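(* Let $(f,w,g)\in\mathcal H=L^2(\mathbb R^-,E_* )\oplus H\oplus L^2(\mathbb R^+,E)$. For $\lambda_0\in\mathbb C^+$, $(\mathcal L-\lambda_0)^{-1}(f,w,g)=(v_-,u,v_+)$ with $$v_-(x)=-i\,\Gamma_*(A^*-\lambda_0)^{-1}w\;e^{-i\lambda_0x}+iS(\lambda_0)\int_0^\infty e^{i\lambda_0(t-x)}g(t)\,dt-i\int_0^xe^{i\lambda_0(t-x)}f(t)\,dt,$$ $$u=(A^*-\lambda_0)^{-1}w-i\big(\Gamma(A-\overline{\lambda_0})^{-1}\big)^*\int_0^\infty e^{i\lambda_0t}g(t)\,dt,$$ $$v_+(x)=i\int_x^\infty e^{i\lambda_0(t-x)}g(t)\,dt.$$ For $\lambda_0\in\mathbb C^-$, $(\mathcal L-\lambda_0)^{-1}(f,w,g)=(v_-,u,v_+)$ with $$v_-(x)=-i\int_{-\infty}^xe^{i\lambda_0(t-x)}f(t)\,dt,$$ $$u=(A-\lambda_0)^{-1}w+i\big(\Gamma_*(A^*-\overline{\lambda_0})^{-1}\big)^*\int_{-\infty}^0e^{i\lambda_0t}f(t)\,dt,$$ $$v_+(x)=i\,e^{-i\lambda_0x}\,\Gamma(A-\lambda_0)^{-1}w-iS^*(\overline{\lambda_0})\int_{-\infty}^0e^{i\lambda_0(t-x)}f(t)\,dt-i\int_0^xe^{i\lambda_0(t-x)}g(t)\,dt.$$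
   Context: Inner products are linear in the first argument. $\mathbb C^\pm=\{z:\pm\Im z>0\}$, $\mathbb R^-=(-\infty,0)$, $\mathbb R^+=(0,\infty)$. A densely defined operator $A$ in a Hilbert space $H$ is dissipative if $\Im\langle Ah,h\rangle\ge 0$ for all $h\in D(A)$, and maximal dissipative if it is dissipative and has no non-trivial dissipative extension; then $\mathbb C^-\subseteq\rho(A)$ and $\mathbb C^+\subseteq\rho(A^* )$. Throughout $A$ is a maximal dissipative operator on $H$. $E,E_*$ are Hilbert spaces and $\Gamma:D(A)\to E$, $\Gamma_*:D(A^* )\to E_*$ are fixed linear operators, bounded in the graph norms of $A$ and $A^*$ respectively, with dense ranges, such that $\langle Au,v\rangle-\langle u,Av\rangle=i\langle\Gamma u,\Gamma v\rangle_E$ for all $u,v\in D(A)$ and $\langle A^*u,v\rangle-\langle u,A^*v\rangle=-i\langle\Gamma_*u,\Gamma_*v\rangle_{E_*}$ for all $u,v\in D(A^* )$. (Any such choice is allowed.) For $z\in\rho(A^* )$, $S(z):E\to E_*$ is the bounded operator determined by $S(z)\Gamma u=\Gamma_*(A^*-z)^{-1}(A-z)u$ for $u\in D(A)$ (extended from $\mathrm{Ran}\,\Gamma$ to $E$ by continuity); $S^*(z)$ denotes $(S(z))^*$. The operator $\mathcal L$ on $\mathcal H$: fix $\mu\in\mathbb C^-$ and $\lambda\in\mathbb C^+$ (the definition does not depend on this choice). $D(\mathcal L)$ is the set of all $U=(v_-,u,v_+)\in\mathcal H$ such that $u\in H$, $v_+\in H^1(\mathbb R^+,E)$, $v_-\in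 H^1(\mathbb R^-,E_* )$, $u+(\Gamma_*(A^*+\mu)^{-1})^*v_-(0)\in D(A)$, $u+(\Gamma(A+\lambda)^{-1})^*v_+(0)\in D(A^* )$, and (I) $v_+(0)=S^*(-\mu)v_-(0)+i\Gamma\big(u+(\Gamma_*(A^*+\mu)^{-1})^*v_-(0)\big)$, (II) $v_-(0)=S(-\bar\lambda)v_+(0)-i\Gamma_*\big(u+(\Gamma(A+\lambda)^{-1})^*v_+(0)\big)$. For $U\in D(\mathcal L)$, $\mathcal L U=(iv_-',\,TU,\,iv_+')$, where $$TU=A^*\big(u+(\Gamma(A+\lambda)^{-1})^*v_+(0)\big)+\bar\lambda(\Gamma(A+\lambda)^{-1})^*v_+(0).$$ On $D(\mathcal L)$ one also has the equal expression $TU=A\big(u+(\Gamma_*(A^*+\mu)^{-1})^*v_-(0)\big)+\bar\mu(\Gamma_*(A^*+\mu)^{-1})^*v_-(0)$. *)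

(* Defs.v *)
From HB Require Import structures.
From mathcomp Require Import all_boot all_order all_algebra.
From mathcomp Require Import sesquilinear complex.
From mathcomp Require Import all_classical all_reals all_analysis.

Set Implicit Arguments.
Unset Strict Implicit.
Unset Printing Implicit Defensive.

Import Order.TTheory GRing.Theory Num.Theory.
Import numFieldNormedType.Exports.

Local Open Scope classical_set_scope.
Local Open Scope ring_scope.
Local Open Scope complex_scope.

(** * Hilbert spaces *)

(* [{dot E for _}] is linear in its first argument. *)
HB.mixin Record isHilbert (R : realType) E of CompleteNormedModule R[i] E := {
  hdot : {dot E for (@conjc R)} ;
  hdot_norm : forall x : E, `|x| ^+ 2 = hdot x x
}.

#[short(type="hilbertType")]
HB.structure Definition Hilbert (R : realType) :=
  {E of isHilbert R E & CompleteNormedModule R[i] E}.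

Notation "<[ x , y ]>" := (hdot x y) (at level 0, format "<[ x ,  y ]>")
  : ring_scope.

(* The norm of [E] takes its values in [R[i]]; this is the same number in [R]. *)
Definition hnorm (R : realType) (E : hilbertType R) (x : E) : R :=
  complex.Re `|x|.

(** * Operators *)

(* Adjoints, resolvents and the function S are total functions, equal to 0 where
   the object they denote does not exist. *)

Section Operators.
Context (R : realType).
Implicit Types (H E F : hilbertType R).

(* The values of [op_fun] outside [op_dom] are irrelevant. *)
Record operator H := Operator { op_dom : set H ; op_fun :> H -> H }.

Definition linear_on (U V : lmodType R[i]) (D : set U) (f : U -> V) : Prop :=
  [/\ D 0,
      forall a u v, D u -> D v -> D (a *: u + v) &
      forall a u v, D u -> D v -> f (a *: u + v) = a *: f u + f v].

Definition bounded_operator E F (T : E -> F) : Prop :=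
  linear T /\ exists M : R, forall x, hnorm (T x) <= M * hnorm x.

Definition badjoint E F (T : E -> F) (y : F) : E :=
  xget 0 [set x | forall u, <[T u, y]> = <[u, x]>].

Definition adjoint H (A : operator H) : operator H :=
  Operator
    [set v | exists w, forall u, op_dom A u -> <[A u, v]> = <[u, w]>]
    (fun v => xget 0 [set w | forall u, op_dom A u -> <[A u, v]> = <[u, w]>]).

Definition resolvent H (A : operator H) (z : R[i]) (w : H) : H :=
  xget 0 [set u | op_dom A u /\ A u - z *: u = w].

Definition dissipative H (A : operator H) : Prop :=
  [/\ linear_on (op_dom A) A, dense (op_dom A) &
      forall h, op_dom A h -> 0 <= complex.Im <[A h, h]>].

Definition extends H (B A : operator H) : Prop :=
  op_dom A `<=` op_dom B /\ forall u, op_dom A u -> B u = A u.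

Definition maximal_dissipative H (A : operator H) : Prop :=
  dissipative A /\
  forall B : operator H, dissipative B -> extends B A ->
    op_dom B `<=` op_dom A.

Definition graph_bounded H E (A : operator H) (G : H -> E) : Prop :=
  exists M : R, forall u, op_dom A u ->
    hnorm (G u) <= M * Num.sqrt (hnorm u ^+ 2 + hnorm (A u) ^+ 2).

(* Below [c] is [i] for (A, Gamma) and [-i] for (A^*, Gamma_* ). *)
Definition boundary_operator H E (c : R[i]) (A : operator H) (G : H -> E) :
    Prop :=
  [/\ linear_on (op_dom A) G,
      graph_bounded A G,
      dense (G @` op_dom A) &
      forall u v, op_dom A u -> op_dom A v ->
        <[A u, v]> - <[u, A v]> = c * <[G u, G v]>].

(* S(z), the bounded extension of Gamma u |-> Gamma_* (A^* - z)^-1 (A - z) u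
   from the dense range of Gamma; meaningful for z in the resolvent set of
   A^*. *)
Definition char_fun H E F (A : operator H) (G : H -> E) (Gs : H -> F)
    (z : R[i]) : E -> F :=
  xget (fun=> 0) [set T | bounded_operator T /\
    forall u, op_dom A u ->
      T (G u) = Gs (resolvent (adjoint A) z (A u - z *: u))].

End Operators.

(** * Vector-valued functions on subsets of the real line *)

Section VectorValued.
Context (R : realType) (E : hilbertType R).
Implicit Types (D : set R) (f g : R -> E) (a b : R) (c : E).

Local Notation mu := (@lebesgue_measure R).

Definition cexp (z : R[i]) : R[i] :=
  (expR (complex.Re z))%:C * (cos (complex.Im z) +i* sin (complex.Im z)).

Definition simple_fun f : Prop :=
  finite_set (range f) /\ forall e : E, measurable (f @^-1` [set e]).

(* If [f] is integrable on [D], only the term [e = 0] can have infinite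
   measure. *)
Definition simple_integral D f : E :=
  \sum_(e \in range f) (fine (mu (D `&` f @^-1` [set e])))%:C *: e.

(* Elements of L^2 are represented by Borel functions; every class has such a
   representative. *)
Definition strongly_measurable D f : Prop :=
  exists s : nat -> R -> E,
    (forall n, simple_fun (s n)) /\
    (forall x, D x -> s n x @[n --> \oo] --> f x).

Definition is_bochner D f (v : E) : Prop :=
  exists s : nat -> R -> E,
    [/\ forall n, simple_fun (s n),
        forall x, D x -> s n x @[n --> \oo] --> f x,
        forall n, (\int[mu]_(x in D) (hnorm (s n x))%:E < +oo)%E,
        (\int[mu]_(x in D) (hnorm (f x - s n x))%:E)%E @[n --> \oo] --> 0%E &
        simple_integral D (s n) @[n --> \oo] --> v].

Definition bochner D f : E := xget 0 [set v | is_bochner D f v].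

Definition oriented_bochner a b f : E :=
  if a <= b then bochner `]a, b[ f else - bochner `]b, a[ f.

Definition L2 D f : Prop :=
  strongly_measurable D f /\
  (\int[mu]_(x in D) ((hnorm (f x)) ^+ 2)%:E < +oo)%E.

Definition ae_eq_on D f g : Prop := {ae mu, forall x, D x -> f x = g x}.

(* [v] is in H^1(D, E), where [D] is an open half-line ending at 0, with
   boundary value [c] at 0 and derivative [v']: up to a null set, [v] is the
   absolutely continuous function with these data. *)
Definition H1_data D (v : R -> E) c (v' : R -> E) : Prop :=
  [/\ L2 D v, L2 D v' &
      {ae mu, forall x, D x -> v x = c + oriented_bochner 0 x v'}].

Definition H1 D v : Prop := exists c v', H1_data D v c v'.

(* [c] is unique, and [v'] is unique up to a.e. equality. *)
Definition trace0 D v : E := xget 0 [set c | exists v', H1_data D v c v'].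

Definition weak_deriv D v : R -> E :=
  xget (fun=> 0) [set v' | exists c, H1_data D v c v'].

End VectorValued.

Notation Rneg := (`]-oo, 0[%classic).
Notation Rpos := (`]0, +oo[%classic).

(** * The operator L *)

Section Dilation.
Context (R : realType) (H E Es : hilbertType R).

(* Triples (v_-, u, v_+); the outer components matter only up to a.e. equality
   on R^- and R^+. *)
Record triple := Triple { vminus : R -> Es ; vmid : H ; vplus : R -> E }.

Definition in_dilation_space (U : triple) : Prop :=
  L2 Rneg (vminus U) /\ L2 Rpos (vplus U).

Definition dilation_eq (U V : triple) : Prop :=
  [/\ ae_eq_on Rneg (vminus U) (vminus V), vmid U = vmid V &
      ae_eq_on Rpos (vplus U) (vplus V)].

Definition triple_subZ (U : triple) (z : R[i]) (V : triple) : triple :=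
  Triple (fun x => vminus U x - z *: vminus V x)
         (vmid U - z *: vmid V)
         (fun x => vplus U x - z *: vplus V x).

Context (A : operator H) (G : H -> E) (Gs : H -> Es) (mu la : R[i]).

Local Notation As := (adjoint A).
Local Notation S := (char_fun A G Gs).

(* (Gamma (A - z)^-1)^* and (Gamma_* (A^* - z)^-1)^* *)
Definition Gres_adj (z : R[i]) : E -> H :=
  badjoint (fun h => G (resolvent A z h)).
Definition Gsres_adj (z : R[i]) : Es -> H :=
  badjoint (fun h => Gs (resolvent As z h)).

Definition L_dom (U : triple) : Prop :=
  let v0m := trace0 Rneg (vminus U) in
  let v0p := trace0 Rpos (vplus U) in
  let um := vmid U + Gsres_adj (- mu) v0m in
  let up := vmid U + Gres_adj (- la) v0p in
  [/\ H1 Rneg (vminus U) /\ H1 Rpos (vplus U),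
      op_dom A um,
      op_dom As up,
      v0p = badjoint (S (- mu)) v0m + 'i%C *: G um &
      v0m = S (- la^*) v0p - 'i%C *: Gs up].

Definition L_fun (U : triple) : triple :=
  let v0p := trace0 Rpos (vplus U) in
  Triple
    (fun x => 'i%C *: weak_deriv Rneg (vminus U) x)
    (As (vmid U + Gres_adj (- la) v0p) + la^* *: Gres_adj (- la) v0p)
    (fun x => 'i%C *: weak_deriv Rpos (vplus U) x).

(* (L - z)^-1 W = U: U is the one solution in D(L), up to equality in the
   dilation space, of (L - z) U = W. *)
Definition L_resolvent_at (z : R[i]) (W U : triple) : Prop :=
  [/\ L_dom U,
      dilation_eq (triple_subZ (L_fun U) z U) W &
      forall V, L_dom V -> dilation_eq (triple_subZ (L_fun V) z V) W ->
        dilation_eq V U].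

End Dilation.

(* Main.v *)
Require Import Defs.
From mathcomp Require Import all_boot all_order all_algebra.
From mathcomp Require Import sesquilinear complex.
From mathcomp Require Import all_classical all_reals all_analysis.
From mathcomp Require Import measurable_realfun ring lra.

Set Implicit Arguments.
Unset Strict Implicit.
Unset Printing Implicit Defensive.

Import Order.TTheory GRing.Theory Num.Theory.
Import numFieldNormedType.Exports.

Local Open Scope classical_set_scope.
Local Open Scope ring_scope.
Local Open Scope complex_scope.

(** The resolvent equation [(L - z) U = (f, w, g)] consists of three equations.
    The outer two are [i v' - z v = F] on a half-line; they do not see [H], and
    their solutions are given by Duhamel's formula
    [v x = e^(-izx) (v 0 - i int_0^x e^(izt) F t dt)] in terms of the boundary
    value [v 0].  The middle equation and the two boundary conditions in the
    domain of [L] then link the boundary values to [u].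

    Let [Im z > 0].  On the right half-line [e^(-izx)] grows, so a square
    integrable solution exists for one boundary value only, namely
    [e = i int_0^oo e^(izt) g t dt], and it is
    [v_+ x = i int_x^oo e^(iz(t-x)) g t dt].  On the left half-line [e^(-izx)]
    decays and every boundary value is allowed.  With [e] known, the middle
    equation determines [u + (Gamma (A + la)^-1)^* e] because [A^* - z] is
    injective; hence it determines [u], then [v_-(0)] through the boundary
    condition that expresses it by [v_+(0)] and [u], then [v_-].  This is
    uniqueness.  For [Im z < 0] the two half-lines exchange their roles,
    and the same argument needs the second expression of the action of [L] on
    [u], in which [A] replaces [A^*] ([boundary_actions]).

    That the formulas do solve the equation is a matter of operator theory
    ([boundary_solve]).  With [a = (A^* - z)^-1 w],
    [u = a - (Gamma (A - z^* )^-1)^* e] and [v_-(0) = - i Gamma_* a + S(z) e],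
    the claims concern the operators [(Gamma (A - z^* )^-1)^*],
    [(Gamma_* (A^* - z)^-1)^*], [S(z)] and [S(z)^*], composed with one another
    and applied to vectors [e] of [E].  These operators are bounded and [Gamma]
    has dense range, so it is enough to check the identities for [e = Gamma h]
    with [h] in [D(A)].  There Green's formula evaluates each of them in terms
    of resolvents, and the resolvent identity ends the computation.  Exchanging
    [A] with [A^*] and [i] with [-i] turns the case [Im z > 0] into the case
    [Im z < 0], so the computation is made once, for a symmetric structure
    [boundary_pair].

    The analysis rests on two facts.  Convolution with [e^(- k |x|)] maps [L^2]
    to [L^2] ([laplace_convolution_L2]), so Duhamel's formula stays in [L^2] on
    the decaying side and for the distinguished boundary value on the growing
    side.  The boundary value and the derivative of an [H^1] function are unique
    ([H1_data_uniq]), so that the formulas can be compared with the operator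
    [L].  Vector-valued integrals are handled throughout by pairing with a fixed
    vector, which turns them into integrals of real functions
    ([bochner_rdot]). *)

(** * Inner products and sequential convergence *)

Section HilbertBasics.
Context (R : realType) (E : hilbertType R).
Implicit Types (x y z : E) (a b : R[i]) (r s : R).

(** The real part of the inner product.  Working with it keeps inequalities and
    limits among the reals, and it determines the inner product. *)
Definition rdot x y : R := complex.Re <[x, y]>.

Lemma hdotC x y : <[x, y]> = conjc <[y, x]>.
Proof.
have := @hermitian_subproof _ _ _ _ (hdot (s := E)) x y.
by rewrite /= mul1r.
Qed.

Lemma hdotDl x y z : <[x + y, z]> = <[x, z]> + <[y, z]>.
Proof. exact: linearDl. Qed.
Lemma hdotDr x y z : <[x, y + z]> = <[x, y]> + <[x, z]>.
Proof. exact: linearDr. Qed.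
Lemma hdotNl x y : <[- x, y]> = - <[x, y]>.
Proof. exact: linearNl. Qed.
Lemma hdotNr x y : <[x, - y]> = - <[x, y]>.
Proof. exact: linearNr. Qed.
Lemma hdotBl x y z : <[x - y, z]> = <[x, z]> - <[y, z]>.
Proof. exact: linearBl. Qed.
Lemma hdotBr x y z : <[x, y - z]> = <[x, y]> - <[x, z]>.
Proof. exact: linearBr. Qed.
Lemma hdot0l x : <[0, x]> = 0.
Proof. exact: linear0l. Qed.
Lemma hdot0r x : <[x, 0]> = 0.
Proof. exact: linear0r. Qed.
Lemma hdotZl a x y : <[a *: x, y]> = a * <[x, y]>.
Proof. by rewrite linearZl_LR. Qed.
Lemma hdotZr a x y : <[x, a *: y]> = conjc a * <[x, y]>.
Proof. by rewrite linearZr_LR. Qed.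

Lemma cReD a b : complex.Re (a + b) = complex.Re a + complex.Re b.
Proof. by case: a; case: b. Qed.
Lemma cImD a b : complex.Im (a + b) = complex.Im a + complex.Im b.
Proof. by case: a; case: b. Qed.
Lemma cReN a : complex.Re (- a) = - complex.Re a.
Proof. by case: a. Qed.
Lemma cImN a : complex.Im (- a) = - complex.Im a.
Proof. by case: a. Qed.
Lemma cReM a b : complex.Re (a * b) =
  complex.Re a * complex.Re b - complex.Im a * complex.Im b.
Proof. by case: a; case: b. Qed.
Lemma cImM a b : complex.Im (a * b) =
  complex.Re a * complex.Im b + complex.Im a * complex.Re b.
Proof. by case: a; case: b. Qed.
Lemma cReJ a : complex.Re (conjc a) = complex.Re a.
Proof. by case: a. Qed.
Lemma cImJ a : complex.Im (conjc a) = - complex.Im a.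
Proof. by case: a. Qed.

Lemma rdotC x y : rdot x y = rdot y x.
Proof. by rewrite /rdot hdotC cReJ. Qed.
Lemma rdotDl x y z : rdot (x + y) z = rdot x z + rdot y z.
Proof. by rewrite /rdot hdotDl cReD. Qed.
Lemma rdotDr x y z : rdot x (y + z) = rdot x y + rdot x z.
Proof. by rewrite /rdot hdotDr cReD. Qed.
Lemma rdotNl x y : rdot (- x) y = - rdot x y.
Proof. by rewrite /rdot hdotNl cReN. Qed.
Lemma rdotNr x y : rdot x (- y) = - rdot x y.
Proof. by rewrite /rdot hdotNr cReN. Qed.
Lemma rdotBl x y z : rdot (x - y) z = rdot x z - rdot y z.
Proof. by rewrite rdotDl rdotNl. Qed.
Lemma rdotBr x y z : rdot x (y - z) = rdot x y - rdot x z.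
Proof. by rewrite rdotDr rdotNr. Qed.
Lemma rdot0l x : rdot 0 x = 0.
Proof. by rewrite /rdot hdot0l. Qed.
Lemma rdotZl r x y : rdot (r%:C *: x) y = r * rdot x y.
Proof. by rewrite /rdot hdotZl cReM /= mul0r subr0. Qed.
Lemma rdotZr r x y : rdot x (r%:C *: y) = r * rdot x y.
Proof. by rewrite rdotC rdotZl rdotC. Qed.
Lemma rdotZJ a x y : rdot (a *: x) y = rdot x (conjc a *: y).
Proof. by rewrite /rdot hdotZl hdotZr conjcK. Qed.

Lemma hdotE x y : <[x, y]> = rdot x y +i* rdot x ('i%C *: y).
Proof.
apply/eqP; rewrite eq_complex /rdot /= eqxx /= hdotZr cReM /=; apply/eqP.
by rewrite mul0r sub0r mulN1r opprK.
Qed.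

Lemma normE x : `|x| = (hnorm x)%:C.
Proof. by rewrite /hnorm RRe_real// ger0_real. Qed.

Lemma hnorm_ge0 x : 0 <= hnorm x.
Proof. by rewrite -ler0c -normE. Qed.

Lemma hnorm_sqr x : hnorm x ^+ 2 = rdot x x.
Proof. by rewrite /rdot -hdot_norm normE !expr2 cReM /= mul0r subr0. Qed.

Lemma hnorm0 : hnorm (0 : E) = 0.
Proof. by rewrite /hnorm normr0. Qed.

Lemma hnorm_eq0 x : hnorm x = 0 -> x = 0.
Proof. by move=> x0; apply/eqP; rewrite -normr_eq0 normE x0. Qed.

Lemma hnormN x : hnorm (- x) = hnorm x.
Proof. by rewrite /hnorm normrN. Qed.

Lemma hnormB x y : hnorm (x - y) = hnorm (y - x).
Proof. by rewrite -hnormN opprB. Qed.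

Lemma hnormD x y : hnorm (x + y) <= hnorm x + hnorm y.
Proof. by have := ler_normD x y; rewrite !normE -rmorphD/= lecR. Qed.

Lemma hnormZ a x : hnorm (a *: x) = complex.Re `|a| * hnorm x.
Proof.
by rewrite /hnorm normrZ cReM (ger0_Im (normr_ge0 a)) mul0r subr0.
Qed.

Lemma hnorm_triangle x y z : hnorm (x - z) <= hnorm (x - y) + hnorm (y - z).
Proof. by apply: le_trans (hnormD _ _); rewrite addrA subrK. Qed.

Lemma rdot_le x y : rdot x y <= hnorm x * hnorm y.
Proof.
have := hnormD x y; rewrite -ler_sqr ?nnegrE ?addr_ge0 ?hnorm_ge0//.
rewrite sqrrD !hnorm_sqr rdotDl !rdotDr (rdotC y x); lra.
Qed.

Lemma CS_rdot x y : `|rdot x y| <= hnorm x * hnorm y.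
Proof. by rewrite ler_norml rdot_le andbT lerNl -rdotNl -(hnormN x) rdot_le. Qed.

Lemma rdot_inj x y : (forall e, rdot x e = rdot y e) -> x = y.
Proof.
move=> xy; apply/subr0_eq/hnorm_eq0/eqP; rewrite -sqrf_eq0 hnorm_sqr.
by rewrite rdotBl xy subrr.
Qed.

Lemma hdot_inj x y : (forall e, <[x, e]> = <[y, e]>) -> x = y.
Proof. by move=> xy; apply: rdot_inj => e; rewrite /rdot xy. Qed.

(** Convergence in norm with a real radius: the norm of a Hilbert space takes its
    values in the partially ordered field [R[i]]. *)
Definition hcvg (u : nat -> E) (x : E) := forall r, 0 < r ->
  exists N, forall n, (N <= n)%N -> hnorm (u n - x) < r.

Definition hcauchy (u : nat -> E) := forall r, 0 < r ->
  exists N, forall n m, (N <= n)%N -> (N <= m)%N -> hnorm (u n - u m) < r.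

Lemma cgt0 (e : R[i]) : 0 < e -> exists2 r, 0 < r & e = r%:C.
Proof.
move=> e0; exists (complex.Re e); first by move: e0; rewrite ltcE => /andP[].
by rewrite RRe_real// gtr0_real.
Qed.

Lemma hcvgP (u : nat -> E) x : u n @[n --> \oo] --> x <-> hcvg u x.
Proof.
split.
  move/cvgrPdist_lt => + r r0 => /(_ r%:C); rewrite ltcR => /(_ r0)[N _ uN].
  by exists N => n Nn; have := uN _ Nn; rewrite /= normE ltcR hnormB.
move=> ux; apply/cvgrPdist_lt => e /cgt0[r r0 ->]; have [N uN] := ux _ r0.
by exists N => // n /= Nn; rewrite normE ltcR hnormB uN.
Qed.

Lemma hcauchy_cvg (u : nat -> E) : hcauchy u -> exists x, hcvg u x.
Proof.
move=> uC.
have /cvg_ex[x ux] : cvg (u n @[n --> \oo]).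
  apply/cauchy_cvgP/cauchy_ballP => e /cgt0[r r0 ->].
  have [N uN] := uC _ r0.
  exists ([set u n | n in [set n | (N <= n)%N]],
          [set u n | n in [set n | (N <= n)%N]]) => /=.
    by split; exists N => // n /= Nn; exists n.
  case=> _ _ /= [[n Nn <-] [m Nm <-]].
  by rewrite -ball_normE /= normE ltcR uN.
by exists x; apply/hcvgP.
Qed.

Lemma hcvg_rdot u x e r : hcvg u x -> 0 < r ->
  exists N, forall n, (N <= n)%N -> `|rdot (u n) e - rdot x e| < r.
Proof.
move=> ux r0; have e0 : 0 < hnorm e + 1 by rewrite ltr_wpDl ?hnorm_ge0.
have [N uN] := ux (r / (hnorm e + 1)) (divr_gt0 r0 e0).
exists N => n /uN; rewrite -rdotBl ltr_pdivlMr// => h.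
apply: le_lt_trans (CS_rdot _ _) (le_lt_trans _ h).
by rewrite ler_wpM2l ?hnorm_ge0// lerDl.
Qed.

Lemma hcvg_rdot_cvg u x e : hcvg u x -> rdot (u n) e @[n --> \oo] --> rdot x e.
Proof.
move=> ux; apply/cvgrPdist_lt => r r0; have [N uN] := hcvg_rdot e ux r0.
by exists N => // n /= Nn; rewrite distrC uN.
Qed.

Lemma hcvg_uniq u x y : hcvg u x -> hcvg u y -> x = y.
Proof.
move=> ux uy; apply: rdot_inj => e.
exact: (cvg_unique (@norm_hausdorff _ _) (hcvg_rdot_cvg ux) (hcvg_rdot_cvg uy)).
Qed.

Lemma denseP (S : set E) : dense S <->
  forall x r, 0 < r -> exists2 y, S y & hnorm (x - y) < r.
Proof.
split.
  move=> dS x r r0; have r0' : 0 < r%:C :> R[i] by rewrite ltcR.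
  have [|y [yb Sy]] := dS (ball x r%:C) _ (ball_open x _).
    by exists x; exact: ballxx.
  by exists y => //; move: yb; rewrite -ball_normE /= normE ltcR.
move=> dS O [x Ox] Oo.
have /nbhs_ballP[e /= /cgt0[r r0 ->] rO] := open_nbhs_nbhs (conj Oo Ox).
have [y Sy xy] := dS x r r0; exists y; split => //; apply: rO.
by rewrite -ball_normE /= normE ltcR.
Qed.

Lemma dense_seq (S : set E) x : dense S -> exists2 u, (forall n, S (u n)) & hcvg u x.
Proof.
move=> /denseP dS.
have /choice[u uP] : forall n : nat, exists y, S y /\ hnorm (x - y) < n.+1%:R^-1.
  by move=> n; have [|y] := dS x n.+1%:R^-1; [rewrite invr_gt0|exists y].
exists u => [n|r r0]; first exact: (uP n).1.
have [N] := ltr_add_invr r0; rewrite add0r => rN.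
exists N => n Nn; rewrite hnormB.
apply: lt_trans (uP n).2 (le_lt_trans _ rN).
by rewrite lef_pV2 ?posrE// ler_nat ltnS.
Qed.

Lemma dense_rdot0 (S : set E) x : dense S -> (forall y, S y -> rdot y x = 0) ->
  x = 0.
Proof.
move=> /(dense_seq x)[u uS ux] xS; apply/hnorm_eq0/eqP.
rewrite -sqrf_eq0 hnorm_sqr; apply/eqP.
have uxx := hcvg_rdot_cvg (e := x) ux.
have u0 : (fun n => rdot (u n) x) = fun=> 0 by apply/funext => n; exact: xS.
rewrite u0 in uxx; apply: (cvg_unique (@norm_hausdorff _ _) uxx).
exact: cvg_cst.
Qed.

End HilbertBasics.

(** * The Riesz representation theorem and bounded operators *)

Section Riesz.
Context (R : realType) (E : hilbertType R).
Implicit Types (K : set E) (phi : E -> R).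

(** The vector that represents [phi] on [K] minimises
    [J u = |u|^2 - 2 phi u]: minimising sequences are Cauchy by the parallelogram
    law, and [J] is stationary at their limit.  A closed subspace [K] covers both
    the representation theorem ([K] the whole space) and the orthogonal
    projection ([phi] an inner product). *)
Lemma riesz_closed K phi M :
  K 0 -> (forall (a : R[i]) u v, K u -> K v -> K (a *: u + v)) ->
  (forall s x, (forall n, K (s n)) -> hcvg s x -> K x) ->
  (forall (r : R) u v, K u -> K v -> phi (r%:C *: u + v) = r * phi u + phi v) ->
  (forall u, K u -> phi u <= M * hnorm u) ->
  exists2 v, K v & forall u, K u -> phi u = rdot u v.
Proof.
move=> K0 Klin Kcl philin phiM.
pose J u := hnorm u ^+ 2 - 2 * phi u.
pose S := J @` K.
have SlbM : lbound S (- M ^+ 2).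
  move=> _ [u Ku <-]; rewrite /J.
  have := phiM _ Ku; have := sqr_ge0 (hnorm u - M); rewrite sqrrB; nra.
have Sinf : has_inf S by split; [exists (J 0), 0|exists (- M ^+ 2)].
pose m := inf S.
have Jm u : K u -> m <= J u.
  by move=> Ku; apply: ge_inf; [exists (- M ^+ 2)|exists u].
have /choice[s sP] : forall n : nat, exists u, K u /\ J u < m + n.+1%:R^-1.
  move=> n; have n0 : 0 < n.+1%:R^-1 :> R by rewrite invr_gt0.
  by have [_ [u Ku <-] Ju] := inf_adherent n0 Sinf; exists u.
have sK n := (sP n).1; have sJ n := (sP n).2.
(* the parallelogram law for [a] and [b], since [J] is at least [m] at their midpoint *)
have par a b : K a -> K b -> hnorm (a - b) ^+ 2 <= 2 * (J a + J b - 2 * m).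
  move=> Ka Kb.
  have phD : phi (a + b) = phi a + phi b.
    by have := philin 1 a b Ka Kb; rewrite scale1r mul1r.
  have KD : K (a + b) by rewrite -(scale1r a); exact: Klin.
  have phh : phi ((2^-1)%:C *: (a + b)) = 2^-1 * phi (a + b).
    rewrite -[_ *: _]addr0 philin//.
    have ph0 : phi 0 = 0.
      have := philin 1 0 0 K0 K0; rewrite scaler0 addr0; lra.
    by rewrite ph0 addr0.
  have : m <= J ((2^-1)%:C *: (a + b)).
    by apply: Jm; rewrite -[_ *: _]addr0; exact: Klin.
  rewrite /J phh phD !hnorm_sqr rdotZl rdotZr rdotBl !rdotBr rdotDl !rdotDr.
  rewrite (rdotC b a); lra.
have sC : hcauchy s.
  move=> r r0; have r2 : 0 < r ^+ 2 / 4 by rewrite divr_gt0// exprn_gt0.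
  have [N] := ltr_add_invr r2; rewrite add0r => rN.
  exists N => p q Np Nq.
  rewrite -ltr_sqr ?nnegrE ?hnorm_ge0 ?(ltW r0)//.
  apply: le_lt_trans (par _ _ (sK p) (sK q)) _.
  have le_inv k : (N <= k)%N -> k.+1%:R^-1 <= N.+1%:R^-1 :> R.
    by move=> Nk; rewrite lef_pV2 ?posrE// ler_nat ltnS.
  have Jr k : (N <= k)%N -> J (s k) < m + r ^+ 2 / 4.
    by move=> Nk; apply: lt_le_trans (sJ k) _; rewrite lerD2l (le_trans (le_inv _ Nk))// ltW.
  have := Jr _ Np; have := Jr _ Nq; lra.
have [v sv] := hcauchy_cvg sC.
have Kv := Kcl _ _ sK sv.
exists v => // u Ku.
(* [J (v + t u) - J v], expanded in [t] *)
have key (t : R) : 0 <= 2 * t * (rdot v u - phi u) + t ^+ 2 * hnorm u ^+ 2.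
  have lim : (2 * t * (rdot (s n) u - phi u) + t ^+ 2 * hnorm u ^+ 2
                + n.+1%:R^-1) @[n --> \oo]
      --> 2 * t * (rdot v u - phi u) + t ^+ 2 * hnorm u ^+ 2 + 0.
    apply: cvgD; last exact: cvg_harmonic.
    apply: cvgD; last exact: cvg_cst.
    apply: cvgMr; apply: cvgB; last exact: cvg_cst.
    exact: hcvg_rdot_cvg.
  rewrite addr0 in lim; rewrite -(cvg_lim _ lim)//; apply: limr_ge.
    exact: cvgP lim.
  apply: nearW => n.
  have := Jm (t%:C *: u + s n) (Klin _ _ _ Ku (sK n)); have := sJ n.
  rewrite /J philin// !hnorm_sqr rdotDl !rdotDr rdotZl !rdotZr rdotZl.
  rewrite (rdotC u (s n)); move: (n.+1%:R^-1) => e; lra.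
have u1 : 0 < hnorm u ^+ 2 + 1 by rewrite ltr_wpDl// sqr_ge0.
(* the vertex of the parabola, up to the [+ 1] that avoids a division by zero *)
have := key (- (rdot v u - phi u) / (hnorm u ^+ 2 + 1)).
set d := rdot v u - phi u; set N := hnorm u ^+ 2 + 1.
have -> : 2 * (- d / N) * d + (- d / N) ^+ 2 * hnorm u ^+ 2 =
   - (d ^+ 2) * (N + 1) / N ^+ 2.
  by rewrite /N; field; lra.
rewrite !mulNr oppr_ge0 => h.
have d0 : d ^+ 2 <= 0.
  move: h; rewrite -mulrA pmulr_lle0// divr_gt0 ?exprn_gt0//; rewrite /N; lra.
apply/esym/subr0_eq; rewrite rdotC; apply/eqP; rewrite -sqrf_eq0.
by rewrite eq_le d0 sqr_ge0.
Qed.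

End Riesz.

Section BoundedOps.
Context (R : realType).
Implicit Types (E F G : hilbertType R).

Lemma riesz E (phi : E -> R) M :
  (forall (r : R) u v, phi (r%:C *: u + v) = r * phi u + phi v) ->
  (forall u, phi u <= M * hnorm u) ->
  exists v, forall u, phi u = rdot u v.
Proof.
move=> philin phiM.
have [||||u _|v _ vP] := @riesz_closed R E setT phi M; rewrite //.
by exists v => u; exact: vP.
Qed.

Lemma bopD E F (T : E -> F) : bounded_operator T -> forall x y, T (x + y) = T x + T y.
Proof. by move=> [Tl _] x y; have := Tl 1 x y; rewrite !scale1r. Qed.
Lemma bop0 E F (T : E -> F) : bounded_operator T -> T 0 = 0.
Proof. by move=> /bopD TD; apply: (addrI (T 0)); rewrite -TD !addr0. Qed.
Lemma bopZ E F (T : E -> F) : bounded_operator T -> forall a x, T (a *: x) = a *: T x.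
Proof. by move=> bT a x; rewrite -[a *: x]addr0 bT.1 bop0// addr0. Qed.
Lemma bopN E F (T : E -> F) : bounded_operator T -> forall x, T (- x) = - T x.
Proof. by move=> bT x; rewrite -scaleN1r bopZ// scaleN1r. Qed.
Lemma bopB E F (T : E -> F) : bounded_operator T -> forall x y, T (x - y) = T x - T y.
Proof. by move=> bT x y; rewrite bopD// bopN. Qed.

Lemma bop_bound E F (T : E -> F) : bounded_operator T ->
  exists2 M, 0 < M & forall x, hnorm (T x) <= M * hnorm x.
Proof.
move=> [_ [M TM]]; exists (`|M| + 1); first by rewrite ltr_wpDl.
move=> x; apply: le_trans (TM x) _; rewrite ler_wpM2r ?hnorm_ge0//.
by rewrite (le_trans (ler_norm _))// lerDl.
Qed.

Lemma bop_cvg E F (T : E -> F) u x : bounded_operator T -> hcvg u x ->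
  hcvg (T \o u) (T x).
Proof.
move=> bT ux r r0; have [M M0 TM] := bop_bound bT.
have [N uN] := ux (r / M) (divr_gt0 r0 M0); exists N => n /uN.
by rewrite ltr_pdivlMr// mulrC => h; rewrite /= -bopB//; exact: le_lt_trans (TM _) h.
Qed.

Lemma bop_ext E F (T T' : E -> F) (S : set E) : dense S ->
  bounded_operator T -> bounded_operator T' ->
  (forall x, S x -> T x = T' x) -> forall x, T x = T' x.
Proof.
move=> dS bT bT' TT' x; have [u uS ux] := dense_seq x dS.
apply: (hcvg_uniq (bop_cvg bT ux)).
have -> : T \o u = T' \o u by apply/funext => n /=; rewrite TT'.
exact: bop_cvg.
Qed.

(** The Riesz vector represents the real parts only; applying it to [- i u] as well
    recovers the imaginary parts. *)
Lemma badjointP E F (T : E -> F) : bounded_operator T ->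
  forall u y, <[T u, y]> = <[u, badjoint T y]>.
Proof.
move=> bT u y; rewrite /badjoint; case: xgetP => [x _ /(_ u)//|no].
have [M M0 TM] := bop_bound bT.
have [r a b||v vP] := @riesz E (fun u => rdot (T u) y) (M * hnorm y).
- by rewrite bT.1 rdotDl rdotZl.
- move=> x; apply: le_trans (rdot_le _ _) _.
  by rewrite mulrAC ler_wpM2r ?hnorm_ge0.
exfalso; apply: (no v) => x; rewrite !hdotE vP; congr (_ +i* _).
have iJ : conjc (- 'i%C) = 'i%C :> R[i].
  by apply/eqP; rewrite eq_complex /= !oppr0 opprK !eqxx.
have -> : rdot (T x) ('i%C *: y) = rdot (T ((- 'i%C) *: x)) y.
  by rewrite bopZ// rdotZJ iJ.
by rewrite vP rdotZJ iJ.
Qed.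

Lemma badjoint_uniq E F (T : E -> F) y x : bounded_operator T ->
  (forall u, <[T u, y]> = <[u, x]>) -> badjoint T y = x.
Proof.
by move=> bT Tyx; apply: hdot_inj => e; rewrite hdotC -badjointP// Tyx -hdotC.
Qed.

Lemma badjoint_bounded E F (T : E -> F) : bounded_operator T ->
  bounded_operator (badjoint T).
Proof.
move=> bT; have [M M0 TM] := bop_bound bT; split.
  move=> a x y; apply: badjoint_uniq => // u.
  by rewrite !hdotDr !hdotZr !badjointP.
exists M => y; have [->|n0] := eqVneq (hnorm (badjoint T y)) 0.
  by rewrite mulr_ge0 ?hnorm_ge0// ltW.
have np : 0 < hnorm (badjoint T y) by rewrite lt_neqAle eq_sym n0 hnorm_ge0.
rewrite -(ler_pM2l np) -expr2 hnorm_sqr /rdot -badjointP//.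
apply: le_trans (rdot_le _ _) _.
by rewrite mulrCA mulrA ler_wpM2r ?hnorm_ge0// mulrC (le_trans (TM _))// mulrC.
Qed.

Lemma bop_comp E F G (T : F -> G) (T' : E -> F) : bounded_operator T ->
  bounded_operator T' -> bounded_operator (T \o T').
Proof.
move=> bT bT'; split => [a x y /=|]; first by rewrite bT'.1 bT.1.
have [M M0 TM] := bop_bound bT; have [M' M0' TM'] := bop_bound bT'.
exists (M * M') => x; apply: le_trans (TM _) _.
by rewrite -mulrA ler_wpM2l// ltW.
Qed.

Lemma bop_lin E F a (T T' : E -> F) : bounded_operator T ->
  bounded_operator T' -> bounded_operator (fun x => a *: T x + T' x).
Proof.
move=> bT bT'; split.
  by move=> b x y; rewrite bT.1 bT'.1 !scalerDr !scalerA (mulrC a) addrACA.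
have [M M0 TM] := bop_bound bT; have [M' M0' TM'] := bop_bound bT'.
exists (complex.Re `|a| * M + M') => x; apply: le_trans (hnormD _ _) _.
rewrite mulrDl lerD// hnormZ -mulrA ler_wpM2l//.
by have := normr_ge0 a; rewrite lecE => /andP[].
Qed.

Lemma bop_id E : bounded_operator (@id E).
Proof. by split => //; exists 1 => x; rewrite mul1r. Qed.

End BoundedOps.
(** * Maximal dissipative operators *)

Section MaximalDissipative.
Context (R : realType) (H : hilbertType R).
Implicit Types (A : operator H) (u v w x y h : H) (z a : R[i]) (s t : nat -> H).

Lemma cvg_hnorm s x : hcvg s x -> hnorm (s n) @[n --> \oo] --> hnorm x.
Proof.
move=> sx; apply/cvgrPdist_lt => r r0; have [N sN] := sx _ r0.
exists N => // n /= /sN; apply: le_lt_trans; rewrite ler_norml.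
have := hnorm_triangle x (s n) 0; have := hnorm_triangle (s n) x 0.
by rewrite !subr0 (hnormB x); lra.
Qed.

Lemma hcvgD s t x y : hcvg s x -> hcvg t y -> hcvg (s \+ t) (x + y).
Proof. by move=> /hcvgP sx /hcvgP ty; apply/hcvgP; exact: cvgD. Qed.

Lemma hcvg_cst x : hcvg (fun=> x) x.
Proof. by apply/hcvgP; exact: cvg_cst. Qed.

Lemma hcvgZ a s x : hcvg s x -> hcvg (a \*: s) (a *: x).
Proof. by move=> /hcvgP sx; apply/hcvgP; exact: cvgZr. Qed.

Lemma hcvgB s t x y : hcvg s x -> hcvg t y -> hcvg (s \- t) (x - y).
Proof. by move=> /hcvgP sx /hcvgP ty; apply/hcvgP; exact: cvgB. Qed.

Lemma cvg_rdot s t x y : hcvg s x -> hcvg t y ->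
  rdot (s n) (t n) @[n --> \oo] --> rdot x y.
Proof.
have rdotE u v : rdot u v = 2^-1 * (hnorm (u + v) ^+ 2 - hnorm u ^+ 2 - hnorm v ^+ 2).
  by rewrite !hnorm_sqr rdotDl !rdotDr (rdotC v u); lra.
move=> sx ty; rewrite rdotE; under eq_fun do rewrite rdotE.
have sq (r : nat -> H) (p : H) : hcvg r p -> (hnorm (r n) ^+ 2) @[n --> \oo] --> hnorm p ^+ 2.
  by move=> /cvg_hnorm rp; rewrite expr2; under eq_fun do rewrite expr2; exact: cvgM.
apply: cvgMr; apply: cvgB; last exact: sq.
apply: cvgB; last exact: sq.
by apply: sq; exact: hcvgD.
Qed.

Lemma Im_hdot x y : complex.Im <[x, y]> = rdot x ('i%C *: y).
Proof. by rewrite hdotE. Qed.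

Lemma hcvg_Im_ge0 s t x y : hcvg s x -> hcvg t y ->
  (forall n, 0 <= complex.Im <[s n, t n]>) -> 0 <= complex.Im <[x, y]>.
Proof.
move=> sx ty st0; rewrite Im_hdot.
have lim := cvg_rdot sx (hcvgZ 'i%C ty).
rewrite -(cvg_lim _ lim)//; apply: limr_ge; first exact: cvgP lim.
by apply: nearW => n; rewrite -Im_hdot.
Qed.

Lemma norm_i : complex.Re `|'i%C : R[i]| = 1.
Proof. by rewrite normc_def /= expr0n expr1n add0r sqrtr1. Qed.

Lemma Im_hdot_le x y : complex.Im <[x, y]> <= hnorm x * hnorm y.
Proof. by rewrite Im_hdot (le_trans (rdot_le _ _))// hnormZ norm_i mul1r. Qed.

Lemma hdotxx x : <[x, x]> = (hnorm x ^+ 2)%:C.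
Proof. by rewrite -hdot_norm normE rmorphXn. Qed.

Section LinearOn.
Variables (U V : lmodType R[i]) (D : set U) (f : U -> V).
Hypothesis lf : linear_on D f.
Lemma linear_onD p q : D p -> D q -> D (p + q) /\ f (p + q) = f p + f q.
Proof.
case: lf => _ lD lE Dp Dq; have := lE 1 p q Dp Dq; have := lD 1 p q Dp Dq.
by rewrite !scale1r.
Qed.
Lemma linear_on0 : D 0 /\ f 0 = 0.
Proof.
case: (lf) => D0 _ _; split=> //; have [_] := linear_onD D0 D0.
by rewrite addr0 => /eqP; rewrite -subr_eq0 opprD addrA subrr sub0r oppr_eq0 => /eqP.
Qed.
Lemma linear_onZ a p : D p -> D (a *: p) /\ f (a *: p) = a *: f p.
Proof.
have [D0 f0] := linear_on0; case: lf => _ lD lE Dp.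
by have := lE a p 0 Dp D0; have := lD a p 0 Dp D0; rewrite !addr0 f0 addr0.
Qed.
Lemma linear_onB p q : D p -> D q -> D (p - q) /\ f (p - q) = f p - f q.
Proof.
move=> Dp Dq; have [DNq fNq] := linear_onZ (-1) Dq.
by have := linear_onD Dp DNq; rewrite fNq !scaleN1r.
Qed.
End LinearOn.

(** A quadratic polynomial that vanishes at [0] and is nonnegative has no linear term. *)
Lemma linear_term_eq0 (p q : R) : 0 <= q ->
  (forall r : R, 0 <= r * p + r ^+ 2 * q) -> p = 0.
Proof.
move=> q0 /(_ (- p / (q + 1))).
have -> : - p / (q + 1) * p + (- p / (q + 1)) ^+ 2 * q = - (p ^+ 2 / (q + 1) ^+ 2).
  by field; lra.
rewrite oppr_ge0 => h; have q1 : 0 < (q + 1) ^+ 2 by rewrite exprn_gt0// ltr_wpDl.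
apply/eqP; rewrite -sqrf_eq0 eq_le sqr_ge0 andbT.
by move: h; rewrite pmulr_lle0// invr_gt0.
Qed.

(** Dissipativity along [s + r h] gives, in the limit,
    [0 <= r Im <v, h> + r^2 Im <A h, h>] for every real [r], so [v] is orthogonal
    to the dense domain. *)
Lemma dissipative_closable A s v : dissipative A ->
  (forall n, op_dom A (s n)) -> hcvg s 0 -> hcvg (A \o s) v -> v = 0.
Proof.
move=> [Al Ad A0] sD s0 Asv.
have Im0 h : op_dom A h -> complex.Im <[v, h]> = 0.
  move=> Dh; apply: (@linear_term_eq0 _ (complex.Im <[A h, h]>)); first exact: A0.
  move=> r; have [Drh Arh] := linear_onZ Al r%:C Dh.
  have : 0 <= complex.Im <[v + A (r%:C *: h), 0 + r%:C *: h]>.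
    apply: (@hcvg_Im_ge0 ((A \o s) \+ fun=> A (r%:C *: h)) (s \+ fun=> r%:C *: h)).
    - by apply: hcvgD => //; exact: hcvg_cst.
    - by apply: hcvgD => //; exact: hcvg_cst.
    move=> n /=; have [Dsn <-] := linear_onD Al (sD n) Drh; exact: A0.
  rewrite add0r Arh hdotDl hdotZl !hdotZr conjc_real !(cImD, cImM, cReM) /=; lra.
apply: (dense_rdot0 Ad) => h Dh.
have [Dih _] := linear_onZ Al (- 'i%C) Dh.
have := Im0 _ Dih; rewrite Im_hdot scalerA rdotC => <-.
by rewrite mulrN -expr2 sqr_i opprK scale1r.
Qed.

(** If assigning the value [y'] to [y] is compatible with dissipativity, then
    [A] extended to the span of [D(A)] and [y] in this way is dissipative, so [y]
    was in [D(A)] already.  This is the only way in which maximality is used. *)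
Lemma maximal_dissipative_dom A y y' : maximal_dissipative A ->
  (forall h a, op_dom A h -> 0 <= complex.Im <[A h + a *: y', h + a *: y]>) ->
  op_dom A y.
Proof.
move=> [[Al Ad A0] Amax] y0; apply: contrapT => nDy.
pose graph x w := exists h a, [/\ op_dom A h, x = h + a *: y & w = A h + a *: y'].
pose B := Operator [set x | exists w, graph x w] (fun x => xget 0 (graph x)).
have graph_fun x w w' : graph x w -> graph x w' -> w = w'.
  move=> [h [a [Dh -> ->]]] [h' [a' [Dh' e ->]]].
  have e' : (a - a') *: y = h' - h.
    have -> : h' = h + a *: y - a' *: y by rewrite e addrK.
    by rewrite scalerBl addrAC [h + _]addrC addrK.
  have [aa'|naa'] := eqVneq a a'.
    subst a'; move: e'; rewrite subrr scale0r => /esym/subr0_eq ->//.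
  exfalso; apply: nDy.
  have -> : y = (a - a')^-1 *: (h' - h).
    by rewrite -e' scalerA mulVf ?scale1r// subr_eq0.
  have [Dhh _] := linear_onB Al Dh' Dh.
  by have [] := linear_onZ Al (a - a')^-1 Dhh.
have BE x w : graph x w -> B x = w.
  move=> gxw; rewrite /B/=; apply: (graph_fun x) => //.
  by apply: (@xgetPex _ _ (graph x)); exists w.
have gA h : op_dom A h -> graph h (A h).
  by move=> Dh; exists h, 0; rewrite !scale0r !addr0.
have Bdiss : dissipative B.
  split.
  - split.
    + by exists (A 0); apply: gA; have [] := linear_on0 Al.
    + move=> a x x' [w [h [b [Dh -> _]]]] [w' [h' [b' [Dh' -> _]]]].
      have [Dah Aah] := linear_onZ Al a Dh; have [Dahh Aahh] := linear_onD Al Dah Dh'.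
      exists (A (a *: h + h') + (a * b + b') *: y'), (a *: h + h'), (a * b + b').
      by split => //; rewrite scalerDr scalerDl scalerA addrACA.
    + move=> a x x' [w gw] [w' gw']; rewrite (BE _ _ gw) (BE _ _ gw'); apply: BE.
      move: gw gw' => [h [b [Dh -> ->]]] [h' [b' [Dh' -> ->]]].
      have [Dah Aah] := linear_onZ Al a Dh; have [Dahh Aahh] := linear_onD Al Dah Dh'.
      exists (a *: h + h'), (a * b + b'); split => //.
        by rewrite scalerDr scalerDl scalerA addrACA.
      by rewrite Aahh Aah !scalerDr scalerDl scalerA addrACA.
  - move=> O O0 Oo; have [x [Ox Dx]] := Ad _ O0 Oo.
    by exists x; split => //; exists (A x); exact: gA.
  - move=> x [w gw]; rewrite (BE _ _ gw); move: gw => [h [a [Dh -> ->]]].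
    exact: y0.
apply/nDy/(Amax B Bdiss).
  split=> [x Dx|x Dx]; first by exists (A x); exact: gA.
  by apply: BE; exact: gA.
by exists y', 0, 1; have [D0 A00] := linear_on0 Al; rewrite A00 !scale1r !add0r.
Qed.

(** Closedness: the limit point can be added to the graph, hence lies in the
    domain, and the value there is the right one by closability. *)
Lemma maximal_dissipative_closed A s x w : maximal_dissipative A ->
  (forall n, op_dom A (s n)) -> hcvg s x -> hcvg (A \o s) w ->
  op_dom A x /\ A x = w.
Proof.
move=> Am sD sx Asw; have [[Al Ad A0] _] := Am.
have Dx : op_dom A x.
  apply: (maximal_dissipative_dom (y' := w) Am) => h a Dh.
  apply: (@hcvg_Im_ge0 ((fun=> A h) \+ (a \*: (A \o s))) ((fun=> h) \+ (a \*: s))).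
  - by apply: hcvgD; [exact: hcvg_cst|exact: hcvgZ].
  - by apply: hcvgD; [exact: hcvg_cst|exact: hcvgZ].
  move=> n /=; have [Das Aas] := linear_onZ Al a (sD n).
  by have [Dhas] := linear_onD Al Dh Das; rewrite Aas => <-; exact: A0.
split => //; apply/esym/subr0_eq; apply: (@dissipative_closable A (s \- fun=> x)).
- by have [] := Am.
- by move=> n /=; have [] := linear_onB Al (sD n) Dx.
- by rewrite -(subrr x); apply: hcvgB => //; exact: hcvg_cst.
have -> : A \o (s \- fun=> x) = (A \o s) \- fun=> A x.
  by apply/funext => n /=; have [_ ->] := linear_onB Al (sD n) Dx.
by apply: hcvgB => //; exact: hcvg_cst.
Qed.

Lemma dissipative_lower_bound A z u : dissipative A -> complex.Im z < 0 -> op_dom A u ->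
  - complex.Im z * hnorm u <= hnorm (A u - z *: u).
Proof.
move=> [_ _ A0] z0 Du.
have [->|n0] := eqVneq (hnorm u) 0; first by rewrite mulr0 hnorm_ge0.
have np : 0 < hnorm u by rewrite lt_neqAle eq_sym n0 hnorm_ge0.
rewrite -(ler_pM2r np); apply: le_trans (Im_hdot_le _ _).
rewrite hdotBl hdotZl cImD cImN hdotxx cImM /= mulr0 add0r mulNr mulNr -mulrA -expr2.
by rewrite lerDr; exact: A0.
Qed.

(** The range [K] of [A - z] is closed by the lower bound.  If [y] is orthogonal
    to it, then [A] can be extended by [y |-> z^* y], so [y] is in [D(A)] and
    [<A y, y> = z |y|^2], which contradicts dissipativity unless [y = 0]. *)
Lemma maximal_dissipative_range A z w : maximal_dissipative A -> complex.Im z < 0 ->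
  exists2 u, op_dom A u & A u - z *: u = w.
Proof.
move=> Am z0; have [Adis _] := Am; have [Al Ad A0] := Adis.
pose K : set H := [set A u - z *: u | u in op_dom A].
have Klin a u v : K u -> K v -> K (a *: u + v).
  move=> [p Dp <-] [q Dq <-]; have [Dap Aap] := linear_onZ Al a Dp.
  have [Dpq Apq] := linear_onD Al Dap Dq; exists (a *: p + q) => //.
  by rewrite Apq Aap scalerDr scalerBr opprD !scalerA mulrC addrACA.
have K0 : K 0.
  by have [D0 A00] := linear_on0 Al; exists 0 => //; rewrite A00 scaler0 subrr.
have Kcl s x : (forall n, K (s n)) -> hcvg s x -> K x.
  move=> Ks sx.
  have /choice[t tP] : forall n, exists u, op_dom A u /\ A u - z *: u = s n.
    by move=> n; have [u Du us] := Ks n; exists u.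
  have tC : hcauchy t.
    move=> r r0; have e0 : 0 < - complex.Im z * r / 2 by rewrite divr_gt0// mulr_gt0// oppr_gt0.
    have [N sN] := sx _ e0; exists N => n m Nn Nm.
    have [Dtt Att] := linear_onB Al (tP n).1 (tP m).1.
    have := dissipative_lower_bound Adis z0 Dtt.
    have -> : A (t n - t m) - z *: (t n - t m) = s n - s m.
      by rewrite Att -(tP n).2 -(tP m).2 scalerBr !opprB addrACA [RHS]addrACA; congr (_ + _); rewrite addrC.
    have := hnorm_triangle (s n) x (s m); have := sN _ Nn; have := sN _ Nm.
    rewrite (hnormB x) => h1 h2 h3 h4.
    by rewrite -(@ltr_pM2l _ (- complex.Im z)) ?oppr_gt0//; lra.
  have [u tu] := hcauchy_cvg tC.
  have [] := @maximal_dissipative_closed A t u (x + z *: u) Am.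
  - by move=> n; exact: (tP n).1.
  - exact: tu.
  - have -> : A \o t = s \+ (z \*: t).
      by apply/funext => n /=; rewrite -(tP n).2 subrK.
    by apply: hcvgD => //; exact: hcvgZ.
  by move=> Du Au; exists u => //; rewrite Au addrK.
have [r u v _ _|u _|v Kv vP] := @riesz_closed R H K (fun u => rdot u w) (hnorm w) K0 Klin Kcl.
- by rewrite rdotDl rdotZl.
- by rewrite mulrC rdot_le.
pose y := w - v.
have yK k : K k -> <[k, y]> = 0.
  move=> Kk; have Re0 k' : K k' -> rdot k' y = 0.
    by move=> Kk'; rewrite rdotBr vP// subrr.
  have Kik : K (- 'i%C *: k) by rewrite -[_ *: k]addr0; exact: Klin.
  have := Re0 _ Kik; rewrite rdotZJ hdotE Re0//.
  have -> : conjc (- 'i%C) = 'i%C :> R[i].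
    by apply/eqP; rewrite eq_complex /= !oppr0 opprK !eqxx.
  by move=> ->.
have Ay h : op_dom A h -> <[A h, y]> = z * <[h, y]>.
  move=> Dh; have := yK (A h - z *: h); rewrite hdotBl hdotZl => /(_ _)/subr0_eq; apply.
  by exists h.
have Dy : op_dom A y.
  apply: (maximal_dissipative_dom (y' := conjc z *: y) Am) => h a Dh.
  rewrite hdotDl !hdotDr !hdotZr !hdotZl Ay// hdotxx (hdotC y h).
  have := A0 h Dh; rewrite !cImD !(cImM, cReM, cReJ, cImJ) /=.
  set p := complex.Re <[h, y]>; set q := complex.Im <[h, y]>.
  set b := complex.Re a; set d := complex.Im a; have := sqr_ge0 (hnorm y).
  move: (hnorm y ^+ 2) (sqr_ge0 b) (sqr_ge0 d) z0 => n b0 d0 z0 n0 A00.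
  have : 0 <= - complex.Im z * (b ^+ 2 + d ^+ 2) * n.
    by rewrite !mulr_ge0 ?addr_ge0// oppr_ge0 ltW.
  lra.
have y0 : y = 0.
  have := A0 _ Dy; rewrite Ay// hdotxx cImM /= mulr0 add0r => h.
  apply/hnorm_eq0/eqP; rewrite -sqrf_eq0 eq_le sqr_ge0 andbT.
  by rewrite -(nmulr_rge0 _ z0).
by have [u Du uv] := Kv; exists u => //; rewrite uv; apply/esym/subr0_eq.
Qed.

End MaximalDissipative.
(** * Resolvents and adjoints *)

Section Resolvents.
Context (R : realType) (H : hilbertType R).
Implicit Types (A : operator H) (u v w x y h : H) (z a : R[i]).

Definition bijective_at A z :=
  (forall w, exists2 u, op_dom A u & A u - z *: u = w) /\
  (forall u, op_dom A u -> A u - z *: u = 0 -> u = 0).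

Lemma resolventP A z w : bijective_at A z ->
  op_dom A (resolvent A z w) /\ A (resolvent A z w) - z *: resolvent A z w = w.
Proof.
move=> [ex _]; rewrite /resolvent; case: xgetP => [u _ //|no].
by have [u Du uw] := ex w; exfalso; exact: (no u).
Qed.

Lemma resolvent_dom A z w : bijective_at A z -> op_dom A (resolvent A z w).
Proof. by move=> /resolventP-/(_ w)[]. Qed.

Lemma op_resolvent A z w : bijective_at A z ->
  A (resolvent A z w) = w + z *: resolvent A z w.
Proof. by move=> /resolventP-/(_ w)[_ {2}<-]; rewrite subrK. Qed.

Lemma resolvent_uniq A z w u : linear_on (op_dom A) A -> bijective_at A z ->
  op_dom A u -> A u = w + z *: u -> resolvent A z w = u.
Proof.
move=> Al Az Du Au; have Dr := resolvent_dom w Az.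
have [Dru Aru] := linear_onB Al Dr Du; apply/subr0_eq/Az.2 => //; rewrite Aru.
by rewrite op_resolvent// Au opprD addrACA subrr add0r scalerBr subrr.
Qed.

Lemma resolventK A z u : linear_on (op_dom A) A -> bijective_at A z -> op_dom A u ->
  resolvent A z (A u - z *: u) = u.
Proof. by move=> Al Az Du; apply: resolvent_uniq => //; rewrite subrK. Qed.

Lemma resolvent_linear A z : linear_on (op_dom A) A -> bijective_at A z ->
  linear (resolvent A z).
Proof.
move=> Al Az a x y; have Dx := resolvent_dom x Az; have Dy := resolvent_dom y Az.
have [Dax Aax] := linear_onZ Al a Dx; have [Daxy Aaxy] := linear_onD Al Dax Dy.
apply: resolvent_uniq => //.
rewrite Aaxy Aax !op_resolvent// !scalerDr !scalerA (mulrC a) addrACA//.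
Qed.

Lemma maximal_dissipative_bijective A z : maximal_dissipative A -> complex.Im z < 0 ->
  bijective_at A z.
Proof.
move=> Am z0; split=> [w|u Du uz]; first exact: maximal_dissipative_range.
have [Ad _] := Am; have := dissipative_lower_bound Ad z0 Du.
rewrite uz hnorm0 => h; apply/hnorm_eq0/eqP; rewrite eq_le hnorm_ge0 andbT.
by move: h; rewrite pmulr_rle0// oppr_gt0.
Qed.

Lemma maximal_dissipative_bounded A z : maximal_dissipative A -> complex.Im z < 0 ->
  bounded_operator (resolvent A z).
Proof.
move=> Am z0; have Az := maximal_dissipative_bijective Am z0; have [Ad _] := Am.
have [Al _ _] := Ad; split; first exact: resolvent_linear.
exists (- complex.Im z)^-1 => x; rewrite ler_pdivlMl ?oppr_gt0//.
by rewrite -{2}(resolventP x Az).2; apply: dissipative_lower_bound => //; exact: resolvent_dom.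
Qed.

Section Adjoint.
Variable A : operator H.
Hypotheses (Al : linear_on (op_dom A) A) (Ad : dense (op_dom A)).

Lemma adjointP u v : op_dom A u -> op_dom (adjoint A) v ->
  <[A u, v]> = <[u, adjoint A v]>.
Proof.
move=> Du [w vw]; rewrite /adjoint/=; case: xgetP => [x _ /(_ u)->//|no].
by exfalso; exact: (no w).
Qed.

Lemma adjoint_intro v w : (forall u, op_dom A u -> <[A u, v]> = <[u, w]>) ->
  op_dom (adjoint A) v /\ adjoint A v = w.
Proof.
move=> vw; have Dv : op_dom (adjoint A) v by exists w.
split => //; apply/subr0_eq/(dense_rdot0 Ad) => u Du.
by rewrite rdotBr /rdot -adjointP// vw// subrr.
Qed.

Lemma adjoint_linear : linear_on (op_dom (adjoint A)) (adjoint A).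
Proof.
have lin a u v : op_dom (adjoint A) u -> op_dom (adjoint A) v ->
    op_dom (adjoint A) (a *: u + v) /\
    adjoint A (a *: u + v) = a *: adjoint A u + adjoint A v.
  move=> Du Dv; apply: adjoint_intro => h Dh.
  by rewrite !hdotDr !hdotZr !adjointP.
split=> [|a u v Du Dv|a u v Du Dv].
- by have [|//] := @adjoint_intro 0 0; move=> u _; rewrite !hdot0r.
- by have [] := lin a u v Du Dv.
- by have [] := lin a u v Du Dv.
Qed.

(** The resolvent of the adjoint is the adjoint of the resolvent. *)
Lemma adjoint_bijective z : bijective_at A (conjc z) ->
  bounded_operator (resolvent A (conjc z)) -> bijective_at (adjoint A) z.
Proof.
move=> Az bA; split=> [w|v Dv vz].
  pose v := badjoint (resolvent A (conjc z)) w.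
  have [u Du|Dv Av] := @adjoint_intro v (w + z *: v).
    have := badjointP bA (A u - conjc z *: u) w.
    by rewrite resolventK// hdotBl hdotZl hdotDr hdotZr => ->; rewrite subrK.
  by exists v => //; rewrite Av addrK.
apply: hdot_inj => x; rewrite hdot0l hdotC.
rewrite -(resolventP x Az).2 hdotBl hdotZl adjointP//; last exact: resolvent_dom.
have -> : adjoint A v = z *: v by apply: subr0_eq.
by rewrite hdotZr subrr conjc0.
Qed.

End Adjoint.
End Resolvents.

Section MoreBounded.
Context (R : realType) (E F : hilbertType R).
Lemma bop_zero : bounded_operator (fun _ : E => 0 : F).
Proof.
split=> [a x y|]; first by rewrite scaler0 addr0.
by exists 0 => x; rewrite mul0r hnorm0.
Qed.
Lemma bop_add (L L' : E -> F) : bounded_operator L -> bounded_operator L' ->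
  bounded_operator (fun x => L x + L' x).
Proof.
by move=> bL bL'; have := bop_lin 1 bL bL'; congr bounded_operator; apply/funext => x; rewrite scale1r.
Qed.
Lemma bop_scale (a : R[i]) (L : E -> F) : bounded_operator L ->
  bounded_operator (fun x => a *: L x).
Proof.
by move=> bL; have := bop_lin a bL bop_zero; congr bounded_operator; apply/funext => x; rewrite addr0.
Qed.
Lemma bop_sub (L L' : E -> F) : bounded_operator L -> bounded_operator L' ->
  bounded_operator (fun x => L x - L' x).
Proof.
move=> bL bL'; have := bop_add bL (bop_scale (-1) bL').
by congr bounded_operator; apply/funext => x; rewrite scaleN1r.
Qed.
End MoreBounded.

Section Extension.
Context (R : realType) (H E F : hilbertType R).

(** The extension is built as a relation: [y] is related to [x] when some sequence
    [u] has [G u] tending to [x] and [L u] tending to [y]. *)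
Lemma extend_bounded (D : set H) (G : H -> E) (L : H -> F) :
  linear_on D G -> linear_on D L -> dense (G @` D) ->
  (forall u, D u -> hnorm (L u) <= hnorm (G u)) ->
  exists2 T, bounded_operator T & forall u, D u -> T (G u) = L u.
Proof.
move=> Gl Ll Gd LG.
pose P x y := exists2 u : nat -> H, (forall n, D (u n)) &
  hcvg (G \o u) x /\ hcvg (L \o u) y.
have Pex x : exists y, P x y.
  have [s sD sx] := dense_seq x Gd.
  have /choice[u uP] : forall n, exists u, D u /\ G u = s n.
    by move=> n; have [u Du us] := sD n; exists u.
  have Gu : G \o u = s by apply/funext => n /=; rewrite (uP n).2.
  have LC : hcauchy (L \o u).
    move=> r r0; have r2 : 0 < r / 2 by rewrite divr_gt0.
    have [N sN] := sx _ r2; exists N => n m Nn Nm /=.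
    have [Dnm <-] := linear_onB Ll (uP n).1 (uP m).1.
    apply: le_lt_trans (LG _ Dnm) _.
    have [_ ->] := linear_onB Gl (uP n).1 (uP m).1; rewrite !(uP _).2.
    apply: le_lt_trans (hnorm_triangle _ x _) _; rewrite (hnormB x).
    by have := sN _ Nn; have := sN _ Nm; lra.
  have [y Ly] := hcauchy_cvg LC.
  by exists y, u; [move=> n; exact: (uP n).1|rewrite Gu].
have Plin a x y x' y' : P x y -> P x' y' -> P (a *: x + x') (a *: y + y').
  move=> [u Du [Gx Ly]] [u' Du' [Gx' Ly']]; exists (fun n => a *: u n + u' n).
    by move=> n; have [_ h _] := Gl; exact: h.
  split.
    have -> : G \o (fun n => a *: u n + u' n) = (a \*: (G \o u)) \+ (G \o u').
      by apply/funext => n /=; have [_ _ ->] := Gl.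
    by apply: hcvgD => //; exact: hcvgZ.
  have -> : L \o (fun n => a *: u n + u' n) = (a \*: (L \o u)) \+ (L \o u').
    by apply/funext => n /=; have [_ _ ->] := Ll.
  by apply: hcvgD => //; exact: hcvgZ.
have Ple x y : P x y -> hnorm y <= hnorm x.
  move=> [u Du [Gx Ly]]; apply: ler_cvg_to (cvg_hnorm Ly) (cvg_hnorm Gx) _.
  by apply: nearW => n /=; exact: LG.
have Puniq x y y' : P x y -> P x y' -> y = y'.
  move=> Pxy Pxy'; have := Ple _ _ (Plin (-1) _ _ _ _ Pxy' Pxy).
  rewrite !scaleN1r addNr hnorm0 => h; rewrite addrC in h.
  by apply/subr0_eq/hnorm_eq0/eqP; rewrite eq_le h hnorm_ge0.
have [T TP] := choice Pex; exists T.
  split=> [a x y|]; first by apply: (Puniq (a *: x + y)) => //; exact: Plin.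
  by exists 1 => x; rewrite mul1r; exact: Ple.
move=> u Du; apply: (Puniq (G u)) => //; exists (fun=> u) => //.
by split; exact: hcvg_cst.
Qed.

End Extension.

(** * Boundary pairs *)

Section BoundaryPair.
Context (R : realType) (H E F : hilbertType R).

(** A maximal dissipative operator and its adjoint, in either order, with boundary
    operators that satisfy Green's formulas, the bounded operators [S z] that
    link them, and [T z], the adjoint of [S (conjc z)].  The constant [c] is [i]
    or [- i], and [up] is the half-plane on which [B] has a bounded resolvent.  The
    clauses are symmetric in [A] and [B], so that the two half-planes of the
    resolvent are the same statement ([boundary_pair_swap]). *)
Record boundary_pair (A B : operator H) (G : H -> E) (Gs : H -> F) (c : R[i])
    (up : R[i] -> Prop) (S : R[i] -> E -> F) (T : R[i] -> F -> E) : Prop :=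
  BoundaryPair {
    bp_linA : linear_on (op_dom A) A;
    bp_linB : linear_on (op_dom B) B;
    bp_dual : forall u v, op_dom A u -> op_dom B v -> <[A u, v]> = <[u, B v]>;
    bp_conj : conjc c = - c;
    bp_sqr : c * c = -1;
    bp_resA : forall z, up (conjc z) -> bijective_at A z;
    bp_resB : forall z, up z -> bijective_at B z;
    bp_bndA : forall z, up (conjc z) -> bounded_operator (resolvent A z);
    bp_bndB : forall z, up z -> bounded_operator (resolvent B z);
    bp_linG : linear_on (op_dom A) G;
    bp_linGs : linear_on (op_dom B) Gs;
    bp_bndG : forall z, up (conjc z) -> bounded_operator (fun h => G (resolvent A z h));
    bp_bndGs : forall z, up z -> bounded_operator (fun h => Gs (resolvent B z h));
    bp_denseG : dense (G @` op_dom A);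
    bp_denseGs : dense (Gs @` op_dom B);
    bp_greenG : forall u v, op_dom A u -> op_dom A v ->
      <[A u, v]> - <[u, A v]> = c * <[G u, G v]>;
    bp_greenGs : forall u v, op_dom B u -> op_dom B v ->
      <[B u, v]> - <[u, B v]> = - c * <[Gs u, Gs v]>;
    bp_bndS : forall z, up z -> bounded_operator (S z);
    bp_bndT : forall z, up (conjc z) -> bounded_operator (T z);
    bp_adj : forall z x y, up z -> <[S z x, y]> = <[x, T (conjc z) y]>;
    bp_S : forall z u, up z -> op_dom A u ->
      S z (G u) = Gs (resolvent B z (A u - z *: u));
    bp_T : forall z u, up (conjc z) -> op_dom B u ->
      T z (Gs u) = G (resolvent A z (B u - z *: u)) }.

End BoundaryPair.

Lemma boundary_pair_swap (R : realType) (H E F : hilbertType R)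
    (A B : operator H) (G : H -> E) (Gs : H -> F) c up S T :
  boundary_pair A B G Gs c up S T ->
  boundary_pair B A Gs G (- c) (fun z => up (conjc z)) T S.
Proof.
move=> bp; have cJ := bp_conj bp; case: bp => *; split => //; rewrite ?opprK//.
- by move=> u v Du Dv; rewrite hdotC [in RHS]hdotC; congr conjc; apply/esym; auto.
- by rewrite rmorphN/= cJ opprK.
- by rewrite mulrNN.
- by move=> z; rewrite conjcK; auto.
- by move=> z; rewrite conjcK; auto.
- by move=> z; rewrite conjcK; auto.
- by move=> z; rewrite conjcK; auto.
- by move=> z x y uz; rewrite hdotC [in RHS]hdotC -{1}(conjcK z); congr conjc; apply/esym; auto.
- by move=> z u; rewrite conjcK; auto.
Qed.

(** Linear identities in a Hilbert space become ring identities among complex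
    numbers once both sides are paired with an arbitrary vector. *)
Ltac hmodule := apply: hdot_inj => ?;
  rewrite ?(hdotDl, hdotBl, hdotNl, hdotZl, hdot0l); ring.

Section Solve.
Context (R : realType) (H E F : hilbertType R) (A B : operator H).
Context (G : H -> E) (Gs : H -> F) (c : R[i]) (up : R[i] -> Prop).
Context (S : R[i] -> E -> F) (T : R[i] -> F -> E).
Hypothesis bp : boundary_pair A B G Gs c up S T.

Local Notation RA := (resolvent A).
Local Notation RB := (resolvent B).
Local Notation Gadj z := (badjoint (fun h => G (RA (conjc z) h))).
Local Notation Gsadj z := (badjoint (fun h => Gs (RB z h))).

Lemma hdot_resolvent z x y : up z -> <[RA (conjc z) x, y]> = <[x, RB z y]>.
Proof.
move=> uz; have uz' : up (conjc (conjc z)) by rewrite conjcK.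
have zA := bp_resA bp uz'; have zB := bp_resB bp uz.
have := bp_dual bp (resolvent_dom x zA) (resolvent_dom y zB).
rewrite (op_resolvent _ zA) (op_resolvent _ zB) hdotDl hdotDr hdotZl hdotZr.
by move=> /addIr.
Qed.

(** Green's formula for [h] and [RA (conjc z) k]: this and [bp_S] are what turns
    operators on [E] into resolvents, when they are evaluated at [G h]. *)
Lemma Gadj_G z h : up z -> op_dom A h ->
  Gadj z (G h) = c *: (h - RB z (A h - z *: h)).
Proof.
move=> uz Dh; have uz' : up (conjc (conjc z)) by rewrite conjcK.
have zA := bp_resA bp uz'.
apply: badjoint_uniq => [|k]; first exact: (bp_bndG bp).
have Da := resolvent_dom k zA.
have := bp_greenG bp Da Dh; rewrite (op_resolvent _ zA) hdotDl hdotZl => e.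
rewrite hdotZr (bp_conj bp) hdotBr -hdot_resolvent// hdotBr hdotZr.
apply: (@mulfI _ c); last first.
  rewrite -e mulNr mulrN mulrA (bp_sqr bp) mulN1r opprK opprB addrA addrAC//.
by apply/negP => /eqP c0; have /eqP := bp_sqr bp; rewrite c0 mul0r eq_sym oppr_eq0 oner_eq0.
Qed.

Lemma dense_eq (V : hilbertType R) (L L' : E -> V) :
  bounded_operator L -> bounded_operator L' ->
  (forall h, op_dom A h -> L (G h) = L' (G h)) -> forall e, L e = L' e.
Proof.
move=> bL bL' LL'; apply: (bop_ext (bp_denseG bp)) => // _ [h Dh <-].
exact: LL'.
Qed.

Lemma Gadj_bounded z : up z -> bounded_operator (Gadj z).
Proof. by move=> uz; apply/badjoint_bounded/(bp_bndG bp); rewrite conjcK. Qed.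

Lemma Gsadj_bounded z : up z -> bounded_operator (Gsadj z).
Proof. by move=> uz; apply/badjoint_bounded/(bp_bndGs bp). Qed.

Lemma resolvent_shift z l h : up z -> up l -> op_dom A h ->
  RB l (A h - l *: h) - RB z (A h - z *: h) =
  (z - l) *: RB l (h - RB z (A h - z *: h)).
Proof.
move=> uz ul Dh; have Bl := bp_linB bp.
have zB := bp_resB bp uz; have lB := bp_resB bp ul.
set p := RB z _; set q := RB l (_ - _).
have [Dqp Bqp] := linear_onB Bl (resolvent_dom _ lB : op_dom B q)
                                (resolvent_dom _ zB : op_dom B p).
rewrite -(bopZ (bp_bndB bp ul)); apply/esym/resolvent_uniq => //.
rewrite Bqp (op_resolvent _ lB) (op_resolvent _ zB) -/p -/q.
hmodule.
Qed.

(** The next two lemmas give the dependence of [Gadj z] and [S z] on [z]; at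
    [e = G h] both reduce to the resolvent identity. *)
Lemma Gadj_shift z l e : up z -> up l ->
  Gadj z e - Gadj l e = (z - l) *: RB l (Gadj z e).
Proof.
move=> uz ul; have bB := bp_bndB bp ul.
have bz := Gadj_bounded uz; have bl := Gadj_bounded ul.
apply: (dense_eq (L := fun e => Gadj z e - Gadj l e)
                 (L' := fun e => (z - l) *: RB l (Gadj z e))).
- exact: bop_sub.
- by apply: bop_scale; exact: (bop_comp bB bz).
move=> h Dh; rewrite !Gadj_G// (bopZ bB) scalerA mulrC -scalerA -resolvent_shift//.
hmodule.
Qed.

Lemma S_shift z l e : up z -> up l ->
  S l e - S z e = - (c * (z - l)) *: Gs (RB l (Gadj z e)).
Proof.
move=> uz ul; have bB := bp_bndB bp ul; have bGs := bp_bndGs bp ul.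
have bz := Gadj_bounded uz.
apply: (dense_eq (L := fun e => S l e - S z e)
                 (L' := fun e => - (c * (z - l)) *: Gs (RB l (Gadj z e)))).
- by apply: bop_sub; exact: (bp_bndS bp).
- by apply: bop_scale; exact: (bop_comp bGs bz).
move=> h Dh; rewrite !(bp_S bp)// Gadj_G// (bopZ bB).
have zB := bp_resB bp uz; have lB := bp_resB bp ul.
have Bl := bp_linB bp; have Gsl := bp_linGs bp.
have DB x := resolvent_dom x lB.
have [_ <-] := linear_onB Gsl (DB (A h - l *: h)) (resolvent_dom (A h - z *: h) zB).
rewrite resolvent_shift//.
have [_ ->] := linear_onZ Gsl (z - l) (DB (h - RB z (A h - z *: h))).
have [_ ->] := linear_onZ Gsl c (DB (h - RB z (A h - z *: h))).
by rewrite scalerA mulNr mulrAC (bp_sqr bp) mulN1r opprK.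
Qed.

End Solve.

Section SolveDual.
Context (R : realType) (H E F : hilbertType R) (A B : operator H).
Context (G : H -> E) (Gs : H -> F) (c : R[i]) (up : R[i] -> Prop).
Context (S : R[i] -> E -> F) (T : R[i] -> F -> E).
Hypothesis bp : boundary_pair A B G Gs c up S T.

Local Notation RA := (resolvent A).
Local Notation RB := (resolvent B).
Local Notation Gadj z := (badjoint (fun h => G (RA (conjc z) h))).
Local Notation Gsadj z := (badjoint (fun h => Gs (RB z h))).

Lemma Gsadj_Gs nu k : up nu -> op_dom B k ->
  Gsadj nu (Gs k) = - c *: (k - RA (conjc nu) (B k - conjc nu *: k)).
Proof.
move=> unu Dk; have unu' : up (conjc (conjc nu)) by rewrite conjcK.
by have := Gadj_G (boundary_pair_swap bp) unu' Dk; rewrite conjcK.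
Qed.

Lemma resolvent_change nu l h : up nu -> up l -> op_dom A h ->
  let q := RB l (A h - l *: h) in
  RA (conjc nu) (B q - conjc nu *: q) =
  h - (l - conjc nu) *: RA (conjc nu) (h - q).
Proof.
move=> unu ul Dh q; have unu' : up (conjc (conjc nu)) by rewrite conjcK.
have bA := bp_bndA bp unu'; rewrite (op_resolvent _ (bp_resB bp ul)) -/q.
have -> : A h - l *: h + l *: q - conjc nu *: q =
    (A h - conjc nu *: h) - (l - conjc nu) *: (h - q) by hmodule.
by rewrite (bopB bA) (bopZ bA) (resolventK (bp_linA bp) (bp_resA bp unu')).
Qed.

(** The next two lemmas compose the operators attached to [A] with those attached
    to [B]. *)
Lemma Gsadj_S nu l e : up nu -> up l ->
  Gsadj nu (S l e) =
  Gadj l e - (l - conjc nu) *: RA (conjc nu) (Gadj l e).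
Proof.
move=> unu ul; have unu' : up (conjc (conjc nu)) by rewrite conjcK.
have bA := bp_bndA bp unu'.
have bl := Gadj_bounded bp ul; have bnu := Gsadj_bounded bp unu.
apply: (dense_eq bp (L := fun e => Gsadj nu (S l e))
  (L' := fun e => Gadj l e - (l - conjc nu) *: RA (conjc nu) (Gadj l e))).
- by apply: (bop_comp bnu); exact: (bp_bndS bp).
- by apply: bop_sub => //; apply: bop_scale; exact: (bop_comp bA bl).
move=> h Dh; rewrite (bp_S bp)// Gsadj_Gs//; last exact: resolvent_dom (bp_resB bp ul).
rewrite resolvent_change// (Gadj_G bp)// (bopZ bA).
hmodule.
Qed.

Lemma T_S nu l e : up nu -> up l ->
  T (conjc nu) (S l e) = e + (c * (l - conjc nu)) *: G (RA (conjc nu) (Gadj l e)).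
Proof.
move=> unu ul; have unu' : up (conjc (conjc nu)) by rewrite conjcK.
have bA := bp_bndA bp unu'; have bG := bp_bndG bp unu'.
have bl := Gadj_bounded bp ul; have nuA := bp_resA bp unu'.
apply: (dense_eq bp (L := fun e => T (conjc nu) (S l e))
  (L' := fun e => e + (c * (l - conjc nu)) *: G (RA (conjc nu) (Gadj l e)))).
- by apply: (bop_comp (bp_bndT bp unu')); exact: (bp_bndS bp).
- by apply: bop_add; [exact: bop_id|apply: bop_scale; exact: (bop_comp bG bl)].
move=> h Dh; have Gl := bp_linG bp; have DA x := resolvent_dom x nuA.
rewrite (bp_S bp)// (bp_T bp)//; last exact: resolvent_dom (bp_resB bp ul).
rewrite resolvent_change// (Gadj_G bp)// (bopZ bA).
set x := RA _ (h - _).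
have [D1 E1] := linear_onZ Gl (l - conjc nu) (DA _ : op_dom A x).
have [_ ->] := linear_onB Gl Dh D1; have [_ E2] := linear_onZ Gl c (DA _ : op_dom A x).
rewrite E1 E2 scalerA mulrAC (bp_sqr bp); hmodule.
Qed.

(** The algebraic part of the existence proof.  Here [u] and [f] are given by the
    formulas of the resolvent at [l], for data [w] and boundary value [e].  The
    first bracket is the description of the domain and of the action through [B],
    with parameter [z]; the second is the one through [A], with parameter
    [conjc nu].  Both hold for every choice of [z] and [nu] because [p] and [m]
    are themselves resolvents at [z] and [conjc nu] applied to explicit vectors. *)
Lemma boundary_solve l z nu w e (a := RB l w) (u := a - Gadj l e)
    (f := - c *: Gs a + S l e) (p := u + Gadj z e) (m := u + Gsadj nu f) :
  up l -> up z -> up nu ->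
  [/\ op_dom B p, B p - z *: Gadj z e = l *: u + w & f = S z e - c *: Gs p] /\
  [/\ op_dom A m, A m - conjc nu *: Gsadj nu f = l *: u + w &
      e = T (conjc nu) f + c *: G m].
Proof.
move=> ul uz unu; have unu' : up (conjc (conjc nu)) by rewrite conjcK.
have lB := bp_resB bp ul; have bB := bp_bndB bp ul.
have nuA := bp_resA bp unu'; have bA := bp_bndA bp unu'; have bT := bp_bndT bp unu'.
have bGs := bp_bndGs bp ul; have bG := bp_bndG bp unu'.
have bnu := Gsadj_bounded bp unu.
split.
- have pE : p = RB l (w + (z - l) *: Gadj z e).
    rewrite (bopD bB) (bopZ bB) -(Gadj_shift bp)// /p /u /a; hmodule.
  split.
  + by rewrite pE; exact: resolvent_dom.
  + by rewrite pE (op_resolvent _ lB) -pE /p; hmodule.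
  + rewrite pE (bopD bGs) (bopZ bGs) /f -/a.
    have -> : S l e = S z e + - (c * (z - l)) *: Gs (RB l (Gadj z e)).
      by rewrite -(S_shift bp)// addrC subrK.
    hmodule.
have Da : op_dom B a by exact: resolvent_dom.
have Ba : B a = w + l *: a by rewrite op_resolvent.
have mE : m = RA (conjc nu) ((l - conjc nu) *: u + w).
  rewrite /m /f (bopD bnu) (bopZ bnu) Gsadj_Gs// Gsadj_S//.
  rewrite scalerA mulrN mulNr opprK (bp_sqr bp) Ba.
  have -> : w + l *: a - conjc nu *: a = (l - conjc nu) *: u + w + (l - conjc nu) *: Gadj l e.
    rewrite /u; hmodule.
  rewrite (bopD bA _ ((l - conjc nu) *: Gadj l e)) (bopZ bA _ (Gadj l e)) /u; hmodule.
split.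
- by rewrite mE; exact: resolvent_dom.
- rewrite mE (op_resolvent _ nuA) -mE /m; hmodule.
rewrite mE /f (bopD bT) (bopZ bT) (bp_T bp)// T_S// Ba.
have -> : w + l *: a - conjc nu *: a = (l - conjc nu) *: u + w + (l - conjc nu) *: Gadj l e.
  rewrite /u; hmodule.
rewrite (bopD bG _ ((l - conjc nu) *: Gadj l e)) (bopZ bG _ (Gadj l e)); hmodule.
Qed.

(** The two expressions of the action of the dilation agree as soon as one
    boundary condition holds: paired with [h] in [D(A)], both are equal to
    [<A h, u> + <G h, e>]. *)
Lemma boundary_actions z nu u e f (p := u + Gadj z e) (m := u + Gsadj nu f) :
  dense (op_dom A) -> up z -> up nu -> op_dom B p -> op_dom A m ->
  e = T (conjc nu) f + c *: G m ->
  B p - z *: Gadj z e = A m - conjc nu *: Gsadj nu f.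
Proof.
move=> dA uz unu Dp Dm eE; have unu' : up (conjc (conjc nu)) by rewrite conjcK.
have uz' : up (conjc (conjc z)) by rewrite conjcK.
apply/subr0_eq/(dense_rdot0 dA) => h Dh.
suff /subr0_eq hh : <[h, B p - z *: Gadj z e]> - <[h, A m - conjc nu *: Gsadj nu f]> = 0.
  by rewrite rdotBr /rdot hh subrr.
have e1 : <[h, B p - z *: Gadj z e]> = <[A h, u]> + <[G h, e]>.
  rewrite hdotBr hdotZr -(bp_dual bp)// /p hdotDr.
  have := badjointP (bp_bndG bp uz') (A h - conjc z *: h) e.
  rewrite (resolventK (bp_linA bp) (bp_resA bp uz')) // hdotBl hdotZl => ->; ring.
have e2 : <[h, A m - conjc nu *: Gsadj nu f]> = <[A h, u]> + <[G h, e]>.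
  have := badjointP (bp_bndGs bp unu) (A h - nu *: h) f.
  rewrite -(bp_S bp)// (bp_adj bp)// hdotBl hdotZl => e3.
  have Gm : c * <[G h, G m]> = <[G h, T (conjc nu) f]> - <[G h, e]>.
    have -> : <[G h, e]> = <[G h, T (conjc nu) f]> - c * <[G h, G m]>.
      by rewrite {1}eE hdotDr hdotZr (bp_conj bp); ring.
    by ring.
  have := bp_greenG bp Dh Dm; rewrite Gm e3 hdotBr hdotZr conjcK {1}/m hdotDr => e4.
  move/eqP: e4; rewrite -subr_eq0 => /eqP e4; apply: subr0_eq.
  by apply: oppr_inj; rewrite oppr0 -[RHS]e4; ring.
rewrite e1 e2; ring.
Qed.

End SolveDual.
(** * The boundary pair of a maximal dissipative operator *)

Section Concrete.
Context (R : realType).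

Lemma Re_norm_ge0 (a : R[i]) : 0 <= complex.Re `|a|.
Proof. by have := normr_ge0 a; rewrite lecE => /andP[]. Qed.

Lemma graph_bounded_resolvent (H E : hilbertType R) (A : operator H) (G : H -> E) z :
  linear_on (op_dom A) A -> bijective_at A z -> bounded_operator (resolvent A z) ->
  linear_on (op_dom A) G -> graph_bounded A G ->
  bounded_operator (fun h => G (resolvent A z h)).
Proof.
move=> Al Az bA Gl [M GM]; have DA x := resolvent_dom x Az; split.
  move=> a x y; rewrite bA.1.
  by have [_ _ ->] := Gl.
have [C C0 rC] := bop_bound bA.
exists (`|M| * (C + (1 + complex.Re `|z| * C))) => x.
apply: le_trans (GM _ (DA x)) _.
apply: (@le_trans _ _ (`|M| * (hnorm (resolvent A z x) + hnorm (A (resolvent A z x))))).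
  have sq_le (p q : R) : 0 <= p -> 0 <= q -> Num.sqrt (p ^+ 2 + q ^+ 2) <= p + q.
    move=> p0 q0; rewrite -[leRHS]ger0_norm ?addr_ge0// -sqrtr_sqr ler_wsqrtr//.
    by rewrite sqrrD lerD2r lerDl mulrn_wge0// mulr_ge0.
  apply: le_trans (ler_wpM2r (sqrtr_ge0 _) (ler_norm M)) _.
  by rewrite ler_wpM2l// sq_le// hnorm_ge0.
rewrite -mulrA ler_wpM2l// !mulrDl mul1r lerD//.
rewrite (op_resolvent _ Az); apply: le_trans (hnormD _ _) _; rewrite lerD2l hnormZ.
by rewrite -mulrA ler_wpM2l// Re_norm_ge0.
Qed.

Context (H E Es : hilbertType R) (A : operator H) (G : H -> E) (Gs : H -> Es).
Hypothesis Am : maximal_dissipative A.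
Hypothesis bG : boundary_operator 'i%C A G.
Hypothesis bGs : boundary_operator (- 'i%C) (adjoint A) Gs.

Local Notation B := (adjoint A).

Let Al : linear_on (op_dom A) A. Proof. by have [[]] := Am. Qed.
Let Ad : dense (op_dom A). Proof. by have [[]] := Am. Qed.
Let Bl : linear_on (op_dom B) B. Proof. exact: adjoint_linear. Qed.

Let lower_conj (z : R[i]) : 0 < complex.Im (conjc z) -> complex.Im z < 0.
Proof. by rewrite cImJ oppr_gt0. Qed.
Let upper_conj (z : R[i]) : 0 < complex.Im z -> complex.Im (conjc z) < 0.
Proof. by rewrite cImJ oppr_lt0. Qed.

Lemma adjoint_bijective_up (z : R[i]) : 0 < complex.Im z -> bijective_at B z.
Proof.
move=> /upper_conj z0; apply: adjoint_bijective => //.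
  exact: maximal_dissipative_bijective.
exact: maximal_dissipative_bounded.
Qed.

Lemma resolvent_adjointE (z : R[i]) : 0 < complex.Im z ->
  resolvent B z = badjoint (resolvent A (conjc z)).
Proof.
move=> z0; have zB := adjoint_bijective_up z0.
have bA := maximal_dissipative_bounded Am (upper_conj z0).
have zA := maximal_dissipative_bijective Am (upper_conj z0).
apply/funext => w; apply/esym/badjoint_uniq => // x.
have := adjointP (resolvent_dom x zA) (resolvent_dom w zB).
rewrite (op_resolvent _ zA) (op_resolvent _ zB) hdotDl hdotDr hdotZl hdotZr.
by move=> /addIr.
Qed.

Lemma adjoint_resolvent_bounded (z : R[i]) : 0 < complex.Im z -> bounded_operator (resolvent B z).
Proof.
move=> z0; rewrite resolvent_adjointE//; apply: badjoint_bounded.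
by apply: maximal_dissipative_bounded => //; exact: upper_conj.
Qed.

(** With [v = (B - z)^-1 (A - z) u], Green's formulas give
    [|G u|^2 - |Gs v|^2 = 2 Im z |u - v|^2]. *)
Lemma char_fun_contraction (z : R[i]) u : 0 < complex.Im z -> op_dom A u ->
  hnorm (Gs (resolvent B z (A u - z *: u))) <= hnorm (G u).
Proof.
move=> z0 Du; have zB := adjoint_bijective_up z0.
set w := A u - z *: u; set v := resolvent B z w.
have Dv : op_dom B v by exact: resolvent_dom.
have Au : A u = w + z *: u by rewrite subrK.
have Bv : B v = w + z *: v by exact: op_resolvent.
have [_ _ _ gG] := bG; have [_ _ _ gGs] := bGs.
have := adjointP Du Dv; rewrite Au Bv hdotDl hdotDr hdotZl hdotZr => e3.
have := gG _ _ Du Du; rewrite Au hdotDl hdotDr hdotZl hdotZr !hdotxx (hdotC u w) => e1.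
have := gGs _ _ Dv Dv; rewrite Bv hdotDl hdotDr hdotZl hdotZr !hdotxx (hdotC v w) => e2.
rewrite (hdotC u w) in e3.
rewrite -ler_sqr ?nnegrE ?hnorm_ge0//.
have := hnorm_sqr (u - v); rewrite rdotBl !rdotBr (rdotC v u) -!hnorm_sqr /rdot.
have := sqr_ge0 (hnorm (u - v)); have z0' := z0.
move: e1 e2 e3 => /(congr1 (@complex.Im R)) + /(congr1 (@complex.Im R)) + /(congr1 (@complex.Im R)).
rewrite !(cImD, cImN, cImM, cReM, cReN, cImJ, cReJ) /=.
move: (hnorm (u - v) ^+ 2) (hnorm u ^+ 2) (hnorm v ^+ 2) => n n1 n2.
move: (complex.Re <[u, v]>) (complex.Im <[u, v]>) (complex.Im <[w, u]>) (complex.Im <[w, v]>) => s t p q.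
move: (hnorm (G u) ^+ 2) (hnorm (Gs v) ^+ 2) => g gs.
move: (complex.Re <[w, u]>) (complex.Re <[w, v]>) => p' q'.
move: (complex.Re z) (complex.Im z) z0 => x y y0 e1 e2 e3 n0 ne.
have yn : y * n = y * (n1 + n2 - 2 * s) by rewrite ne; ring.
have := mulr_ge0 (ltW y0) n0; lra.
Qed.

(** The contraction estimate provides the extension by continuity from the range of [G]. *)
Lemma char_funP (z : R[i]) : 0 < complex.Im z -> bounded_operator (char_fun A G Gs z) /\
  forall u, op_dom A u ->
    char_fun A G Gs z (G u) = Gs (resolvent B z (A u - z *: u)).
Proof.
move=> z0; rewrite /char_fun; case: xgetP => [T _ //|no].
have zB := adjoint_bijective_up z0.
have [Gl _ Gd _] := bG; have [Gsl _ _ _] := bGs.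
have [| |T bT TP] := @extend_bounded R H E Es (op_dom A) G
    (fun u => Gs (resolvent B z (A u - z *: u))) Gl _ Gd.
- have [D0 Dl Gsl'] := Gsl; have [DA0 DAl Al'] := Al.
  split => // a u v Du Dv; rewrite Al'//.
  have -> : a *: A u + A v - z *: (a *: u + v) = a *: (A u - z *: u) + (A v - z *: v).
    hmodule.
  rewrite (adjoint_resolvent_bounded z0).1 Gsl'//; exact: resolvent_dom.
- by move=> u Du; exact: char_fun_contraction.
by exfalso; apply: (no T); split.
Qed.

(** The one clause that is not immediate is the formula for [S(z)^*] on the range
    of [Gs]: it follows from the formula for [S(z)] by pairing with [G h] and
    using Green's formula on both sides. *)
Lemma maximal_dissipative_boundary_pair :
  boundary_pair A B G Gs 'i%C (fun z : R[i] => 0 < complex.Im z) (char_fun A G Gs)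
    (fun z => badjoint (char_fun A G Gs (conjc z))).
Proof.
have [Gl Gb Gd gG] := bG; have [Gsl Gsb Gsd gGs] := bGs.
have bS (z : R[i]) : 0 < complex.Im z -> bounded_operator (char_fun A G Gs z).
  by move=> /char_funP[].
have bA (z : R[i]) : complex.Im z < 0 -> bounded_operator (resolvent A z).
  exact: maximal_dissipative_bounded.
have zA (z : R[i]) : complex.Im z < 0 -> bijective_at A z.
  exact: maximal_dissipative_bijective.
split => //.
- by move=> u v Du Dv; exact: adjointP.
- by apply/eqP; rewrite eq_complex /= oppr0 !eqxx.
- by rewrite -expr2 sqr_i.
- by move=> z /lower_conj; exact: zA.
- exact: adjoint_bijective_up.
- by move=> z /lower_conj; exact: bA.
- exact: adjoint_resolvent_bounded.
- by move=> z /lower_conj z0; apply: graph_bounded_resolvent; auto.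
- move=> z z0; apply: graph_bounded_resolvent => //.
    exact: adjoint_bijective_up.
  exact: adjoint_resolvent_bounded.
- by move=> z z0; apply: badjoint_bounded; apply: bS.
- by move=> z x y z0; rewrite conjcK; apply: badjointP; exact: bS.
- by move=> z u z0 Du; have [_ ->] := char_funP z0.
move=> z u z0 Du; have z0' := lower_conj z0.
have zA' := zA _ z0'; have zB := adjoint_bijective_up z0.
set r := resolvent A z _; have Dr : op_dom A r by exact: resolvent_dom.
apply/subr0_eq/(dense_rdot0 Gd) => _ [h Dh <-].
rewrite rdotBr /rdot -badjointP; last exact: bS.
have [_ ->] := char_funP z0; last by [].
set nu := conjc z; set k := A h - nu *: h; set p := resolvent B nu k.
have Dp : op_dom B p by exact: resolvent_dom.
have e1 := gGs _ _ Dp Du; have e2 := gG _ _ Dh Dr.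
have adj x y : <[resolvent B nu x, y]> = <[x, resolvent A z y]>.
  by rewrite resolvent_adjointE// /nu conjcK hdotC -badjointP; [rewrite [RHS]hdotC|exact: bA].
have Bp : B p = k + nu *: p by exact: op_resolvent.
have Ar : A r = B u - z *: u + z *: r by exact: op_resolvent.
have Ah : A h = k + nu *: h by rewrite subrK.
have e3 : <[p, B u - z *: u]> = <[k, r]> by exact: adj.
have e4 : <[h, B u - z *: u]> = <[k, u]>.
  rewrite hdotBr hdotZr -adjointP// /k hdotBl hdotZl//.
suff : 'i%C * (<[Gs p, Gs u]> - <[G h, G r]>) = 0.
  move=> /eqP; rewrite mulf_eq0 => /orP[/eqP i0|/eqP/subr0_eq ->]; last by rewrite subrr.
  by exfalso; move: i0 => /(congr1 (@complex.Im R)) /= /eqP; rewrite oner_eq0.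
have -> : 'i%C * (<[Gs p, Gs u]> - <[G h, G r]>) =
   - (- 'i%C * <[Gs p, Gs u]>) - 'i%C * <[G h, G r]> by ring.
clearbody p; clearbody k.
rewrite -e1 -e2 Bp Ar Ah !(hdotDl, hdotDr, hdotZl, hdotZr).
move: e3 e4; rewrite !(hdotBr, hdotZr) -/nu => e3 e4.
have -> : <[p, B u]> = <[k, r]> + nu * <[p, u]> by rewrite -e3 subrK.
have -> : <[h, B u]> = <[k, u]> + nu * <[h, u]> by rewrite -e4 subrK.
rewrite hdotNr hdotZr -/nu; ring.
Qed.

End Concrete.
Import HBSimple.

(** * The Bochner integral *)

Section SimpleMaps.
Context (R : realType).
Local Notation leb := (@lebesgue_measure R).

(** Simple functions with values in any type.  This generality allows values to be
    paired and mapped, which yields all closure properties of simple functions. *)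
Definition simple_map (T : Type) (f : R -> T) : Prop :=
  finite_set (range f) /\ forall t, measurable (f @^-1` [set t]).

Lemma simple_preimage (T : Type) (f : R -> T) (B : set T) :
  simple_map f -> measurable (f @^-1` B).
Proof.
move=> [ff mf].
have -> : f @^-1` B = \bigcup_(t in range f `&` B) (f @^-1` [set t]).
  apply/seteqP; split=> [x Bfx|x [t [_ Bt] fxt]]; last by rewrite /preimage/= fxt.
  by exists (f x) => //; split => //; exists x.
by apply: fin_bigcup_measurable => [|t _]; [exact: finite_setIl|exact: mf].
Qed.

Lemma simple_comp (T U : Type) (phi : T -> U) (f : R -> T) :
  simple_map f -> simple_map (phi \o f).
Proof.
move=> sf; split=> [|u]; last exact: (simple_preimage (phi @^-1` [set u]) sf).
by rewrite -(image_comp f phi); apply: finite_image; exact: sf.1.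
Qed.

Lemma simple_pair (T U : Type) (f : R -> T) (g : R -> U) :
  simple_map f -> simple_map g -> simple_map (fun x => (f x, g x)).
Proof.
move=> sf sg; split.
  apply: (@sub_finite_set _ _ (range f `*` range g)).
    by move=> _ [x _ <-]; split; exists x.
  by apply: finite_setX; [exact: sf.1|exact: sg.1].
move=> [t u].
have -> : (fun x => (f x, g x)) @^-1` [set (t, u)] =
    (f @^-1` [set t]) `&` (g @^-1` [set u]).
  by apply/seteqP; split=> x /= [-> ->].
by apply: measurableI; [exact: sf.2|exact: sg.2].
Qed.

Lemma simple_bool (A : set R) : measurable A -> simple_map (fun x => x \in A).
Proof.
move=> mA; split; first exact: finite_finset.
move=> [].
  have -> : (fun x => x \in A) @^-1` [set true] = A; last by [].
  by apply/seteqP; split=> [x /= /set_mem|x Ax] //=; exact: mem_set.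
have -> : (fun x => x \in A) @^-1` [set false] = ~` A; last exact: measurableC.
apply/seteqP; split=> [x /= xA Ax|x nAx /=]; first by rewrite mem_set in xA.
by apply/negbTE/negP => /set_mem.
Qed.

Lemma simple_if (T : Type) (A : set R) (f : R -> T) (t : T) : measurable A ->
  simple_map f -> simple_map (fun x => if x \in A then f x else t).
Proof.
move=> mA sf.
exact: (simple_comp (fun p => if p.1 then p.2 else t) (simple_pair (simple_bool mA) sf)).
Qed.

Lemma simple_measurable (f : R -> R) (D : set R) : simple_map f -> measurable_fun D f.
Proof.
by move=> sf; apply: measurable_funTS => _ B _; rewrite setTI; exact: simple_preimage.
Qed.

(** Composing with these approximations of the identity makes continuous functions
    strongly measurable. *)
Lemma simple_grid : exists g : nat -> R -> R,
  (forall n, simple_map (g n)) /\ forall x, g n x @[n --> \oo] --> x.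
Proof.
have [g gP] := @approximation_sfun _ _ R (EFin : R -> \bar R) setT measurableT
  ((measurable_EFinP setT id).2 (@measurable_id _ _ setT)).
exists (fun n => HBSimple.SimpleFun.sort (g n)); split=> [n|x].
  split=> [|t]; first exact: (fimfunP (g n)).
  exact: (measurable_funPTI (g n)).
by have := gP x I => /fine_cvgP[_] /=.
Qed.

End SimpleMaps.

Section StrongMeasurability.
Context (R : realType) (E : hilbertType R).
Implicit Types (D A : set R) (f g : R -> E) (x : R) (e : E).
Local Notation leb := (@lebesgue_measure R).

Lemma smeas_rdot D f e : strongly_measurable D f ->
  measurable_fun D (fun x => rdot (f x) e).
Proof.
move=> [s [ss sf]].
apply: (measurable_fun_cvg (h := fun n x => rdot (s n x) e)).
  by move=> n; apply: simple_measurable; exact: (simple_comp (fun y => rdot y e) (ss n)).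
by move=> x Dx; apply: hcvg_rdot_cvg; apply/hcvgP; exact: sf.
Qed.

Lemma smeas_hnorm D f : strongly_measurable D f ->
  measurable_fun D (fun x => hnorm (f x)).
Proof.
move=> [s [ss sf]].
apply: (measurable_fun_cvg (h := fun n x => hnorm (s n x))).
  by move=> n; apply: simple_measurable; exact: (simple_comp (@hnorm R E) (ss n)).
by move=> x Dx; apply: cvg_hnorm; apply/hcvgP; exact: sf.
Qed.

Lemma smeas_sub D D' f : D' `<=` D -> strongly_measurable D f -> strongly_measurable D' f.
Proof. by move=> DD' [s [ss sf]]; exists s; split => // x /DD'; exact: sf. Qed.

Lemma smeas_eq D f g : (forall x, D x -> f x = g x) ->
  strongly_measurable D f -> strongly_measurable D g.
Proof. by move=> fg [s [ss sf]]; exists s; split => // x Dx; rewrite -fg//; exact: sf. Qed.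

Lemma smeas_lin D (a : R[i]) f g : strongly_measurable D f -> strongly_measurable D g ->
  strongly_measurable D (fun x => a *: f x + g x).
Proof.
move=> [s [ss sf]] [t [st tg]]; exists (fun n x => a *: s n x + t n x); split.
  by move=> n; exact: (simple_comp (fun p => a *: p.1 + p.2) (simple_pair (ss n) (st n))).
by move=> x Dx; apply: cvgD; [apply: cvgZr; exact: sf|exact: tg].
Qed.

Lemma smeas_patch D f : measurable D -> strongly_measurable D f ->
  strongly_measurable setT (fun x => if x \in D then f x else 0).
Proof.
move=> mD [s [ss sf]]; exists (fun n x => if x \in D then s n x else 0); split.
  by move=> n; exact: (simple_if _ mD (ss n)).
move=> x _; case: ifPn => xD; last exact: cvg_cst.
by apply: sf; rewrite inE in xD.
Qed.

Definition seq_continuous_at f x :=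
  forall u : nat -> R, u n @[n --> \oo] --> x -> hcvg (f \o u) (f x).

Lemma smeas_continuous D f : (forall x, D x -> seq_continuous_at f x) ->
  strongly_measurable D f.
Proof.
move=> fc; have [g [sg gx]] := simple_grid R; exists (fun n => f \o g n); split.
  by move=> n; exact: simple_comp.
by move=> x Dx; apply/hcvgP; exact: (fc x Dx (g ^~ x)).
Qed.

Definition cabs (a : R[i]) : R := complex.Re `|a|.

Lemma cabs_ge0 a : 0 <= cabs a. Proof. exact: Re_norm_ge0. Qed.
Lemma cabsE a : cabs a = Num.sqrt (complex.Re a ^+ 2 + complex.Im a ^+ 2).
Proof. by rewrite /cabs normc_def. Qed.
Lemma cabsM a b : cabs (a * b) = cabs a * cabs b.
Proof.
by rewrite /cabs normrM cReM (ger0_Im (normr_ge0 a)) mul0r subr0.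
Qed.
Lemma cabsN a : cabs (- a) = cabs a. Proof. by rewrite /cabs normrN. Qed.
Lemma cabs_i : cabs 'i%C = 1. Proof. exact: norm_i. Qed.
Lemma cabs_le a : cabs a <= `|complex.Re a| + `|complex.Im a|.
Proof.
rewrite cabsE -[leRHS]ger0_norm ?addr_ge0// -sqrtr_sqr ler_wsqrtr//.
rewrite sqrrD !real_normK ?num_real//.
by rewrite [leRHS]addrAC lerDl mulrn_wge0// mulr_ge0.
Qed.

Lemma hcvg0P (u : nat -> E) : hnorm (u n) @[n --> \oo] --> 0 -> hcvg u 0.
Proof.
move=> /cvgrPdist_lt u0 r r0; have [N _ uN] := u0 r r0; exists N => n /uN /=.
by rewrite sub0r subr0 normrN ger0_norm// hnorm_ge0.
Qed.

Definition seq_continuous (a : R -> R[i]) := forall (u : nat -> R) x,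
  u n @[n --> \oo] --> x -> cabs (a (u n) - a x) @[n --> \oo] --> 0.

Lemma smeas_scale D (a : R -> R[i]) f : seq_continuous a ->
  strongly_measurable D f -> strongly_measurable D (fun x => a x *: f x).
Proof.
move=> ac [s [ss sf]]; have [g [sg gx]] := simple_grid R.
exists (fun n x => a (g n x) *: s n x); split.
  move=> n.
  exact: (simple_comp (fun p => a p.1 *: p.2) (simple_pair (sg n) (ss n))).
move=> x Dx; have /hcvgP sx := sf x Dx; apply/hcvgP.
have l1 : hcvg (fun n => (a (g n x) - a x) *: (s n x - f x)) 0.
  apply: hcvg0P; under eq_fun do rewrite hnormZ.
  rewrite -(mulr0 0); apply: cvgM; first exact: (ac _ _ (gx x)).
  by rewrite -(@hnorm0 R E) -(subrr (f x)); apply: cvg_hnorm; apply: hcvgB => //; exact: hcvg_cst.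
have l2 : hcvg (fun n => (a (g n x) - a x) *: f x) 0.
  apply: hcvg0P; under eq_fun do rewrite hnormZ.
  rewrite -(mul0r (hnorm (f x))); apply: cvgMl; exact: (ac _ _ (gx x)).
have l3 : hcvg (fun n => a x *: s n x) (a x *: f x) by exact: hcvgZ.
have := hcvgD (hcvgD l1 l2) l3; rewrite addr0 add0r.
congr hcvg; apply/funext => n /=.
hmodule.
Qed.

End StrongMeasurability.

Section Bochner.
Context (R : realType) (E : hilbertType R).
Implicit Types (D A : set R) (f g : R -> E) (x : R) (e v : E).
Local Notation leb := (@lebesgue_measure R).

Definition bintegrable D f := strongly_measurable D f /\
  (\int[leb]_(x in D) (hnorm (f x))%:E < +oo)%E.

Lemma bintegrable_hnorm D f : measurable D -> bintegrable D f ->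
  leb.-integrable D (EFin \o (fun x => hnorm (f x))).
Proof.
move=> mD [mf fi]; apply/integrableP; split.
  by apply/measurable_EFinP; exact: smeas_hnorm.
by under eq_integral do rewrite /= ger0_norm ?hnorm_ge0//.
Qed.

Lemma bintegrable_rdot D f e : measurable D -> bintegrable D f ->
  leb.-integrable D (EFin \o (fun x => rdot (f x) e)).
Proof.
move=> mD fD; have [mf fi] := fD.
apply: (@le_integrable _ _ _ leb D mD _ (EFin \o (fun x => hnorm e * hnorm (f x)))).
- by apply/measurable_EFinP; exact: smeas_rdot.
- move=> x Dx /=; rewrite lee_fin [leRHS]ger0_norm ?mulr_ge0 ?hnorm_ge0// mulrC.
  exact: CS_rdot.
have := integrableZl (mu := leb) mD (hnorm e) (bintegrable_hnorm mD fD).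
by [].
Qed.

(** Chebyshev's inequality for the level sets. *)
Lemma simple_bintegrable_finite D (s : R -> E) v : measurable D -> simple_fun s ->
  (\int[leb]_(x in D) (hnorm (s x))%:E < +oo)%E -> v != 0 ->
  (leb (D `&` s @^-1` [set v]) < +oo)%E.
Proof.
move=> mD ss si v0; have vp : 0 < hnorm v.
  rewrite lt_neqAle hnorm_ge0 andbT eq_sym; apply/negP => /eqP/hnorm_eq0 e0.
  by rewrite e0 eqxx in v0.
have mA : measurable (D `&` s @^-1` [set v]) by apply: measurableI => //; exact: ss.2.
have : ((hnorm v)%:E * leb (D `&` s @^-1` [set v]) < +oo)%E.
  apply: le_lt_trans si.
  rewrite -(@integral_cst _ _ _ leb _ mA).
  apply: (@le_trans _ _ (\int[leb]_(x in D `&` s @^-1` [set v]) (hnorm (s x))%:E)%E).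
    rewrite le_eqVlt; apply/orP; left; apply/eqP; apply: eq_integral => x.
    by rewrite inE => -[_ /= ->].
  apply: ge0_subset_integral => //.
  - apply/measurable_EFinP; apply: simple_measurable.
    exact: (simple_comp (@hnorm R E) ss).
  - by move=> x _; rewrite lee_fin hnorm_ge0.
have := measure_ge0 leb (D `&` s @^-1` [set v]).
case: (leb _) => [r _ _||]//=; first by rewrite ltry.
by move=> _; rewrite mulry gtr0_sg// mul1e ltxx.
Qed.

Lemma rdot_sum (I : Type) (r : seq I) (F : I -> E) e :
  rdot (\sum_(i <- r) F i) e = \sum_(i <- r) rdot (F i) e.
Proof.
by elim/big_rec2: _ => [|i x y _ <-]; [rewrite rdot0l|rewrite rdotDl].
Qed.

Lemma simple_integral_rdot D (s : R -> E) e : measurable D -> simple_fun s ->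
  (\int[leb]_(x in D) (hnorm (s x))%:E < +oo)%E ->
  rdot (simple_integral D s) e = \int[leb]_(x in D) rdot (s x) e.
Proof.
move=> mD ss si; rewrite /simple_integral fsbig_finite; last exact: ss.1.
rewrite rdot_sum; set r := finmap.enum_fset _.
pose A v := s @^-1` [set v].
have mA v : measurable (A v) by exact: ss.2.
have intA v : leb.-integrable D (fun x => (rdot v e * \1_(A v) x)%:E) /\
    (\int[leb]_(x in D) (rdot v e * \1_(A v) x)%:E =
     (rdot v e * fine (leb (D `&` A v)))%:E)%E.
  have [v0|v0] := eqVneq v 0.
    rewrite v0 rdot0l; under eq_fun do rewrite mul0r; rewrite mul0r integral0.
    by split => //; exact: integrable0.
  have fA := simple_bintegrable_finite mD ss si v0.
  have iA : leb.-integrable D (fun x => (\1_(A v) x)%:E).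
    apply/integrableP; split.
      by apply/measurable_EFinP; exact: (@measurable_indic _ (measurableTypeR R) R D _ (mA v)).
    under eq_integral do rewrite gee0_abs//.
    have h := integral_indic leb mD (mA v); by rewrite h setIC.
  split; first exact: (integrableZl (mu := leb) mD (rdot v e) iA).
  under eq_integral do rewrite EFinM.
  rewrite integralZl// (integral_indic leb mD (mA v)) setIC EFinM fineK//.
  by rewrite ge0_fin_numE.
have sE x : rdot (s x) e = \sum_(v <- r) rdot v e * \1_(A v) x.
  rewrite (bigD1_seq (s x)) /=; last exact: finmap.fset_uniq.
    rewrite big1 ?addr0 => [|v vs].
      by rewrite indicE mem_set// mulr1.
    rewrite indicE memNset ?mulr0// => svx; move: vs; rewrite /A/= in svx.
    by rewrite svx eqxx.
  by rewrite in_fset_set ?inE; [exists x|exact: ss.1].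
rewrite /Rintegral; under eq_integral do rewrite sE -sumEFin.
rewrite (integral_sum (mu := leb) mD (fun v => (intA v).1)).
under eq_bigr do rewrite rdotZl mulrC.
by under [in RHS]eq_bigr do rewrite (intA _).2; rewrite sumEFin.
Qed.

(** The given approximations are truncated where they exceed [2 |f|]; dominated
    convergence with bound [3 |f|] then applies. *)
Lemma bintegrable_approx D f : measurable D -> bintegrable D f ->
  exists t : nat -> R -> E, [/\ forall n, simple_fun (t n),
    forall x, D x -> t n x @[n --> \oo] --> f x,
    forall n, (\int[leb]_(x in D) (hnorm (t n x))%:E < +oo)%E &
    (\int[leb]_(x in D) (hnorm (f x - t n x))%:E)%E @[n --> \oo] --> 0%E].
Proof.
move=> mD fD; have [[s [ss sf]] fi] := fD.
have mfn := smeas_hnorm fD.1.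
pose A n := D `&` [set x | hnorm (s n x) <= 2 * hnorm (f x)].
have mA n : measurable (A n).
  apply: measurable_fun_le => //.
    by apply: simple_measurable; exact: (simple_comp (@hnorm R E) (ss n)).
  by apply: measurable_funM => //; exact: measurable_cst.
pose t n x := if x \in A n then s n x else 0.
have st n : simple_fun (t n) by exact: (simple_if _ (mA n) (ss n)).
have tle n x : D x -> hnorm (t n x) <= 2 * hnorm (f x).
  move=> Dx; rewrite /t; case: ifPn; first by rewrite inE => -[].
  by move=> _; rewrite hnorm0 mulr_ge0// hnorm_ge0.
have tsf n x : D x -> hnorm (t n x - f x) <= hnorm (s n x - f x).
  move=> Dx; rewrite /t; case: ifPn => // xA.
  have : 2 * hnorm (f x) <= hnorm (s n x).
    rewrite leNgt; apply/negP => h; move/negP: xA; apply; rewrite inE; split => //=.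
    exact: ltW.
  have := hnorm_triangle (s n x) (f x) 0; rewrite !subr0 sub0r hnormN; lra.
have tf x : D x -> hcvg (t ^~ x) (f x).
  move=> Dx r r0; have /hcvgP sx := sf x Dx; have [N sN] := sx r r0.
  by exists N => n /sN; apply: le_lt_trans; exact: tsf.
have i2f : leb.-integrable D (EFin \o (fun x => 3 * hnorm (f x))).
  exact: (integrableZl (mu := leb) mD 3 (bintegrable_hnorm mD fD)).
have mt n : strongly_measurable D (t n).
  by exists (fun=> t n); split => // x _; exact: cvg_cst.
have mft n : strongly_measurable D (fun x => f x - t n x).
  apply: smeas_eq (smeas_lin (-1) (mt n) fD.1) => x _; by rewrite scaleN1r addrC.
exists t; split => //.
- by move=> x Dx; apply/hcvgP; exact: tf.
- move=> n; apply: (@le_lt_trans _ _ (\int[leb]_(x in D) (3 * hnorm (f x))%:E)%E).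
    apply: ge0_le_integral => //=.
    + by move=> x _; rewrite lee_fin hnorm_ge0.
    + by apply/measurable_EFinP; exact: smeas_hnorm.
    + by case/integrableP: i2f.
    + move=> x Dx; rewrite lee_fin; apply: le_trans (tle n x Dx) _.
      by rewrite ler_wpM2r ?hnorm_ge0// ler_nat.
  have /integrableP[_] := i2f; under eq_integral do rewrite gee0_abs ?lee_fin ?mulr_ge0 ?hnorm_ge0//.
  by [].
have [] := @dominated_convergence _ _ _ leb D mD
   (fun n x => (hnorm (f x - t n x))%:E) (cst 0%E) (EFin \o (fun x => 3 * hnorm (f x))).
- by move=> n; apply/measurable_EFinP; exact: smeas_hnorm.
- exact: measurable_cst.
- apply: aeW => x Dx; apply: cvg_EFin; first exact: nearW.
  have : hcvg (fun n => f x - t n x) (f x - f x).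
    by apply: hcvgB; [exact: hcvg_cst|exact: tf].
  by move=> /cvg_hnorm; rewrite subrr hnorm0.
- exact: i2f.
- apply: aeW => x n Dx /=; rewrite lee_fin ger0_norm ?hnorm_ge0//.
  have := hnormD (f x) (- t n x); rewrite hnormN; have := tle n x Dx; lra.
move=> _ + _; apply: cvg_trans; apply: near_eq_cvg; apply: nearW => n.
by apply: eq_integral => x _ /=; rewrite subr0 ger0_norm// hnorm_ge0.
Qed.

Lemma bintegrable_lin D (a : R[i]) f g : measurable D -> bintegrable D f ->
  bintegrable D g -> bintegrable D (fun x => a *: f x + g x).
Proof.
move=> mD fD gD; split; first exact: (smeas_lin a fD.1 gD.1).
have fi := bintegrable_hnorm mD fD; have gi := bintegrable_hnorm mD gD.
have afi := integrableZl (mu := leb) mD (cabs a) fi.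
have fgi := integrableD (mu := leb) mD afi gi.
case/integrableP: fgi => mfg; apply: le_lt_trans.
apply: ge0_le_integral => //=.
- by move=> x _; rewrite lee_fin hnorm_ge0.
- apply/measurable_EFinP; apply: (@smeas_hnorm _ _ D (fun x => a *: f x + g x)).
  exact: (smeas_lin a fD.1 gD.1).
- apply/measurable_EFinP; apply: measurableT_comp => //.
  apply: measurable_funD; last exact: smeas_hnorm gD.1.
  by apply: measurable_funM; [exact: measurable_cst|exact: smeas_hnorm fD.1].
move=> x Dx; rewrite lee_fin [leRHS]ger0_norm; last first.
  by rewrite addr_ge0 ?mulr_ge0 ?hnorm_ge0 ?cabs_ge0.
by rewrite (le_trans (hnormD _ _))// hnormZ.
Qed.

Lemma bintegrable0 D : measurable D -> bintegrable D (fun=> 0 : E).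
Proof.
move=> mD; split.
  by apply: smeas_continuous => x _ u _; exact: hcvg_cst.
by under eq_integral do rewrite hnorm0; rewrite integral0.
Qed.

Lemma bintegrableZ D (a : R[i]) f : measurable D -> bintegrable D f ->
  bintegrable D (fun x => a *: f x).
Proof.
move=> mD fD; have := bintegrable_lin a mD fD (bintegrable0 mD).
by congr bintegrable; apply/funext => x; rewrite addr0.
Qed.

Lemma bintegrableD D f g : measurable D -> bintegrable D f -> bintegrable D g ->
  bintegrable D (fun x => f x + g x).
Proof.
move=> mD fD gD; have := bintegrable_lin 1 mD fD gD.
by congr bintegrable; apply/funext => x; rewrite scale1r.
Qed.

Lemma bintegrableB D f g : measurable D -> bintegrable D f -> bintegrable D g ->
  bintegrable D (fun x => f x - g x).
Proof.
move=> mD fD gD; have := bintegrable_lin (-1) mD gD fD.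
by congr bintegrable; apply/funext => x; rewrite scaleN1r addrC.
Qed.

Lemma Rintegral_rdot_le D f e : measurable D -> bintegrable D f ->
  \int[leb]_(x in D) rdot (f x) e <= (\int[leb]_(x in D) hnorm (f x)) * hnorm e.
Proof.
move=> mD fD; have fi := bintegrable_hnorm mD fD.
rewrite mulrC -RintegralZl//; apply: le_Rintegral => //.
- exact: bintegrable_rdot.
- exact: (integrableZl (mu := leb) mD (hnorm e) fi).
- by move=> x Dx; rewrite mulrC rdot_le.
Qed.

(** The value of the integral is the Riesz vector of the functional obtained by
    pairing first and integrating afterwards. *)
Lemma bochner_exists D f : measurable D -> bintegrable D f -> exists v, is_bochner D f v.
Proof.
move=> mD fD; have fi := bintegrable_hnorm mD fD.
have [r a b||v vP] := @riesz R E (fun e => \int[leb]_(x in D) rdot (f x) e)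
  (\int[leb]_(x in D) hnorm (f x)).
- have ia := bintegrable_rdot a mD fD; have ib := bintegrable_rdot b mD fD.
  rewrite -RintegralZl// -RintegralD//; last exact: (integrableZl (mu := leb) mD r ia).
  by apply: eq_Rintegral => x _; rewrite rdotDr rdotZr.
- by move=> e; exact: Rintegral_rdot_le.
have [t [st tf ti tfi]] := bintegrable_approx mD fD.
exists v, t; split => //; apply/hcvgP.
have tD n : bintegrable D (t n).
  by split; [exists (fun=> t n); split => // x _; exact: cvg_cst|exact: ti].
have ftD n : bintegrable D (fun x => f x - t n x) by exact: bintegrableB.
have bound n : hnorm (simple_integral D (t n) - v) <= \int[leb]_(x in D) hnorm (f x - t n x).
  set d := simple_integral D (t n) - v.
  have : hnorm d ^+ 2 <= (\int[leb]_(x in D) hnorm (f x - t n x)) * hnorm d.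
    rewrite -(hnormN d); apply: le_trans (Rintegral_rdot_le _ mD (ftD n)).
    rewrite hnormN hnorm_sqr {1}/d rdotBl simple_integral_rdot// (rdotC v) -vP.
    rewrite -RintegralB//; [|exact: bintegrable_rdot|exact: bintegrable_rdot].
    rewrite le_eqVlt; apply/orP; left; apply/eqP/eq_Rintegral => x _.
    by rewrite rdotBl !rdotNr opprK addrC.
  have [->|d0] := eqVneq (hnorm d) 0.
    by move=> _; apply: Rintegral_ge0 => x _; exact: hnorm_ge0.
  by rewrite expr2 ler_pM2r// lt_neqAle eq_sym d0 hnorm_ge0.
have lim : (\int[leb]_(x in D) hnorm (f x - t n x)) @[n --> \oo] --> 0.
  by have /fine_cvgP[_] := tfi.
move=> r r0; have /cvgrPdist_lt/(_ r r0)[N _ NP] := lim.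
exists N => n Nn; apply: le_lt_trans (bound n) _.
by have := NP n Nn; rewrite /= sub0r normrN; exact/le_lt_trans/ler_norm.
Qed.

(** The bridge to scalar integrals, from which all properties of the Bochner
    integral are derived. *)
Lemma bochner_rdot D f e : measurable D -> bintegrable D f ->
  rdot (bochner D f) e = \int[leb]_(x in D) rdot (f x) e.
Proof.
move=> mD fD; have [v vP] := bochner_exists mD fD.
have [s [ss sf si sfi sv]] : is_bochner D f (bochner D f) by apply: xgetPex; exists v.
have tD n : bintegrable D (s n).
  by split; [exists (fun=> s n); split => // x _; exact: cvg_cst|exact: si].
have ftD n : bintegrable D (fun x => f x - s n x) by exact: bintegrableB.
have l1 : rdot (simple_integral D (s n)) e @[n --> \oo] --> rdot (bochner D f) e.
  by apply: hcvg_rdot_cvg; apply/hcvgP.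
apply: (cvg_unique (@norm_hausdorff _ _) l1).
have lim : (\int[leb]_(x in D) hnorm (f x - s n x)) @[n --> \oo] --> 0.
  by have /fine_cvgP[_] := sfi.
have lime : ((\int[leb]_(x in D) hnorm (f x - s n x)) * hnorm e) @[n --> \oo] --> 0.
  by rewrite -(mul0r (hnorm e)); exact: cvgMl.
apply/cvgrPdist_lt => r r0; have /cvgrPdist_lt/(_ r r0)[N _ NP] := lime.
exists N => // n Nn; have := NP n Nn; rewrite /= sub0r normrN.
apply: le_lt_trans; rewrite simple_integral_rdot//.
rewrite -RintegralB//; [|exact: bintegrable_rdot|exact: bintegrable_rdot].
have -> : \int[leb]_(x in D) (rdot (f x) e - rdot (s n x) e) =
   \int[leb]_(x in D) (rdot (f x - s n x) e).
  by apply: eq_Rintegral => x _; rewrite rdotBl.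
apply: le_trans (ler_norm _); rewrite ler_norml Rintegral_rdot_le// andbT.
rewrite lerNl -(hnormN e); apply: le_trans (Rintegral_rdot_le _ mD (ftD n)).
rewrite -mulN1r -RintegralZl//; last exact: bintegrable_rdot.
by rewrite le_eqVlt; apply/orP; left; apply/eqP/eq_Rintegral => x _; rewrite rdotNr mulN1r.
Qed.

Lemma bochnerP D f v : measurable D -> bintegrable D f ->
  (forall e, rdot v e = \int[leb]_(x in D) rdot (f x) e) -> bochner D f = v.
Proof. by move=> mD fD vP; apply: rdot_inj => e; rewrite bochner_rdot. Qed.

Lemma bochner_lin D (a : R[i]) f g : measurable D -> bintegrable D f ->
  bintegrable D g ->
  bochner D (fun x => a *: f x + g x) = a *: bochner D f + bochner D g.
Proof.
move=> mD fD gD; apply: bochnerP => // [|e]; first exact: bintegrable_lin.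
rewrite rdotDl rdotZJ !bochner_rdot// -RintegralD//; [|exact: bintegrable_rdot..].
by apply: eq_Rintegral => x _; rewrite rdotDl rdotZJ.
Qed.

Lemma eq_bochner D f g : (forall x, D x -> f x = g x) -> bochner D f = bochner D g.
Proof.
move=> fg; congr (xget 0); apply/funext => v; apply/propext.
have eqi (s : nat -> R -> E) n : (\int[leb]_(x in D) (hnorm (f x - s n x))%:E)%E =
   (\int[leb]_(x in D) (hnorm (g x - s n x))%:E)%E.
  by apply: eq_integral => x; rewrite inE => Dx; rewrite fg.
split=> -[s [ss sf si sfi sv]]; exists s; split => //.
- by move=> x Dx; rewrite -fg//; exact: sf.
- by under eq_fun do rewrite -eqi.
- by move=> x Dx; rewrite fg//; exact: sf.
- by under eq_fun do rewrite eqi.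
Qed.

Lemma bochner0 D : measurable D -> bochner D (fun=> 0 : E) = 0.
Proof.
move=> mD; apply: bochnerP => // [|e]; first exact: bintegrable0.
by rewrite rdot0l Rintegral_cst// mul0r.

Qed.

Lemma bochnerZ D (a : R[i]) f : measurable D -> bintegrable D f ->
  bochner D (fun x => a *: f x) = a *: bochner D f.
Proof.
move=> mD fD; have := bochner_lin a mD fD (bintegrable0 mD).
by rewrite (bochner0 mD) addr0 => <-; apply: eq_bochner => x _; rewrite addr0.
Qed.

Lemma bochnerD D f g : measurable D -> bintegrable D f -> bintegrable D g ->
  bochner D (fun x => f x + g x) = bochner D f + bochner D g.
Proof.
move=> mD fD gD; have := bochner_lin 1 mD fD gD; rewrite scale1r => <-.
by apply: eq_bochner => x _; rewrite scale1r.
Qed.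

Lemma bochnerB D f g : measurable D -> bintegrable D f -> bintegrable D g ->
  bochner D (fun x => f x - g x) = bochner D f - bochner D g.
Proof.
move=> mD fD gD; have := bochner_lin (-1) mD gD fD.
by rewrite scaleN1r addrC => <-; apply: eq_bochner => x _; rewrite scaleN1r addrC.
Qed.

Lemma hnorm_bochner D f : measurable D -> bintegrable D f ->
  hnorm (bochner D f) <= \int[leb]_(x in D) hnorm (f x).
Proof.
move=> mD fD; have := Rintegral_rdot_le (bochner D f) mD fD.
rewrite -bochner_rdot// -hnorm_sqr; have [->|d0] := eqVneq (hnorm (bochner D f)) 0.
  by move=> _; apply: Rintegral_ge0 => x _; exact: hnorm_ge0.
by rewrite expr2 ler_pM2r// lt_neqAle eq_sym d0 hnorm_ge0.
Qed.

Lemma bintegrable_subset D D' f : measurable D -> measurable D' -> D' `<=` D ->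
  bintegrable D f -> bintegrable D' f.
Proof.
move=> mD mD' DD' [mf fi]; split; first exact: smeas_sub mf.
apply: le_lt_trans fi; apply: ge0_subset_integral => //.
  by apply/measurable_EFinP; exact: smeas_hnorm.
by move=> x _; rewrite lee_fin hnorm_ge0.
Qed.

Lemma bochner_setU D D' f : measurable D -> measurable D' -> [disjoint D & D'] ->
  bintegrable (D `|` D') f -> bochner (D `|` D') f = bochner D f + bochner D' f.
Proof.
move=> mD mD' DD' fD; have mU : measurable (D `|` D') by exact: measurableU.
apply: bochnerP => // e.
have fD1 : bintegrable D f by apply: (bintegrable_subset mU) fD => // x; left.
have fD2 : bintegrable D' f by apply: (bintegrable_subset mU) fD => // x; right.
rewrite rdotDl !bochner_rdot// Rintegral_setU//.
exact: bintegrable_rdot.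
Qed.

Lemma bintegrable_set1 f x : bintegrable [set x] f.
Proof.
split.
  apply: (@smeas_eq _ _ _ (fun=> f x)); first by move=> _ ->.
  by apply: smeas_continuous => y _ u _; exact: hcvg_cst.
by rewrite integral_set1.
Qed.

Lemma bochner_set1 f x : bochner [set x] f = 0.
Proof.
apply: bochnerP => // [|e]; first exact: bintegrable_set1.
by rewrite rdot0l Rintegral_set1.
Qed.

End Bochner.
(** * Integration by parts against an exponential *)

Section Exponential.
Context (R : realType).
Implicit Types (a b z : R[i]) (x y t : R).

Lemma cexpD a b : cexp (a + b) = cexp a * cexp b.
Proof.
case: a => a1 a2; case: b => b1 b2; rewrite /cexp /= expRD cosD sinD.
by apply/eqP; rewrite eq_complex /=; apply/andP; split; apply/eqP; ring.
Qed.

Lemma cexp0 : cexp (0 : R[i]) = 1.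
Proof.
by rewrite /cexp /= expR0 cos0 sin0; apply/eqP; rewrite eq_complex /= !mulr1 !mulr0 subr0 addr0 !eqxx.
Qed.

Lemma cexpNK a : cexp (- a) * cexp a = 1.
Proof. by rewrite -cexpD addNr cexp0. Qed.

Lemma cabs_cexp a : cabs (cexp a) = expR (complex.Re a).
Proof.
rewrite cabsE /cexp /= !mul0r subr0 addr0 !exprMn -mulrDr cos2Dsin2 mulr1.
by rewrite sqrtr_sqr ger0_norm// expR_ge0.
Qed.

Lemma cvg_seq_comp (phi : R -> R) (u : nat -> R) x : continuous phi ->
  u n @[n --> \oo] --> x -> phi (u n) @[n --> \oo] --> phi x.
Proof. by move=> pc ux; apply: (cvg_comp _ _ ux); exact: pc. Qed.

Lemma seq_continuous_cexp a : seq_continuous (fun t => cexp (a * t%:C)).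
Proof.
move=> u x ux.
have lin (r : R) : r * u n @[n --> \oo] --> r * x by apply: cvgMr.
have reE (r : R) : complex.Re (a * r%:C) = complex.Re a * r by rewrite cReM /= mulr0 subr0.
have imE (r : R) : complex.Im (a * r%:C) = complex.Im a * r by rewrite cImM /= mulr0 add0r.
pose c (r : R) := expR (complex.Re a * r) * cos (complex.Im a * r).
pose s (r : R) := expR (complex.Re a * r) * sin (complex.Im a * r).
have cvgs : s (u n) @[n --> \oo] --> s x.
  by apply: cvgM; apply: cvg_seq_comp => //; [exact: continuous_expR|exact: continuous_sin].
have cvgc : c (u n) @[n --> \oo] --> c x.
  by apply: cvgM; apply: cvg_seq_comp => //; [exact: continuous_expR|exact: continuous_cos].
have lim : (`|c (u n) - c x| + `|s (u n) - s x|) @[n --> \oo] --> 0.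
  rewrite -(addr0 0); apply: cvgD.
    by apply/norm_cvg0P; rewrite -(subrr (c x)); apply: cvgB => //; exact: cvg_cst.
  by apply/norm_cvg0P; rewrite -(subrr (s x)); apply: cvgB => //; exact: cvg_cst.
apply: (squeeze_cvgr _ (cvg_cst 0) lim); apply: nearW => n /=.
rewrite cabs_ge0/=; apply: le_trans (cabs_le _) _.
by rewrite /cexp !reE !imE /= !mul0r !subr0 !addr0.
Qed.

Lemma cexp_lin (k : R[i]) a t : complex.Re (cexp (a * t%:C) * k) =
  expR (complex.Re a * t) * (complex.Re k * cos (complex.Im a * t) - complex.Im k * sin (complex.Im a * t)).
Proof.
case: a => a1 a2; case: k => k1 k2; rewrite /cexp /= !mulr0 subr0 add0r; ring.
Qed.

Lemma is_derive_cexp (k : R[i]) a t :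
  is_derive t 1 (fun s => complex.Re (cexp (a * s%:C) * k))
    (complex.Re (cexp (a * t%:C) * (a * k))).
Proof.
have -> : (fun s => complex.Re (cexp (a * s%:C) * k)) = fun s =>
  expR (complex.Re a * s) * (complex.Re k * cos (complex.Im a * s) - complex.Im k * sin (complex.Im a * s)).
  by apply/funext => s; exact: cexp_lin.
rewrite cexp_lin.
have d1 (r : R) : is_derive t 1 (fun s : R => r * s) r.
  by apply: is_derive_eq; rewrite /GRing.scale/= mulr1.
have de := is_derive1_comp (is_derive_expR (complex.Re a * t)) (d1 (complex.Re a)).
have dc := is_derive1_comp (is_derive_cos (complex.Im a * t)) (d1 (complex.Im a)).
have ds := is_derive1_comp (is_derive_sin (complex.Im a * t)) (d1 (complex.Im a)).
have dk := is_deriveB (is_deriveZ (complex.Re k) dc) (is_deriveZ (complex.Im k) ds).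
have dM := is_deriveM de dk.
apply: (@DeriveDef _ _ _ _ _ _ _); first exact: (@ex_derive _ _ _ _ _ _ _ dM).
have -> := @derive_val _ _ _ _ _ _ _ dM.
rewrite !fctE /GRing.scale /= /GRing.scale /= cReM cImM; ring.
Qed.

End Exponential.

Section Intervals.
Context (R : realType) (E : hilbertType R).
Implicit Types (f g Y : R -> E) (a : R[i]) (x y p q t : R) (c e v : E).
Local Notation leb := (@lebesgue_measure R).

Lemma leb_itv x y : x <= y -> leb `]x, y[ = (y - x)%:E.
Proof.
by rewrite le_eqVlt => /predU1P[->|xy];
  rewrite lebesgue_measure_itv/= lte_fin ?ltxx ?subrr// xy.
Qed.

Lemma bintegrable_dom (D : set R) K f g : measurable D -> strongly_measurable D f ->
  bintegrable D g -> (forall t, D t -> hnorm (f t) <= K * hnorm (g t)) -> bintegrable D f.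
Proof.
move=> mD mf gD fg; split => //.
have := integrableZl (mu := leb) mD K (bintegrable_hnorm mD gD).
move=> /integrableP[_]; apply: le_lt_trans; apply: ge0_le_integral => //=.
- by move=> x _; rewrite lee_fin hnorm_ge0.
- by apply/measurable_EFinP; exact: smeas_hnorm.
- apply/measurable_EFinP; apply: measurableT_comp => //.
  by apply: measurable_funM; [exact: measurable_cst|exact: smeas_hnorm gD.1].
by move=> x Dx; rewrite lee_fin (le_trans (fg x Dx))// ler_norm.
Qed.

Lemma bintegrable_bounded (D : set R) K f : measurable D -> (leb D < +oo)%E ->
  strongly_measurable D f -> (forall t, D t -> hnorm (f t) <= K) -> bintegrable D f.
Proof.
move=> mD fD mf fK; split => //.
apply: (@le_lt_trans _ _ (\int[leb]_(x in D) (cst `|K|%:E) x)%E).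
  apply: ge0_le_integral => //=.
  - by move=> x _; rewrite lee_fin hnorm_ge0.
  - by apply/measurable_EFinP; exact: smeas_hnorm.
  by move=> x Dx; rewrite lee_fin (le_trans (fK x Dx))// ler_norm.
by rewrite integral_cst// lte_mul_pinfty.
Qed.

Lemma hnorm_bochner_dom (D : set R) K f g : measurable D -> bintegrable D f ->
  bintegrable D g -> (forall t, D t -> hnorm (f t) <= K * hnorm (g t)) ->
  hnorm (bochner D f) <= K * \int[leb]_(t in D) hnorm (g t).
Proof.
move=> mD fD gD fg; apply: le_trans (hnorm_bochner mD fD) _.
have gi := bintegrable_hnorm mD gD; rewrite -RintegralZl//; apply: le_Rintegral => //.
- exact: bintegrable_hnorm.
- exact: (integrableZl (mu := leb) mD K gi).
Qed.

Lemma hnorm_bochner_cst K f x y : x <= y -> bintegrable `]x, y[ f ->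
  (forall t, x < t < y -> hnorm (f t) <= K) ->
  hnorm (bochner `]x, y[ f) <= K * (y - x).
Proof.
move=> xy fi fK; apply: le_trans (hnorm_bochner (measurable_itv _) fi) _.
have -> : K * (y - x) = \int[leb]_(t in `]x, y[) K.
  by rewrite Rintegral_cst//= leb_itv.
apply: le_Rintegral => //.
- exact: bintegrable_hnorm.
- apply/integrableP; split; first exact: measurable_cst.
  rewrite (_ : (fun _ => _) = cst `|K|%:E)// integral_cst//=.
  by rewrite leb_itv// -EFinM ltry.
Qed.

Lemma bochner_set0 f : bochner set0 f = 0.
Proof. by rewrite (@eq_bochner _ _ _ _ (fun=> 0))// bochner0. Qed.

Lemma bochner_itv0 f x y : y <= x -> bochner `]x, y[ f = 0.
Proof.
move=> yx; have -> : `]x, y[%classic = set0 :> set R; last exact: bochner_set0.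
by apply/seteqP; split=> t //=; rewrite in_itv/= => /andP[xt ty]; have := lt_trans xt ty; rewrite ltNge yx.
Qed.

Lemma bochner_itv_cat f (b1 b2 : itv_bound R) y :
  (b1 <= BLeft y)%O -> (BRight y <= b2)%O -> bintegrable [set` Interval b1 b2] f ->
  bochner [set` Interval b1 b2] f =
  bochner [set` Interval b1 (BLeft y)] f + bochner [set` Interval (BRight y) b2] f.
Proof.
move=> by1 by2 fi.
have e1 : [set` Interval b1 b2] = [set` Interval b1 (BLeft y)] `|` [set` Interval (BLeft y) b2].
  by rewrite -itv_bndbnd_setU//; apply: le_trans by2; rewrite bnd_simp.
have e2 : [set` Interval (BLeft y) b2] = [set y] `|` [set` Interval (BRight y) b2].
  by rewrite -set_itv1 -itv_bndbnd_setU// bnd_simp.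
have d1 : [disjoint [set` Interval b1 (BLeft y)] & [set` Interval (BLeft y) b2]].
  apply/disj_setPS => t [] /=; rewrite !itv_boundlr !bnd_simp => /andP[_ ty] /andP[yt _].
  by have := lt_le_trans ty yt; rewrite ltxx.
have d2 : [disjoint [set y] & [set` Interval (BRight y) b2]].
  by apply/disj_setPS => t [] /= ->; rewrite itv_boundlr !bnd_simp ?ltxx.
have m1 : measurable [set` Interval (BLeft y) b2] by exact: measurable_itv.
have m0 : measurable [set` Interval b1 (BLeft y)] by exact: measurable_itv.
have m2 : measurable [set` Interval (BRight y) b2] by exact: measurable_itv.
have fi1 := fi; rewrite e1 in fi1.
have fi2 : bintegrable ([set y] `|` [set` Interval (BRight y) b2]) f.
  rewrite -e2; apply: (bintegrable_subset (measurableU _ _ m0 m1) m1 _ fi1).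
  by move=> t; right.
rewrite e1 (bochner_setU m0 m1 d1 fi1) e2.
by rewrite (bochner_setU (measurable_set1 y) m2 d2 fi2) bochner_set1 add0r.
Qed.

Lemma Rintegral_cat (phi : R -> R) x y z : x <= y -> y <= z ->
  leb.-integrable `]x, z[ (EFin \o phi) ->
  \int[leb]_(t in `]x, z[) phi t =
  \int[leb]_(t in `]x, y[) phi t + \int[leb]_(t in `]y, z[) phi t.
Proof.
have itv0 (s : R) : `]s, s[%classic = set0 :> set R.
  by apply/seteqP; split=> t //=; rewrite in_itv/= => /andP[] /lt_trans h /h; rewrite ltxx.
rewrite le_eqVlt => /predU1P[->|xy]; first by rewrite itv0 Rintegral_set0 add0r.
rewrite le_eqVlt => /predU1P[->|yz]; first by rewrite (itv0 z) Rintegral_set0 addr0.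
move=> fi; rewrite -(@Rintegral_itvB _ _ _ _ y fi) ?bnd_simp//; try exact: ltW.
rewrite -Rintegral_itv_bndo_bndc ?(addrC _ (_ - _)) ?subrK//.
apply: integrableS fi => //; apply: subset_itvl; rewrite bnd_simp; exact: ltW.
Qed.

Lemma bochner_cat f x y z : x <= y -> y <= z -> bintegrable `]x, z[ f ->
  bochner `]x, z[ f = bochner `]x, y[ f + bochner `]y, z[ f.
Proof.
rewrite le_eqVlt => /predU1P[->|xy]; first by rewrite bochner_itv0// add0r.
rewrite le_eqVlt => /predU1P[->|yz]; first by rewrite (@bochner_itv0 _ z z)// addr0.
by move=> fi; rewrite (bochner_itv_cat (y := y))// bnd_simp.
Qed.

Definition cexp_bound a x y : R := expR (`|complex.Re a| * (`|x| + `|y|)).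

Lemma cabs_cexp_le a x y t : x <= t <= y -> cabs (cexp (a * t%:C)) <= cexp_bound a x y.
Proof.
move=> /andP[xt ty]; rewrite cabs_cexp ler_expR cReM /= mulr0 subr0.
apply: le_trans (ler_norm _) _; rewrite normrM ler_wpM2l// ler_norml.
by have := ler_norm (- x); rewrite normrN; have := ler_norm y; have := normr_ge0 x;
  have := normr_ge0 y; move: `|x| `|y| => *; apply/andP; split; lra.
Qed.

Lemma bintegrable_cexp a f x y : bintegrable `]x, y[ f ->
  bintegrable `]x, y[ (fun t => cexp (a * t%:C) *: f t).
Proof.
move=> fi; apply: (@bintegrable_dom _ (cexp_bound a x y) _ f) => //.
  by apply: smeas_scale fi.1; exact: seq_continuous_cexp.
move=> t; rewrite /= in_itv/= => /andP[xt ty].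
by rewrite hnormZ ler_wpM2r ?hnorm_ge0// cabs_cexp_le// !ltW.
Qed.

Lemma bintegrable_cst c x y : bintegrable `]x, y[ (fun=> c).
Proof.
apply: (@bintegrable_bounded _ (hnorm c)) => //; last first.
  by apply: smeas_continuous => t _ u _; exact: hcvg_cst.
by have [xy|yx] := leP x y; rewrite lebesgue_measure_itv/=; case: ifPn => _; rewrite ?ltry.
Qed.

Lemma bochner_cexp a c x y : x <= y ->
  bochner `]x, y[ (fun t => (a * cexp (a * t%:C)) *: c) =
  (cexp (a * y%:C) - cexp (a * x%:C)) *: c.
Proof.
rewrite le_eqVlt => /predU1P[->|xy].
  by rewrite bochner_itv0// subrr scale0r.
have cexp_bint : bintegrable `]x, y[ (fun t => (a * cexp (a * t%:C)) *: c).
  have := bintegrableZ a (measurable_itv _) (bintegrable_cexp a (bintegrable_cst c x y)).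
  by congr bintegrable; apply/funext => t; rewrite scalerA.
apply: bochnerP => // e; set k := <[c, e]>.
have -> : rdot ((cexp (a * y%:C) - cexp (a * x%:C)) *: c) e =
  complex.Re (cexp (a * y%:C) * k) - complex.Re (cexp (a * x%:C) * k).
  by rewrite /rdot hdotZl -/k mulrBl cReD cReN.
pose F t := complex.Re (cexp (a * t%:C) * k).
pose F' t := complex.Re (cexp (a * t%:C) * (a * k)).
have dF t : is_derive t 1 F (F' t) by exact: is_derive_cexp.
have -> : \int[leb]_(t in `]x, y[) rdot ((a * cexp (a * t%:C)) *: c) e =
    \int[leb]_(t in `]x, y[) F' t.
  apply: eq_Rintegral => t _; rewrite /rdot hdotZl -/k /F'; congr complex.Re; ring.
have F'c : continuous F'.
  move=> t; apply: differentiable_continuous; apply/derivable1_diffP.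
  exact: (@ex_derive _ _ _ _ _ _ _ (is_derive_cexp (a * k) a t)).
have Fc : continuous F.
  move=> t; apply: differentiable_continuous; apply/derivable1_diffP.
  exact: (@ex_derive _ _ _ _ _ _ _ (dF t)).
have F'w : {within `[x, y], continuous F'} by exact: continuous_subspaceT.
have F1 : derivable_oo_LRcontinuous F x y.
  split=> [t _||].
  - exact: (@ex_derive _ _ _ _ _ _ _ (dF t)).
  - by apply: cvg_at_right_filter; exact: Fc.
  - by apply: cvg_at_left_filter; exact: Fc.
have F2 : {in `]x, y[, F^`()%classic =1 F'}.
  by move=> t _; rewrite derive1E; exact: (@derive_val _ _ _ _ _ _ _ (dF t)).
have ftc := continuous_FTC2 xy F'w F1 F2.
rewrite integral_itv_bndoo in ftc; last first.
  by apply/measurable_EFinP/measurable_funTS; exact: continuous_measurable_fun.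
by rewrite /Rintegral ftc.
Qed.

(** An increment bounded by a product of two increments is of second order: on a
    partition of [p, q] into [n] equal parts the errors add up to [O(1/n)].  This
    replaces differentiation of [Phi], which is only differentiable almost
    everywhere. *)
Lemma zero_increment (Phi : R -> E) (g : R -> R) C p q : p <= q ->
  (forall x y, p <= x -> x <= y -> y <= q ->
     hnorm (Phi y - Phi x) <= C * (y - x) * (g y - g x)) -> Phi q = Phi p.
Proof.
move=> pq H; apply/subr0_eq/hnorm_eq0/eqP; rewrite eq_le hnorm_ge0 andbT.
have bound n : hnorm (Phi q - Phi p) <= C * (q - p) * (g q - g p) / n.+1%:R.
  pose d := (q - p) / n.+1%:R; pose x k := p + k%:R * d.
  have d0 : 0 <= d by rewrite divr_ge0// subr_ge0.
  have xn : x n.+1 = q by rewrite /x /d mulrC divfK ?pnatr_eq0// addrC subrK.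
  have xp k : p <= x k by rewrite lerDl mulr_ge0.
  have xq k : (k <= n.+1)%N -> x k <= q.
    by move=> kn; rewrite -xn lerD2l ler_wpM2r// ler_nat.
  have xS k : x k.+1 - x k = d by rewrite /x -natr1; ring.
  have : forall k, (k <= n.+1)%N -> hnorm (Phi (x k) - Phi p) <= C * d * (g (x k) - g p).
    elim=> [_|k IH kn].
      by rewrite /x mul0r addr0 !subrr mulr0 hnorm0.
    apply: le_trans (hnorm_triangle _ (Phi (x k)) _) _.
    have -> : C * d * (g (x k.+1) - g p) =
      C * d * (g (x k.+1) - g (x k)) + C * d * (g (x k) - g p) by ring.
    apply: lerD; last by apply: IH; exact: ltnW.
    rewrite -{1}(xS k); apply: H => //; last exact: xq.
    by rewrite -subr_ge0 xS.
  by move=> /(_ n.+1 (leqnn _)); rewrite xn /d; congr (_ <= _); ring.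
set K := C * (q - p) * (g q - g p) in bound.
have lim : K / n.+1%:R @[n --> \oo] --> K * 0 by apply: cvgMr; exact: cvg_harmonic.
rewrite mulr0 in lim; rewrite -(cvg_lim _ lim)//; apply: limr_ge; first exact: cvgP lim.
exact: nearW.
Qed.

(** Integration by parts for a function [Y] whose derivative [f] is merely
    integrable.  The difference [Phi] of the two sides, as a function of the upper
    end, satisfies the hypothesis of [zero_increment], with the integral of [|f|]
    for the second increment. *)
Lemma exp_by_parts a f Y p q : p <= q -> bintegrable `]p, q[ f ->
  strongly_measurable `]p, q[ Y ->
  (forall x y, p <= x -> x <= y -> y <= q -> Y y - Y x = bochner `]x, y[ f) ->
  cexp (a * q%:C) *: Y q - cexp (a * p%:C) *: Y p =
  bochner `]p, q[ (fun t => (a * cexp (a * t%:C)) *: Y t + cexp (a * t%:C) *: f t).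
Proof.
move=> pq fi mY YE.
pose h t := cexp (a * t%:C); pose M := cexp_bound a p q; pose La := cabs a * M.
have M0 : 0 <= M by exact: expR_ge0.
have La0 : 0 <= La by rewrite mulr_ge0// cabs_ge0.
have sub_itv x y : p <= x -> y <= q -> `]x, y[%classic `<=` `]p, q[%classic.
  move=> px yq t /=; rewrite !in_itv/= => /andP[xt ty].
  by rewrite (le_lt_trans px xt) (lt_le_trans ty yq).
have bsub (k : R -> E) x y : bintegrable `]p, q[ k -> p <= x -> y <= q -> bintegrable `]x, y[ k.
  by move=> ki px yq; apply: (bintegrable_subset _ _ (sub_itv x y px yq)) ki.
have hM t : p <= t -> t <= q -> cabs (h t) <= M.
  by move=> pt tq; apply: cabs_cexp_le; rewrite pt.
have lip c x y : p <= x -> x <= y -> y <= q ->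
    hnorm ((h y - h x) *: c) <= La * (y - x) * hnorm c.
  move=> px xy yq; rewrite -bochner_cexp// mulrAC; apply: hnorm_bochner_cst => //.
    have := bintegrableZ a (measurable_itv _) (bintegrable_cexp a (bintegrable_cst c x y)).
    by congr bintegrable; apply/funext => t; rewrite scalerA.
  move=> t /andP[xt ty]; rewrite hnormZ -/(cabs _) cabsM ler_wpM2r ?hnorm_ge0//.
  rewrite ler_wpM2l ?cabs_ge0//; apply: hM; first exact: le_trans px (ltW xt).
  exact: le_trans (ltW ty) yq.
pose g x := \int[leb]_(t in `]p, x[) hnorm (f t).
pose N x y := \int[leb]_(t in `]x, y[) hnorm (f t).
have gE x y : p <= x -> x <= y -> y <= q -> g y - g x = N x y.
  move=> px xy yq; rewrite /g (@Rintegral_cat _ p x y)//; first by rewrite addrC addKr.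
  by apply: bintegrable_hnorm => //; exact: bsub.
have N0 x y : 0 <= N x y by apply: Rintegral_ge0 => t _; exact: hnorm_ge0.
have Ybound t : p <= t -> t <= q -> hnorm (Y t) <= hnorm (Y p) + N p q.
  move=> pt tq; have := YE p t (lexx p) pt tq => /(canRL (subrK _)) ->.
  rewrite addrC; apply: le_trans (hnormD _ _) _; rewrite lerD2l.
  apply: le_trans (hnorm_bochner _ (bsub _ p t fi (lexx p) tq)) _ => //.
  have := gE _ _ pt tq (lexx q); have := N0 t q; rewrite /N /g; lra.
have Yi : bintegrable `]p, q[ Y.
  apply: (@bintegrable_bounded _ (hnorm (Y p) + N p q)) => //.
    by rewrite leb_itv// ltry.
  move=> t; rewrite /= in_itv/= => /andP[pt tq]; apply: Ybound; exact: ltW.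
have ahYi : bintegrable `]p, q[ (fun t => (a * h t) *: Y t).
  have := bintegrableZ a (measurable_itv _) (bintegrable_cexp a Yi).
  by congr bintegrable; apply/funext => t; rewrite scalerA.
have hfi : bintegrable `]p, q[ (fun t => h t *: f t) by exact: bintegrable_cexp.
pose k t := (a * h t) *: Y t + h t *: f t.
have ki : bintegrable `]p, q[ k by exact: bintegrableD.
pose Phi s := h s *: Y s - bochner `]p, s[ k.
have : Phi q = Phi p.
  apply: (@zero_increment Phi g (2 * La) p q pq) => x y px xy yq.
  have xq := le_trans xy yq; have py := le_trans px xy.
  have fxy := bsub _ x y fi px yq; have Yxy := bsub _ x y Yi px yq.
  have ahYxy := bsub _ x y ahYi px yq; have hfxy := bsub _ x y hfi px yq.
  have kpy := bsub _ p y ki (lexx p) yq.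
  have cst c := bintegrable_cst c x y.
  have ahc c : bintegrable `]x, y[ (fun t => (a * h t) *: c).
    have := bintegrableZ a (measurable_itv _) (bintegrable_cexp a (cst c)).
    by congr bintegrable; apply/funext => t; rewrite scalerA.
  have i1 : bintegrable `]x, y[ (fun t => h y *: f t - h t *: f t).
    by apply: bintegrableB; [exact: measurable_itv|exact: bintegrableZ|exact: hfxy].
  have i2 : bintegrable `]x, y[ (fun t => (a * h t) *: Y x - (a * h t) *: Y t).
    exact: bintegrableB.
  have -> : Phi y - Phi x =
      bochner `]x, y[ (fun t => h y *: f t - h t *: f t) +
      bochner `]x, y[ (fun t => (a * h t) *: Y x - (a * h t) *: Y t).
    have mxy : measurable (`]x, y[%classic : set R) by exact: measurable_itv.
    rewrite (bochnerB mxy (bintegrableZ (h y) mxy fxy) hfxy).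
    rewrite (bochnerB mxy (ahc (Y x)) ahYxy) (bochnerZ (h y) mxy fxy) -(YE _ _ px xy yq).
    rewrite (bochner_cexp a (Y x) xy) -/(h _) -/(h _) /Phi.
    rewrite (bochner_cat px xy kpy) (bochnerD mxy ahYxy hfxy).
    move: (bochner `]p, x[ k) (bochner `]x, y[ (fun t => (a * h t) *: Y t))
      (bochner `]x, y[ (fun t => h t *: f t)) (h y) (h x) (Y y) (Y x).
    move=> B0 B1 B2 hy hx y1 y2.
    hmodule.
  apply: le_trans (hnormD _ _) _.
  have -> : 2 * La * (y - x) * (g y - g x) = La * (y - x) * N x y + La * N x y * (y - x).
    by rewrite gE//; ring.
  apply: lerD.
    apply: (@hnorm_bochner_dom _ _ _ f) => // t; rewrite /= in_itv/= => /andP[xt ty].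
    rewrite -scalerBl; apply: le_trans (lip _ _ _ _ _ _) _ => //.
    - exact: le_trans px (ltW xt).
    - exact: ltW.
    by rewrite ler_wpM2r ?hnorm_ge0// ler_wpM2l// lerD2l lerN2 ltW.
  apply: hnorm_bochner_cst => // t /andP[xt ty].
  rewrite -scalerBr hnormZ -/(cabs _) cabsM ler_pM ?mulr_ge0 ?cabs_ge0 ?hnorm_ge0//.
    by rewrite ler_wpM2l ?cabs_ge0// hM// ?(le_trans px)// ?(le_trans _ yq)// ltW.
  rewrite hnormB YE//; [|exact: ltW|by apply: le_trans yq; exact: ltW].
  apply: le_trans (hnorm_bochner _ (bsub _ x t fi px (le_trans (ltW ty) yq))) _ => //.
  have xt' := ltW xt; have ty' := ltW ty; have tq := le_trans ty' yq.
  have := gE _ _ px xt' tq; have := gE _ _ px xy yq.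
  have := gE _ _ (le_trans px xt') ty' yq; have := N0 t y; rewrite /N; lra.
rewrite /Phi (@bochner_itv0 k p p)// subr0 => <-.
by rewrite opprB addrC subrK.
Qed.

End Intervals.
(** * Duhamel's formula *)

Section LocallyL2.
Context (R : realType) (E : hilbertType R).
Implicit Types (f g Y k F : R -> E) (a z : R[i]) (x y p q t s : R) (c e v : E) (D : set R).
Local Notation leb := (@lebesgue_measure R).

Lemma ae_mono (P Q : R -> Prop) : (forall x, P x -> Q x) ->
  {ae leb, forall x, P x} -> {ae leb, forall x, Q x}.
Proof. by move=> PQ; apply: negligibleS => x; exact: contra_not (PQ x). Qed.

Lemma ae_mono2 (P Q S : R -> Prop) : (forall x, P x -> Q x -> S x) ->
  {ae leb, forall x, P x} -> {ae leb, forall x, Q x} -> {ae leb, forall x, S x}.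
Proof.
move=> PQS aP aQ; apply: negligibleS (negligibleU aP aQ) => x /= nS.
by apply: contrapT => /not_orP[/contrapT Px /contrapT Qx]; exact/nS/PQS.
Qed.

Definition locL2 f := strongly_measurable setT f /\
  forall p q, (\int[leb]_(x in `]p, q[) ((hnorm (f x)) ^+ 2)%:E < +oo)%E.

Lemma measurable_hnorm2 D f : strongly_measurable D f ->
  measurable_fun D (fun x => ((hnorm (f x)) ^+ 2)%:E).
Proof.
move=> mf; apply/measurable_EFinP.
by apply: measurable_funX; exact: smeas_hnorm.
Qed.

Lemma L2_subset D D' f : measurable D -> measurable D' -> D' `<=` D ->
  L2 D f -> L2 D' f.
Proof.
move=> mD mD' DD' [mf fi]; split; first exact: smeas_sub mf.
apply: le_lt_trans fi; apply: ge0_subset_integral => //.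
  exact: measurable_hnorm2.
by move=> x _; rewrite lee_fin sqr_ge0.
Qed.

Lemma L2_locL2 f : L2 setT f -> locL2 f.
Proof.
move=> fL; split; first exact: fL.1.
by move=> p q; have [] := @L2_subset setT `]p, q[ f measurableT (measurable_itv _) _ fL.
Qed.

Lemma L2_lin D a f g : measurable D -> L2 D f -> L2 D g ->
  L2 D (fun x => a *: f x + g x).
Proof.
move=> mD [mf fi] [mg gi]; have mfg := smeas_lin a mf mg; split => //.
apply: (@le_lt_trans _ _ (\int[leb]_(x in D)
   ((2 * cabs a ^+ 2)%:E * ((hnorm (f x)) ^+ 2)%:E + 2%:E * ((hnorm (g x)) ^+ 2)%:E))%E).
  apply: ge0_le_integral => //.
  - by move=> x _; rewrite lee_fin sqr_ge0.
  - exact: measurable_hnorm2.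
  - by apply: emeasurable_funD; apply: measurable_funeM; exact: measurable_hnorm2.
  move=> x Dx; rewrite -!EFinM -EFinD lee_fin.
  apply: (@le_trans _ _ ((cabs a * hnorm (f x) + hnorm (g x)) ^+ 2)).
    rewrite ler_sqr ?nnegrE ?addr_ge0 ?mulr_ge0 ?hnorm_ge0 ?cabs_ge0//.
    by rewrite (le_trans (hnormD _ _))// hnormZ.
  have := sqr_ge0 (cabs a * hnorm (f x) - hnorm (g x)).
  by rewrite sqrrB sqrrD exprMn; lra.
rewrite ge0_integralD//; last 4 first.
- move=> x _; rewrite -EFinM lee_fin; apply: mulr_ge0; last exact: sqr_ge0.
  by apply: mulr_ge0; [exact: ler0n|exact: sqr_ge0].
- by apply: measurable_funeM; exact: measurable_hnorm2.
- move=> x _; rewrite -EFinM lee_fin; apply: mulr_ge0; last exact: sqr_ge0.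
  exact: ler0n.
- by apply: measurable_funeM; exact: measurable_hnorm2.
rewrite !ge0_integralZl//.
- apply: lte_add_pinfty; apply: lte_mul_pinfty => //.
  by rewrite lee_fin; apply: mulr_ge0; [exact: ler0n|exact: sqr_ge0].
- exact: measurable_hnorm2.
- by move=> x _; rewrite lee_fin sqr_ge0.
- exact: measurable_hnorm2.
- by move=> x _; rewrite lee_fin sqr_ge0.
- by rewrite lee_fin mulr_ge0// sqr_ge0.
Qed.

Lemma L2_bintegrable D f : measurable D -> (leb D < +oo)%E -> L2 D f -> bintegrable D f.
Proof.
move=> mD Dfin [mf fi]; split => //.
apply: (@le_lt_trans _ _ (\int[leb]_(x in D) (cst 1%E x + ((hnorm (f x)) ^+ 2)%:E))%E).
  apply: ge0_le_integral => //.
  - by move=> x _; rewrite lee_fin hnorm_ge0.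
  - by apply/measurable_EFinP; exact: smeas_hnorm.
  - by apply: emeasurable_funD; [exact: measurable_cst|exact: measurable_hnorm2].
  move=> x Dx; rewrite -EFinD lee_fin.
  by have := sqr_ge0 (hnorm (f x) - 2^-1); rewrite sqrrB; have := hnorm_ge0 (f x); lra.
rewrite ge0_integralD//; last 2 first.
- by move=> x _; rewrite lee_fin sqr_ge0.
- exact: measurable_hnorm2.
by rewrite integral_cst// mul1e lte_add_pinfty.
Qed.

Lemma locL2_bintegrable f p q : locL2 f -> bintegrable `]p, q[ f.
Proof.
move=> [mf fi]; apply: L2_bintegrable => //; last by split; [exact: smeas_sub mf|].
by rewrite lebesgue_measure_itv/=; case: ifPn => _; rewrite ?ltry.
Qed.

Lemma locL2_cexp a f : locL2 f -> locL2 (fun t => cexp (a * t%:C) *: f t).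
Proof.
move=> [mf fi]; split.
  by apply: smeas_scale mf; exact: seq_continuous_cexp.
move=> p q; pose M := cexp_bound a p q.
have mf' : strongly_measurable `]p, q[ f by exact: smeas_sub mf.
apply: (@le_lt_trans _ _ (\int[leb]_(x in `]p, q[) ((M ^+ 2)%:E * ((hnorm (f x)) ^+ 2)%:E))%E).
  apply: ge0_le_integral => //.
  - by move=> x _; rewrite lee_fin sqr_ge0.
  - by apply: measurable_hnorm2; apply: smeas_scale mf'; exact: seq_continuous_cexp.
  - by apply: measurable_funeM; exact: measurable_hnorm2.
  move=> x; rewrite /= in_itv/= => /andP[px xq]; rewrite -EFinM lee_fin -exprMn.
  rewrite ler_sqr ?nnegrE ?mulr_ge0 ?hnorm_ge0 ?expR_ge0// hnormZ.
  by rewrite ler_wpM2r ?hnorm_ge0// cabs_cexp_le// !ltW.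
rewrite ge0_integralZl//.
- by rewrite lte_mul_pinfty// lee_fin sqr_ge0.
- exact: measurable_hnorm2.
- by move=> x _; rewrite lee_fin sqr_ge0.
- by rewrite lee_fin sqr_ge0.
Qed.

Lemma locL2Z a f : locL2 f -> locL2 (fun t => a *: f t).
Proof.
move=> [mf fi].
have z0 (D : set R) : measurable D -> L2 D (fun=> 0 : E).
  move=> mD; split; first by apply: smeas_continuous => x _ u _; exact: hcvg_cst.
  by under eq_integral do rewrite hnorm0 expr0n; rewrite integral0.
split.
  have := smeas_lin a mf (z0 setT measurableT).1.
  by congr strongly_measurable; apply/funext => x; rewrite addr0.
move=> p q; have mpq : measurable (`]p, q[%classic : set R) by exact: measurable_itv.
have fpq : L2 `]p, q[ f by split; [exact: smeas_sub mf|exact: fi].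
have [_] := L2_lin a mpq fpq (z0 _ mpq).
by under eq_integral do rewrite addr0.
Qed.

Lemma smeasT_patch D f : measurable D -> L2 D f ->
  L2 setT (fun x => if x \in D then f x else 0).
Proof.
move=> mD [mf fi]; split; first exact: smeas_patch.
apply: le_lt_trans fi.
rewrite [leRHS]integral_mkcond le_eqVlt; apply/orP; left; apply/eqP/eq_integral => x _.
by rewrite patchE; case: ifPn => // _; rewrite hnorm0 expr0n.
Qed.

(** The Cauchy-Schwarz inequality in the form [h <= s + h^2 / s], which avoids square
    roots. *)
Lemma hnorm_bochner_L2 f p q x y s : locL2 f -> 0 < s -> p <= x -> x <= y -> y <= q ->
  hnorm (bochner `]x, y[ f) <=
  s * (y - x) + s^-1 * fine (\int[leb]_(t in `]p, q[) ((hnorm (f t)) ^+ 2)%:E).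
Proof.
move=> fL s0 px xy yq; have [mf fi] := fL.
have mI (p' q' : R) : measurable (`]p', q'[%classic : set R) by exact: measurable_itv.
apply: le_trans (hnorm_bochner (mI x y) (locL2_bintegrable x y fL)) _.
have fxy : strongly_measurable `]x, y[ f by exact: smeas_sub mf.
have fpq : strongly_measurable `]p, q[ f by exact: smeas_sub mf.
have i2 : leb.-integrable `]x, y[ (EFin \o (fun t => s^-1 * hnorm (f t) ^+ 2)).
  apply: (integrableZl (mu := leb) (mI x y) s^-1 (f := fun t => (hnorm (f t) ^+ 2)%:E)).
  apply/integrableP; split; first exact: measurable_hnorm2.
  by under eq_integral do rewrite gee0_abs ?lee_fin ?sqr_ge0//; exact: fi.
have i1 : leb.-integrable `]x, y[ (EFin \o (fun=> s)).
  apply/integrableP; split; first exact: measurable_cst.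
  rewrite (_ : (fun _ => _) = cst `|s|%:E)// integral_cst//=.
  by rewrite leb_itv// -EFinM ltry.
apply: (@le_trans _ _ (\int[leb]_(t in `]x, y[) (s + s^-1 * hnorm (f t) ^+ 2))).
  apply: le_Rintegral => //.
  - exact: (bintegrable_hnorm (mI x y) (locL2_bintegrable x y fL)).
  - exact: (integrableD (mu := leb) (mI x y) i1 i2).
  move=> t _; have h0 := hnorm_ge0 (f t).
  have [hs|sh] := leP (hnorm (f t)) s.
    by rewrite (le_trans hs)// lerDl mulr_ge0 ?sqr_ge0// invr_ge0 ltW.
  by rewrite ler_wpDl ?(ltW s0)// mulrC ler_pdivlMr// expr2 ler_wpM2l// ltW.
rewrite RintegralD// Rintegral_cst//= leb_itv//= lerD2l.
rewrite /Rintegral.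
have -> : (\int[leb]_(t in `]x, y[) (s^-1 * hnorm (f t) ^+ 2)%:E =
    s^-1%:E * \int[leb]_(t in `]x, y[) (hnorm (f t) ^+ 2)%:E)%E.
  under eq_integral do rewrite EFinM; rewrite ge0_integralZl//.
  - exact: measurable_hnorm2.
  - by move=> t _; rewrite lee_fin sqr_ge0.
  - by rewrite lee_fin invr_ge0 ltW.
have fn0 (p' q' : R) : (\int[leb]_(t in `]p', q'[) (hnorm (f t) ^+ 2)%:E \is a fin_num)%E.
  by rewrite ge0_fin_numE ?fi// integral_ge0// => t _; rewrite lee_fin sqr_ge0.
rewrite fineM//= ler_wpM2l ?invr_ge0 ?(ltW s0)// fine_le//.
apply: ge0_subset_integral => //.
- exact: measurable_hnorm2.
- by move=> t _; rewrite lee_fin sqr_ge0.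
move=> t /=; rewrite !in_itv/= => /andP[xt ty].
by rewrite (le_lt_trans px xt) (lt_le_trans ty yq).
Qed.

Definition oint f x := oriented_bochner 0 x f.

Lemma oint_sub f x y : (forall p q, bintegrable `]p, q[ f) -> x <= y ->
  oint f y - oint f x = bochner `]x, y[ f.
Proof.
move=> fi xy; rewrite /oint /oriented_bochner.
have [x0|x0] := leP 0 x.
  by rewrite (le_trans x0 xy) (bochner_cat x0 xy (fi _ _)) addrC addKr.
have [y0|y0] := leP 0 y; rewrite opprK.
  by rewrite addrC (bochner_cat (ltW x0) y0 (fi _ _)).
by rewrite (bochner_cat xy (ltW y0) (fi _ _)) addrC addrK.
Qed.

Lemma oint0 f : oint f 0 = 0.
Proof. by rewrite /oint /oriented_bochner lexx bochner_itv0. Qed.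

Lemma oint_continuous f x : locL2 f -> seq_continuous_at (oint f) x.
Proof.
move=> fL u ux r r0; have fi p q := locL2_bintegrable p q fL.
pose B := fine (\int[leb]_(t in `](x - 1), (x + 1)[) ((hnorm (f t)) ^+ 2)%:E).
have B0 : 0 <= B by rewrite fine_ge0// integral_ge0// => t _; rewrite lee_fin sqr_ge0.
pose s := (2 * B + 1) / r * 2.
have s0 : 0 < s by rewrite mulr_gt0// divr_gt0// ltr_wpDl// mulr_ge0.
have bound y : `|y - x| <= 1 -> hnorm (oint f y - oint f x) <= s * `|y - x| + s^-1 * B.
  rewrite ler_norml => /andP[y1 y2]; have [xy|yx] := leP x y.
    rewrite oint_sub// ger0_norm ?subr_ge0//.
    by apply: hnorm_bochner_L2 => //; lra.
  rewrite hnormB oint_sub ?(ltW yx)// ltr0_norm ?subr_lt0// opprB.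
  by apply: hnorm_bochner_L2 => //; lra.
have e0 : 0 < Num.min 1 (r / (2 * s)) by rewrite lt_min ltr01 divr_gt0// mulr_gt0.
have /cvgrPdist_lt/(_ _ e0)[N _ NP] := ux.
exists N => n Nn; have := NP n Nn; rewrite /= distrC lt_min => /andP[u1 u2].
apply: le_lt_trans (bound _ (ltW u1)) _.
have sB : s^-1 * B <= r / 4.
  rewrite mulrC ler_pdivrMr// /s mulrA mulrA.
  rewrite (_ : r / 4 * (2 * B + 1) = (2 * B + 1) / 4 * r); last by ring.
  by rewrite mulfK ?gt_eqF//; lra.
clearbody s; have : s * `|u n - x| < r / 2.
  move: u2; rewrite ltr_pdivlMr ?mulr_gt0// => u2; rewrite ltr_pdivlMr//.
  by rewrite (_ : s * _ * 2 = `|u n - x| * (2 * s))//; ring.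
lra.
Qed.

Lemma smeas_oint f c D : locL2 f -> strongly_measurable D (fun x => c + oint f x).
Proof.
move=> fL; apply: smeas_continuous => x _ u ux; apply: hcvgD; first exact: hcvg_cst.
exact: (oint_continuous fL ux).
Qed.

Lemma ae_eq_bochner D f g : measurable D -> bintegrable D f -> bintegrable D g ->
  ae_eq_on D f g -> bochner D f = bochner D g.
Proof.
move=> mD fD gD fg; apply: bochnerP => // e; rewrite bochner_rdot//.
rewrite /Rintegral; congr fine; apply: ae_eq_integral => //.
- by have /integrableP[] := bintegrable_rdot e mD gD.
- by have /integrableP[] := bintegrable_rdot e mD fD.
- by apply: ae_mono fg => x fgx Dx; rewrite /= fgx.
Qed.

(** The solution of [i v' - z v = F] with [v 0 = c]. *)
Definition duhamel z F c x : E :=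
  cexp (- ('i%C * z * x%:C)) *:
    (c - 'i%C *: oint (fun t => cexp ('i%C * z * t%:C) *: F t) x).

Lemma duhamel0 z F c : duhamel z F c 0 = c.
Proof. by rewrite /duhamel oint0 scaler0 subr0 mulr0 oppr0 cexp0 scale1r. Qed.

Lemma oint_scale a f g x :
  (forall p q, bochner `]p, q[ f = a *: bochner `]p, q[ g) -> oint f x = a *: oint g x.
Proof.
by move=> fg; rewrite /oint /oriented_bochner !fg; case: (0 <= x); rewrite ?scalerN.
Qed.

Lemma ointB f g k x :
  (forall p q, bochner `]p, q[ f = bochner `]p, q[ g - bochner `]p, q[ k) ->
  oint f x = oint g x - oint k x.
Proof.
by move=> fg; rewrite /oint /oriented_bochner !fg; case: (0 <= x); rewrite // -opprD.
Qed.

Lemma ointZ a f x : (forall p q, bintegrable `]p, q[ f) ->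
  oint (fun t => a *: f t) x = a *: oint f x.
Proof.
by move=> fi; apply: oint_scale => p q; exact: (bochnerZ a (measurable_itv _) (fi p q)).
Qed.

Lemma duhamel_solves z F c x : locL2 F ->
  duhamel z F c x =
  c + oint (fun t => - 'i%C *: (F t + z *: duhamel z F c t)) x.
Proof.
move=> FL; pose G t := cexp ('i%C * z * t%:C) *: F t.
have GL : locL2 G by exact: locL2_cexp.
have iGL : locL2 (fun t => - 'i%C *: G t) by exact: locL2Z.
pose Y t := c + oint (fun t => - 'i%C *: G t) t.
have GI p q := locL2_bintegrable p q GL.
have iGI p q := locL2_bintegrable p q iGL.
have vE t : duhamel z F c t = cexp (- ('i%C * z) * t%:C) *: Y t.
  by rewrite /duhamel /Y ointZ// scaleNr mulNr.
have step p q : p <= q -> duhamel z F c q - duhamel z F c p =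
    bochner `]p, q[ (fun t => - 'i%C *: (F t + z *: duhamel z F c t)).
  move=> pq; rewrite !vE.
  have := exp_by_parts (- ('i%C * z)) pq (iGI p q) (smeas_oint c _ iGL).
  move=> ->; last by move=> x' y' _ xy _; rewrite /Y opprD addrACA subrr add0r oint_sub.
  apply: eq_bochner => t _; rewrite vE /G.
  have K : cexp (- ('i%C * z) * t%:C) * cexp ('i%C * z * t%:C) = 1.
    by rewrite mulNr cexpNK.
  rewrite -/(Y t) !scalerA.
  rewrite (_ : cexp (- ('i%C * z) * t%:C) * - 'i%C * cexp ('i%C * z * t%:C) = - 'i%C).
    by rewrite [RHS]scalerDr scalerA addrC; congr (_ + _); congr (_ *: _); ring.
  by rewrite mulrAC K mul1r.
rewrite /oint /oriented_bochner; case: ifPn => [x0|/negbTE x0].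
  by rewrite -step// duhamel0 addrC subrK.
by rewrite -step ?duhamel0 ?opprB 1?addrC ?subrK// ltW// ltNge x0.
Qed.

(** [Y] is the absolutely continuous function with value [c] at [0] and derivative
    [k]; when it solves the equation, multiplying by the exponential makes the
    homogeneous part disappear. *)
Lemma duhamel_unique z F c k p q (Y := fun x => c + oint k x) : p <= q ->
  locL2 F -> locL2 k ->
  ae_eq_on `]p, q[ k (fun t => - 'i%C *: (F t + z *: Y t)) ->
  cexp ('i%C * z * q%:C) *: Y q - cexp ('i%C * z * p%:C) *: Y p =
  bochner `]p, q[ (fun t => - 'i%C *: (cexp ('i%C * z * t%:C) *: F t)).
Proof.
move=> pq FL kL kE; have kI p' q' := locL2_bintegrable p' q' kL.
rewrite (exp_by_parts ('i%C * z) pq (kI p q) (smeas_oint c _ kL)); last first.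
  by move=> x y _ xy _; rewrite /Y opprD addrACA subrr add0r oint_sub.
have mpq : measurable (`]p, q[%classic : set R) by exact: measurable_itv.
have YI : bintegrable `]p, q[ Y.
  pose B := fine (\int[leb]_(t in `]p, q[) ((hnorm (k t)) ^+ 2)%:E).
  apply: (@bintegrable_bounded _ _ _ (hnorm (Y p) + (1 * (q - p) + 1^-1 * B))) => //.
  - by rewrite leb_itv// ltry.
  - exact: smeas_oint.
  move=> t; rewrite /= in_itv/= => /andP[pt tq].
  have -> : Y t = Y p + bochner `]p, t[ k.
    rewrite -oint_sub; [|exact: kI|exact: ltW]; rewrite /Y.
    by move: (oint k t) (oint k p) => A' B'; hmodule.
  apply: le_trans (hnormD _ _) _; rewrite lerD2l.
  apply: le_trans (hnorm_bochner_L2 kL ltr01 (lexx p) (ltW pt) (ltW tq)) _.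
  by rewrite lerD2r !mul1r lerD2r ltW.
apply: ae_eq_bochner => //.
- apply: bintegrableD => //; last exact: bintegrable_cexp.
  have := bintegrableZ ('i%C * z) mpq (bintegrable_cexp ('i%C * z) YI).
  by congr bintegrable; apply/funext => t; rewrite scalerA.
- exact: (bintegrableZ _ mpq (bintegrable_cexp ('i%C * z) (locL2_bintegrable p q FL))).
apply: ae_mono kE => t kt tpq; rewrite (kt tpq) -/(Y t).
move: (Y t) (F t) (cexp _) => y f h; hmodule.
Qed.

(** Lebesgue's differentiation theorem for the primitive of [phi], which is constant. *)
Lemma ae_zero_of_integrals (phi : R -> R) :
  (forall p q, leb.-integrable `]p, q[ (EFin \o phi)) -> measurable_fun setT phi ->
  (forall p q, p < q -> \int[leb]_(t in `]p, q[) phi t = 0) ->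
  {ae leb, forall x, phi x = 0}.
Proof.
move=> phii mphi phi0.
have loc : locally_integrable [set: R] phi.
  split => //; first exact: openT.
  move=> K _ cK; have [N [_ NP]] := compact_bounded cK.
  have KN : K `<=` `](- (`|N| + 2)), (`|N| + 2)[.
    move=> t Kt; have N1 : N < `|N| + 1 by rewrite (le_lt_trans (ler_norm _))// ltrDl.
    have := NP _ N1 t Kt; rewrite /= ler_norml in_itv/= => /andP[h1 h2].
    by apply/andP; split; lra.
  have /integrableP[_] := phii (- (`|N| + 2)) (`|N| + 2).
  apply: le_lt_trans; apply: ge0_subset_integral => //.
  - exact: compact_measurable.
  - apply/measurable_EFinP; apply: measurableT_comp => //; exact: measurable_funTS.
have := lebesgue_differentiation loc; apply: ae_mono => x xleb.
have int1 : leb.-integrable `[(x - 1), (x + 1)] (EFin \o phi).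
  apply: (integrableS _ _ _ (phii (x - 2) (x + 2))) => // t.
  by rewrite /= !in_itv/= => /andP[h1 h2]; apply/andP; split; lra.
have x1 : x < x + 1 by rewrite ltrDl.
have [] := @FTC1_lebesgue_pt _ _ _ _ _ x1 int1 _ xleb.
  by rewrite ?bnd_simp ?lte_fin ?ltEereal/= ?bnd_simp ?ltrBlDr ?ltrDl//; lra.
move=> _ <-.
have -> : (fun y : R => \int[leb]_(t in `[(x - 1), y]) phi t) = fun=> 0.
  apply/funext => y; have [xy|yx] := ltP (x - 1) y.
    rewrite -[RHS](phi0 _ _ xy) /Rintegral integral_itv_bndoo//.
    by apply/measurable_EFinP; exact: measurable_funTS.
  have [->|/eqP xy] := eqVneq y (x - 1); first by rewrite set_itv1 Rintegral_set1.
  rewrite (_ : `[(x - 1), y]%classic = set0) ?Rintegral_set0//.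
  apply/seteqP; split=> t //=; rewrite in_itv/= => /andP[h1 h2].
  by apply: xy; apply/eqP; rewrite eq_le yx (le_trans h1 h2).
by rewrite derive1_cst.
Qed.

Lemma ae_dense (D : set R) (P : R -> Prop) : open D -> {ae leb, forall x, D x -> P x} ->
  forall x, D x -> exists2 u : nat -> R, (forall n, D (u n) /\ P (u n)) & u n @[n --> \oo] --> x.
Proof.
move=> oD [N [mN N0 NP]] x Dx.
have pick n : exists y, [/\ `|x - y| < n.+1%:R^-1, D y & P y].
  have /nbhs_ballP[e /= e0 eD] := open_nbhs_nbhs (conj oD Dx).
  pose d := Num.min e n.+1%:R^-1; have d0 : 0 < d by rewrite lt_min e0 invr_gt0 ltr0n.
  have [y [yd Ny]] : exists y, `](x - d), (x + d)[%classic y /\ ~ N y.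
    apply: contrapT => /forallNP h.
    have : (leb `](x - d)%R, (x + d)%R[ <= leb N)%E.
      apply: le_measure; rewrite ?inE// => y yd.
      by have := h y; rewrite not_andP => -[//|]; rewrite notK.
    rewrite N0 leb_itv; last by lra.
    rewrite lee_fin; lra.
  have xy : `|x - y| < d by move: yd; rewrite /= in_itv/= ltr_distlC.
  have Dy : D y by apply: eD; rewrite /ball/=; apply: lt_le_trans xy _; rewrite ge_min lexx.
  exists y; split => //; first by apply: lt_le_trans xy _; rewrite ge_min lexx orbT.
  by apply: contrapT => nP; apply: Ny; apply: NP => /= /(_ Dy).
have [u uP] := choice pick; exists u; first by move=> n; have [] := uP n.
apply/cvgrPdist_lt => r r0; have [M] := ltr_add_invr r0; rewrite add0r => Mr.
exists M => // n /= Mn; have [h _ _] := uP n; apply: lt_trans h (le_lt_trans _ Mr).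
by rewrite lef_pV2 ?posrE// ler_nat ltnS.
Qed.

(** For each vector [e] the scalar case gives [rdot (f x) e = 0] almost everywhere.
    The null set depends on [e], but the countably many values of the simple
    functions that approximate [f] are enough. *)
Lemma ae_zero_of_oint f : locL2 f -> (forall x y, x < y -> bochner `]x, y[ f = 0) ->
  {ae leb, forall x, f x = 0}.
Proof.
move=> fL f0; have [[s [ss sf]] _] := fL.
have fI p q := locL2_bintegrable p q fL.
have ae_e e : {ae leb, forall x, rdot (f x) e = 0}.
  apply: ae_zero_of_integrals.
  - by move=> p q; apply: bintegrable_rdot.
  - exact: smeas_rdot fL.1.
  - by move=> p q pq; rewrite -bochner_rdot// f0// rdot0l.
pose en n i := nth 0 (finmap.enum_fset (fset_set (range (s n)))) i.
have : {ae leb, forall x, forall n i, rdot (f x) (en n i) = 0}.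
  apply/ae_foralln => n; apply/ae_foralln => i; exact: ae_e.
apply: ae_mono => x fx0.
have fs n : rdot (s n x) (f x) = 0.
  have sr : s n x \in finmap.enum_fset (fset_set (range (s n))).
    by rewrite in_fset_set ?inE; [exists x|exact: (ss n).1].
  by rewrite rdotC -(nth_index 0 sr); exact: fx0.
have /hcvgP/hcvg_rdot_cvg-/(_ (f x)) := sf x I.
under eq_fun do rewrite fs.
move=> /(cvg_unique (@norm_hausdorff _ _) (cvg_cst 0)) h.
by apply/hnorm_eq0/eqP; rewrite -sqrf_eq0 hnorm_sqr -h.
Qed.

End LocallyL2.

(** * Uniqueness of the boundary value and of the derivative *)

Section HalfLine.
Context (R : realType) (E : hilbertType R).
Implicit Types (f g v F : R -> E) (z : R[i]) (x y : R) (c : E) (D : set R).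
Local Notation leb := (@lebesgue_measure R).

(** What the argument needs of these two domains is that they are open and contain
    the open segment from [0] to any of their points. *)
Definition half_line D := D = Rneg \/ D = Rpos.

Lemma half_line_open D : half_line D -> open D.
Proof. by move=> [] ->; exact: interval_open. Qed.

Lemma half_line_measurable D : half_line D -> measurable D.
Proof. by move=> [] ->; exact: measurable_itv. Qed.

(** Extending by zero makes interval integrals meaningful on the whole line. *)
Definition patch0 D f : R -> E := fun x => if x \in D then f x else 0.

Lemma patch0E D f x : D x -> patch0 D f x = f x.
Proof. by move=> Dx; rewrite /patch0 mem_set. Qed.

Lemma patch0_L2 D f : half_line D -> L2 D f -> L2 setT (patch0 D f).
Proof. by move=> /half_line_measurable mD fL; exact: smeasT_patch. Qed.

Lemma patch0_locL2 D f : half_line D -> L2 D f -> locL2 (patch0 D f).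
Proof. by move=> hD fL; apply: L2_locL2; exact: patch0_L2. Qed.

Lemma eq_oint D f g x : half_line D -> D x -> (forall t, D t -> f t = g t) ->
  oint f x = oint g x.
Proof.
move=> hD Dx fg.
have e p q : (forall t, p < t < q -> D t) -> bochner `]p, q[ f = bochner `]p, q[ g.
  by move=> sub; apply: eq_bochner => t; rewrite /= in_itv/= => /sub; exact: fg.
have e1 : 0 <= x -> bochner `]0, x[ f = bochner `]0, x[ g.
  move=> x0; apply: e => t /andP[h1 h2]; case: hD Dx => ->; rewrite /= !in_itv/= ?andbT => x0' //.
  by have := lt_le_trans x0' x0; rewrite ltxx.
have e2 : x < 0 -> bochner `]x, 0[ f = bochner `]x, 0[ g.
  move=> x0; apply: e => t /andP[h1 h2]; case: hD Dx => ->; rewrite /= !in_itv/= ?andbT => x0' //.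
  by have := lt_trans x0' x0; rewrite ltxx.
rewrite /oint /oriented_bochner; case: (leP 0 x) => x0; first exact: e1.
by rewrite e2.
Qed.

Lemma oint_patch0 D f x : half_line D -> D x -> oint f x = oint (patch0 D f) x.
Proof. by move=> hD Dx; apply: (eq_oint hD Dx) => t Dt; rewrite patch0E. Qed.

Lemma half_line_near0 D : half_line D ->
  exists2 u : nat -> R, (forall n, D (u n)) & u n @[n --> \oo] --> 0.
Proof.
case=> ->; [exists (fun n => - n.+1%:R^-1)|exists (fun n => n.+1%:R^-1)].
- by move=> n; rewrite /= in_itv/= oppr_lt0 invr_gt0.
- rewrite -oppr0; apply: cvgN; exact: cvg_harmonic.
- by move=> n; rewrite /= in_itv/= andbT invr_gt0.
- exact: cvg_harmonic.
Qed.

(** The difference [g] of the two absolutely continuous representatives vanishes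
    almost everywhere on [D] and is continuous, hence vanishes on [D] and at its
    end [0].  So the boundary values agree, all integrals of [v1 - v2] over
    intervals are zero, and so is [v1 - v2]. *)
Lemma H1_data_uniq D v c1 v1 c2 v2 : half_line D ->
  H1_data D v c1 v1 -> H1_data D v c2 v2 -> c1 = c2 /\ ae_eq_on D v1 v2.
Proof.
move=> hD [vL v1L v1E] [_ v2L v2E]; have oD := half_line_open hD.
have mD := half_line_measurable hD.
have p1 := patch0_locL2 hD v1L; have p2 := patch0_locL2 hD v2L.
pose d := patch0 D (fun x => (-1) *: v2 x + v1 x).
have dL : locL2 d by apply: (patch0_locL2 hD); exact: L2_lin.
have dI p q := locL2_bintegrable p q dL.
have dE x : d x = patch0 D v1 x - patch0 D v2 x.
  by rewrite /d /patch0; case: ifP => _; rewrite ?subr0// scaleN1r addrC.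
pose g x := (c1 - c2) + oint d x.
have ointd x : oint d x = oint (patch0 D v1) x - oint (patch0 D v2) x.
  have B p q := bochnerB (measurable_itv `]p, q[) (locL2_bintegrable p q p1) (locL2_bintegrable p q p2).
  have dB p q : bochner `]p, q[ d = bochner `]p, q[ (patch0 D v1) - bochner `]p, q[ (patch0 D v2).
    by rewrite -B; apply: eq_bochner => t _; rewrite dE.
  exact: ointB.
have g_ae : {ae leb, forall x, D x -> g x = 0}.
  apply: ae_mono2 v1E v2E => x v1x v2x Dx; have e1 := v1x Dx; have e2 := v2x Dx.
  rewrite -/(oint _ _) (oint_patch0 _ hD Dx) in e1; rewrite -/(oint _ _) (oint_patch0 _ hD Dx) in e2.
  by rewrite /g ointd addrACA -opprD -e1 -e2 subrr.
have gcont x : seq_continuous_at g x.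
  by move=> u ux; apply: hcvgD; [exact: hcvg_cst|exact: (oint_continuous dL ux)].
have g0 x : D x -> g x = 0.
  move=> Dx; have [u uP ux] := ae_dense oD g_ae Dx.
  apply: (hcvg_uniq (gcont x u ux)).
  have -> : g \o u = fun=> 0 by apply/funext => n /=; exact: (uP n).2.
  exact: hcvg_cst.
have cc : c1 = c2.
  have [u uD u0] := half_line_near0 hD.
  have g00 : g 0 = 0.
    apply: (hcvg_uniq (gcont 0 u u0)).
    have -> : g \o u = fun=> 0 by apply/funext => n /=; exact: g0.
    exact: hcvg_cst.
  by move: g00; rewrite /g oint0 addr0 => /subr0_eq.
split => //.
have od x : D x -> oint d x = 0 by move=> Dx; have := g0 x Dx; rewrite /g cc subrr add0r.
have : {ae leb, forall x, d x = 0}.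
  apply: ae_zero_of_oint => // x y xy; rewrite -oint_sub// ?(ltW xy)//.
  suff o0 t : oint d t = 0 by rewrite !o0 subrr.
  have [/od//|nDt] := pselect (D t).
  rewrite /oint /oriented_bochner; case: ifPn => [t0|]; last rewrite -ltNge => t0;
    rewrite (@eq_bochner _ _ _ _ (fun=> 0)) ?bochner0 ?oppr0// => s /=; rewrite in_itv/= => /andP[h1 h2];
    rewrite /d /patch0 memNset//; case: hD nDt => -> /=; rewrite !in_itv/= ?andbT => h3 h4.
  - by have := lt_trans h1 h4; rewrite ltxx.
  - by apply: h3; exact: lt_trans h1 h2.
  - by apply: h3.
  - by have := lt_trans h2 h4; rewrite ltxx.
apply: ae_mono => x dx0 Dx; move: dx0; rewrite dE !patch0E//; exact: subr0_eq.
Qed.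

End HalfLine.
(** * Convolution with a two-sided exponential *)

Section Laplace.
Context (R : realType) (E : hilbertType R).
Implicit Types (f g v F : R -> E) (kap x y t : R) (phi : R -> R) (D : set R).
Local Notation leb := (@lebesgue_measure R).

Definition laplace kap t x : R := expR (- (kap * `|t - x|)).

Lemma laplace_sym kap t x : laplace kap t x = laplace kap x t.
Proof. by rewrite /laplace distrC. Qed.

Lemma laplace_ge0 kap t x : 0 <= laplace kap t x. Proof. exact: expR_ge0. Qed.

Lemma continuous_laplace kap x : continuous (fun t => laplace kap t x).
Proof.
move=> t; apply: (@continuous_comp _ _ _ (fun t => - (kap * `|t - x|)) expR); last exact: continuous_expR.
apply: cvgN; apply: cvgMr; apply: cvg_norm; apply: cvgB; [exact: cvg_id|exact: cvg_cst].
Qed.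

Lemma integral_laplace0 kap : 0 < kap ->
  (\int[leb]_t (laplace kap t 0)%:E = (2 / kap)%:E)%E.
Proof.
move=> kap0; rewrite ge0_symfun_integralT; last 3 first.
- by move=> t; exact: laplace_ge0.
- exact: continuous_laplace.
- by move=> t; rewrite /laplace /= !subr0 normrN.
rewrite -set_itvcy.
have cE (t : R) : is_derive t 1 (fun t => - kap^-1 * expR (- kap * t)) (expR (- (kap * t))).
  have d1 : is_derive t 1 (fun s : R => - kap * s) (- kap).
    by apply: is_derive_eq; rewrite /GRing.scale/= mulr1.
  have de := is_derive1_comp (is_derive_expR (- kap * t)) d1.
  have dk := is_deriveZ (- kap^-1) de.
  apply: is_derive_eq dk _; rewrite /GRing.scale/= -mulNr.
  by move: (expR _) => r; field; rewrite gt_eqF.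
have cont : continuous (fun t : R => - kap^-1 * expR (- kap * t)).
  move=> t; apply: differentiable_continuous; apply/derivable1_diffP; exact: (@ex_derive _ _ _ _ _ _ _ (cE t)).
rewrite (@ge0_continuous_FTC2y _ _ (fun t => - kap^-1 * expR (- kap * t)) 0 0).
- by rewrite mulr0 expR0 mulr1 EFinN oppeK add0e -EFinM.
- by move=> t _; exact: laplace_ge0.
- by apply: continuous_subspaceT; exact: continuous_laplace.
- rewrite -(mulr0 (- kap^-1)); apply: cvgMr.
  rewrite (_ : (fun x => expR (- kap * x)) = (fun z => expR (- z)) \o (fun z => kap * z)); last first.
    by apply: eq_fun => t; rewrite mulNr.
  apply: (@cvg_comp _ _ _ _ _ _ (pinfty_nbhs R)); last exact: cvgr_expR.
  exact: gt0_cvgMry.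
- by move=> t _; exact: (@ex_derive _ _ _ _ _ _ _ (cE t)).
- by apply: cvg_at_right_filter; exact: cont.
- move=> t; rewrite in_itv/= andbT => t0; rewrite derive1E (@derive_val _ _ _ _ _ _ _ (cE t)).
  by rewrite /laplace subr0 gtr0_norm.
Qed.

Lemma integral_laplace kap x : 0 < kap ->
  (\int[leb]_t (laplace kap t x)%:E = (2 / kap)%:E)%E.
Proof.
move=> kap0; rewrite -(integral_laplace0 kap0).
have D1 : derive1 (fun t : R => t - x) = cst 1.
  by apply/funext => t; rewrite derive1E; have d : is_derive t 1 (fun t : R => t - x) 1;
    [apply: is_derive_eq; rewrite subr0|exact: (@derive_val _ _ _ _ _ _ _ d)].
rewrite (@increasing_ge0_integration_by_substitutionT _ (fun t => t - x) (fun t => laplace kap t 0)).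
- by apply: eq_integral => t _; rewrite D1 /laplace !fctE/= subr0 mulr1.
- by move=> s t st; rewrite ltrD2r.
- by rewrite D1 => t; exact: cvg_cst.
- by rewrite D1; exact: is_cvg_cst.
- by rewrite D1; exact: is_cvg_cst.
- by move=> t; apply: derivableB.
- apply/cvgrNyPle => M; exists (M + x); split; first exact: num_real.
  by move=> t tM; rewrite lerBlDr ltW.
- apply/cvgryPge => M; exists (M + x); split; first exact: num_real.
  by move=> t tM; rewrite lerBrDr ltW.
- exact: continuous_laplace.
- by move=> t; exact: laplace_ge0.
Qed.

Lemma measurable_laplace kap : measurable_fun setT (fun p : R * R => laplace kap p.2 p.1).
Proof.
apply: measurableT_comp => //; apply: measurableT_comp => //.
apply: measurable_funM; first exact: measurable_cst.
apply: measurableT_comp => //; apply: measurable_funB; [exact: measurable_snd|exact: measurable_fst].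
Qed.

Lemma laplace_integral_fin kap phi x : 0 < kap -> measurable_fun setT phi ->
  (forall t, 0 <= phi t) ->
  (\int[leb]_t ((phi t) ^+ 2)%:E < +oo)%E ->
  (\int[leb]_t (laplace kap t x * phi t)%:E < +oo)%E.
Proof.
move=> kap0 mphi phi0 phi2.
have ml : measurable_fun setT (fun t => (laplace kap t x)%:E).
  by apply/measurable_EFinP; apply: continuous_measurable_fun; exact: continuous_laplace.
have mp : measurable_fun setT (fun t => ((phi t) ^+ 2)%:E).
  by apply/measurable_EFinP; exact: measurable_funX.
apply: (@le_lt_trans _ _ (\int[leb]_t ((laplace kap t x)%:E + ((phi t) ^+ 2)%:E))%E).
  apply: ge0_le_integral => //.
  - by move=> t _; rewrite lee_fin mulr_ge0// laplace_ge0.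
  - by apply/measurable_EFinP; apply: measurable_funM => //; apply/measurable_EFinP.
  - exact: emeasurable_funD.
  move=> t _; rewrite -EFinD lee_fin.
  have l1 : laplace kap t x <= 1.
    by rewrite /laplace -expR0 ler_expR oppr_le0 mulr_ge0// ltW.
  have := sqr_ge0 (laplace kap t x - phi t); rewrite sqrrB => h.
  have := laplace_ge0 kap t x; have := phi0 t; nra.
rewrite ge0_integralD//.
- by rewrite integral_laplace// lte_add_pinfty// ltry.
- by move=> t _; rewrite lee_fin laplace_ge0.
- by move=> t _; rewrite lee_fin sqr_ge0.
Qed.

(** With these weights the first term becomes [n / 2] after integration against a
    kernel of integral [C]. *)
Lemma weighted_AMGM (n C r : R) : 0 < n -> 0 < C ->
  r <= n / (2 * C) + C / (2 * n) * r ^+ 2.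
Proof.
move=> n0 C0.
have -> : n / (2 * C) + C / (2 * n) * r ^+ 2 = r + (n - C * r) ^+ 2 / (2 * C * n).
  by field; rewrite !gt_eqF.
rewrite lerDl; apply: divr_ge0; first exact: sqr_ge0.
by apply: mulr_ge0; [apply: mulr_ge0|]; rewrite ?ltW.
Qed.

Lemma ge0_integral_lin (a b : R) (u w : R -> \bar R) : 0 <= a -> 0 <= b ->
  measurable_fun setT u -> measurable_fun setT w ->
  (forall t, (0 <= u t)%E) -> (forall t, (0 <= w t)%E) ->
  (\int[leb]_t (a%:E * u t + b%:E * w t) =
   a%:E * \int[leb]_t u t + b%:E * \int[leb]_t w t)%E.
Proof.
move=> a0 b0 mu mw u0 w0; rewrite ge0_integralD//.
- by rewrite !ge0_integralZl.
- by move=> t _; rewrite mule_ge0.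
- exact: measurable_funeM.
- by move=> t _; rewrite mule_ge0.
- exact: measurable_funeM.
Qed.

(** Young's inequality for the convolution with the kernel [e^(- kap |t|)], whose
    integral is [C = 2 / kap].  The arithmetic-geometric mean inequality gives the
    pointwise bound [|v x|^2 <= C Q x], where [Q] is the convolution of the kernel
    with [phi^2], and Tonelli's theorem bounds the integral of [Q]. *)
Lemma laplace_convolution_L2 kap D v phi : 0 < kap -> measurable D ->
  strongly_measurable D v -> measurable_fun setT phi -> (forall t, 0 <= phi t) ->
  (\int[leb]_t ((phi t) ^+ 2)%:E < +oo)%E ->
  (forall x, D x -> ((hnorm (v x))%:E <= \int[leb]_t (laplace kap t x * phi t)%:E)%E) ->
  L2 D v.
Proof.
move=> kap0 mD mv mphi phi0 phi2 vle; split => //.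
pose C := 2 / kap; have C0 : 0 < C by rewrite divr_gt0.
pose h (p : R * R) := (laplace kap p.2 p.1 * (phi p.2) ^+ 2)%:E.
have h0 p : (0 <= h p)%E by rewrite lee_fin mulr_ge0 ?sqr_ge0 ?laplace_ge0.
have mh : measurable_fun setT h.
  apply/measurable_EFinP; apply: measurable_funM; first exact: measurable_laplace.
  apply: measurable_funX; exact: (measurableT_comp mphi measurable_snd).
have ml x : measurable_fun setT (fun t => laplace kap t x).
  by apply: continuous_measurable_fun; exact: continuous_laplace.
have mp : measurable_fun setT (fun t => ((phi t) ^+ 2)).
  exact: measurable_funX.
have mlE x : measurable_fun setT (fun t => (laplace kap t x)%:E) by apply/measurable_EFinP.
have mpE : measurable_fun setT (fun t => ((phi t) ^+ 2)%:E) by apply/measurable_EFinP.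
have mlp x : measurable_fun setT (fun t => (laplace kap t x * phi t)%:E).
  by apply/measurable_EFinP; exact: (measurable_funM (ml x) mphi).
have mhx x : measurable_fun setT (fun t => h (x, t)).
  by apply/measurable_EFinP; exact: (measurable_funM (ml x) mp).
have mZ a (u : R -> \bar R) : measurable_fun setT u -> measurable_fun setT (fun t => (a * u t)%E).
  by move=> mu; exact: measurable_funeM.
pose Q x := (\int[leb]_t h (x, t))%E.
have mQ : measurable_fun setT Q.
  exact: (measurable_fun_fubini_tonelli_F (m2 := leb) h mh h0).
have Q0 x : (0 <= Q x)%E by apply: integral_ge0.
have pt x : D x -> (((hnorm (v x)) ^+ 2)%:E <= C%:E * Q x)%E.
  move=> Dx; have := vle x Dx; set n := hnorm (v x) => nle.
  have [->|n0] := eqVneq n 0; first by rewrite expr0n/= mule_ge0// lee_fin ltW.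
  have {}n0 : 0 < n by rewrite lt_neqAle eq_sym n0 hnorm_ge0.
  have s0 : 0 < n / (2 * C) by rewrite divr_gt0// mulr_gt0.
  have s1 : 0 < C / (2 * n) by rewrite divr_gt0// mulr_gt0.
  have bound : (n%:E <= (n / (2 * C) * C)%:E + (C / (2 * n))%:E * Q x)%E.
    apply: le_trans nle _.
    apply: (@le_trans _ _ (\int[leb]_t ((n / (2 * C))%:E * (laplace kap t x)%:E + (C / (2 * n))%:E * h (x, t)))%E).
      apply: ge0_le_integral => //.
      - by move=> t _; rewrite lee_fin mulr_ge0// laplace_ge0.
      - exact: mlp.
      - exact: (emeasurable_funD (mZ _ _ (mlE x)) (mZ _ _ (mhx x))).
      move=> t _; rewrite -!EFinM -EFinD lee_fin /=.
      rewrite (_ : _ + _ = laplace kap t x * (n / (2 * C) + C / (2 * n) * phi t ^+ 2)); last by ring.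
      apply: ler_wpM2l; first exact: laplace_ge0.
      exact: weighted_AMGM.
    have -> : (\int[leb]_t ((n / (2 * C))%:E * (laplace kap t x)%:E + (C / (2 * n))%:E * h (x, t)) =
      (n / (2 * C))%:E * \int[leb]_t (laplace kap t x)%:E + (C / (2 * n))%:E * Q x)%E.
      by apply: ge0_integral_lin => //; rewrite ?ltW// => t; rewrite lee_fin laplace_ge0.
    by rewrite integral_laplace// -EFinM.
  move: bound; have := Q0 x; case: (Q x) => [q| |//] q0.
    rewrite -!EFinM -EFinD !lee_fin.
    have -> : n / (2 * C) * C = n / 2 by field; rewrite gt_eqF.
    rewrite -lerBlDl => hn.
    have : n * (n - n / 2) <= n * (C / (2 * n) * q) by rewrite ler_wpM2l// ltW.
    have -> : n * (C / (2 * n) * q) = C * q / 2 by field; rewrite gt_eqF.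
    by lra.
  by move=> _; rewrite gt0_muley ?lte_fin// leey.
apply: (@le_lt_trans _ _ (\int[leb]_(x in D) (C%:E * Q x))%E).
  apply: ge0_le_integral => //.
  - by move=> x _; rewrite lee_fin sqr_ge0.
  - exact: measurable_hnorm2.
  - by apply: measurable_funeM; exact: measurable_funTS.
apply: (@le_lt_trans _ _ (\int[leb]_x (C%:E * Q x))%E).
  apply: ge0_subset_integral => //; first exact: measurable_funeM.
  by move=> x _; rewrite mule_ge0// lee_fin ltW.
rewrite ge0_integralZl//; last by rewrite lee_fin ltW.
rewrite lte_mul_pinfty//; first by rewrite lee_fin ltW.
rewrite /Q; rewrite (fubini_tonelli (m1 := leb) (m2 := leb) h mh h0).
have -> : (\int[leb]_y \int[leb]_x h (x, y) = \int[leb]_y (C%:E * ((phi y) ^+ 2)%:E))%E.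
  apply: eq_integral => y _; rewrite /h /=.
  under eq_integral do rewrite EFinM muleC laplace_sym.
  rewrite ge0_integralZl//.
  - by rewrite integral_laplace// muleC.
  - exact: mlE.
  - by move=> t _; rewrite lee_fin laplace_ge0.
  - by rewrite lee_fin sqr_ge0.
rewrite ge0_integralZl//.
- by rewrite lte_mul_pinfty// lee_fin ltW.
- by move=> t _; rewrite lee_fin sqr_ge0.
- by rewrite lee_fin ltW.
Qed.

Lemma laplace_bochner kap D f phi x : measurable D -> bintegrable D f ->
  measurable_fun setT phi -> (forall t, 0 <= phi t) ->
  (forall t, D t -> hnorm (f t) <= laplace kap t x * phi t) ->
  ((hnorm (bochner D f))%:E <= \int[leb]_t (laplace kap t x * phi t)%:E)%E.
Proof.
move=> mD fD mphi phi0 fle.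
have ml : measurable_fun setT (fun t => (laplace kap t x * phi t)%:E).
  apply/measurable_EFinP; apply: measurable_funM => //.
  by apply: continuous_measurable_fun; exact: continuous_laplace.
apply: (@le_trans _ _ (\int[leb]_(t in D) (hnorm (f t))%:E)%E).
  rewrite -[leRHS]fineK; first by rewrite lee_fin; exact: hnorm_bochner.
  rewrite ge0_fin_numE ?fD.2// integral_ge0// => t _; rewrite lee_fin; exact: hnorm_ge0.
apply: (@le_trans _ _ (\int[leb]_(t in D) (laplace kap t x * phi t)%:E)%E).
  apply: ge0_le_integral => //.
  - by move=> t _; rewrite lee_fin hnorm_ge0.
  - by apply/measurable_EFinP; exact: smeas_hnorm fD.1.
  - exact: measurable_funTS.
by apply: ge0_subset_integral => // t _; rewrite lee_fin mulr_ge0// laplace_ge0.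
Qed.

End Laplace.
(** * Square integrable solutions on a half-line *)

Section HalfLineEquation.
Context (R : realType) (E : hilbertType R).
Implicit Types (f g v F P : R -> E) (z k : R[i]) (x y t : R) (c : E) (D T : set R).
Local Notation leb := (@lebesgue_measure R).

(** Whether the homogeneous solution [e^(-izx)], of absolute value [e^(Im z x)],
    decays or grows along [D]. *)
Definition decays D z := (D = Rneg /\ 0 < complex.Im z) \/ (D = Rpos /\ complex.Im z < 0).
Definition grows D z := (D = Rneg /\ complex.Im z < 0) \/ (D = Rpos /\ 0 < complex.Im z).

Lemma decays_half_line D z : decays D z -> half_line D.
Proof. by move=> [[-> _]|[-> _]]; [left|right]. Qed.

Lemma grows_half_line D z : grows D z -> half_line D.
Proof. by move=> [[-> _]|[-> _]]; [left|right]. Qed.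

Lemma decays_Im_neq0 D z : decays D z -> complex.Im z != 0.
Proof. by move=> [[_ z0]|[_ z0]]; [rewrite gt_eqF|rewrite lt_eqF]. Qed.

Lemma cabs_cexp_i z x : cabs (cexp ('i%C * z * x%:C)) = expR (- (complex.Im z * x)).
Proof. by rewrite cabs_cexp; congr expR; case: z => a b /=; ring. Qed.

Lemma cabs_cexp_Ni z x : cabs (cexp (- ('i%C * z * x%:C))) = expR (complex.Im z * x).
Proof. by rewrite cabs_cexp; congr expR; case: z => a b /=; ring. Qed.

(** The hypothesis says that [t] lies on the side of [x] on which [e^(iz(t-x))] decays. *)
Lemma cabs_kernel z x t : complex.Im z * (x - t) <= 0 ->
  cabs (cexp (- ('i%C * z * x%:C))) * cabs (cexp ('i%C * z * t%:C)) =
  laplace `|complex.Im z| t x.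
Proof.
move=> h; rewrite cabs_cexp_i cabs_cexp_Ni -expRD /laplace; congr expR.
by rewrite distrC -normrM ler0_norm// opprK mulrBr addrC.
Qed.

Lemma measurable_hnormT P : L2 setT P -> measurable_fun setT (fun t => hnorm (P t)).
Proof. by move=> [mP _]; exact: smeas_hnorm. Qed.

Lemma exponential_convolution_le z P x T : L2 setT P -> measurable T ->
  bintegrable T (fun t => cexp ('i%C * z * t%:C) *: P t) ->
  (forall t, T t -> complex.Im z * (x - t) <= 0) ->
  ((hnorm (cexp (- ('i%C * z * x%:C)) *:
      bochner T (fun t => cexp ('i%C * z * t%:C) *: P t)))%:E <=
   \int[leb]_t (laplace `|complex.Im z| t x * hnorm (P t))%:E)%E.
Proof.
move=> PL mT iT zT; rewrite -(bochnerZ _ mT iT).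
apply: laplace_bochner => //.
- exact: bintegrableZ.
- exact: measurable_hnormT.
- by move=> t; exact: hnorm_ge0.
- by move=> t Tt; rewrite !hnormZ mulrA -!/(cabs _) cabs_kernel// zT.
Qed.

Lemma exponential_bintegrable z P T : L2 setT P -> measurable T -> complex.Im z != 0 ->
  (forall t, T t -> complex.Im z * (0 - t) <= 0) ->
  bintegrable T (fun t => cexp ('i%C * z * t%:C) *: P t).
Proof.
move=> PL mT z0 zT; have [mP Pfin] := PL.
have mf : strongly_measurable T (fun t => cexp ('i%C * z * t%:C) *: P t).
  apply: smeas_scale; first exact: seq_continuous_cexp.
  exact: smeas_sub mP.
split => //; have k0 : 0 < `|complex.Im z| by rewrite normr_gt0.
have mh := measurable_hnormT PL.
have := laplace_integral_fin 0 k0 mh (fun t => hnorm_ge0 (P t)) Pfin.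
have ml : measurable_fun setT (fun t => (laplace `|complex.Im z| t 0 * hnorm (P t))%:E).
  apply/measurable_EFinP; apply: measurable_funM => //.
  by apply: continuous_measurable_fun; exact: continuous_laplace.
apply: le_lt_trans.
apply: (@le_trans _ _ (\int[leb]_(t in T) (laplace `|complex.Im z| t 0 * hnorm (P t))%:E)%E).
  apply: ge0_le_integral => //.
  - by move=> t _; rewrite lee_fin hnorm_ge0.
  - by apply/measurable_EFinP; exact: smeas_hnorm.
  - exact: measurable_funTS.
  - move=> t Tt; rewrite lee_fin hnormZ -/(cabs _) -(cabs_kernel (zT t Tt)).
    by rewrite mulr0 oppr0 cexp0 /cabs normr1 /= mul1r.
by apply: ge0_subset_integral => // t _; rewrite lee_fin mulr_ge0// ?laplace_ge0 ?hnorm_ge0.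
Qed.

Lemma L2_eq D f g : (forall x, D x -> f x = g x) -> L2 D f -> L2 D g.
Proof.
move=> fg [mf fi]; split; first exact: smeas_eq mf.
by apply: le_lt_trans fi; rewrite le_eqVlt; apply/orP; left; apply/eqP/eq_integral => x;
  rewrite inE => Dx; rewrite fg.
Qed.

Lemma decays_exponential_L2 D z c : decays D z ->
  L2 D (fun x => cexp (- ('i%C * z * x%:C)) *: c).
Proof.
move=> dz; have mD := half_line_measurable (decays_half_line dz).
have mf : strongly_measurable D (fun x => cexp (- ('i%C * z * x%:C)) *: c).
  apply: (@smeas_eq _ _ _ (fun x => cexp (- ('i%C * z) * x%:C) *: c)).
    by move=> x _; rewrite mulNr.
  apply: smeas_scale; first exact: seq_continuous_cexp.
  by apply: smeas_continuous => x _ u _; exact: hcvg_cst.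
split => //; pose kap := `|complex.Im z|.
have kap0 : 0 < kap by rewrite normr_gt0 (decays_Im_neq0 dz).
have ml : measurable_fun setT (fun t => (laplace kap t 0)%:E).
  by apply/measurable_EFinP; apply: continuous_measurable_fun; exact: continuous_laplace.
have c0 : (0%:E <= ((hnorm c) ^+ 2)%:E)%E by rewrite lee_fin sqr_ge0.
apply: (@le_lt_trans _ _ (\int[leb]_x (((hnorm c) ^+ 2)%:E * (laplace kap x 0)%:E))%E).
  apply: (@le_trans _ _ (\int[leb]_(x in D) (((hnorm c) ^+ 2)%:E * (laplace kap x 0)%:E))%E).
    apply: ge0_le_integral => //.
    - by move=> x _; rewrite lee_fin sqr_ge0.
    - exact: measurable_hnorm2.
    - by apply: measurable_funeM; exact: measurable_funTS.
    move=> x Dx; rewrite -EFinM lee_fin hnormZ -/(cabs _) cabs_cexp_Ni exprMn mulrC.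
    apply: ler_wpM2l; first exact: sqr_ge0.
    have -> : complex.Im z * x = - (kap * `|x - 0|).
      rewrite subr0 /kap -normrM ler0_norm ?opprK//.
      case: dz Dx => -[-> z0]; rewrite /= in_itv/= ?andbT => x0.
        by rewrite pmulr_rle0// ltW.
      by rewrite nmulr_rle0// ltW.
    rewrite -/(laplace kap x 0) expr2 -[leRHS]mulr1 ler_wpM2l ?laplace_ge0//.
    by rewrite /laplace -expR0 ler_expR oppr_le0 mulr_ge0// ltW.
  apply: ge0_subset_integral => //; first exact: measurable_funeM.
  by move=> x _; rewrite mule_ge0// lee_fin laplace_ge0.
rewrite ge0_integralZl//; first by rewrite integral_laplace// -EFinM ltry.
by move=> x _; rewrite lee_fin laplace_ge0.
Qed.

Lemma duhamel_measurable D z P c : locL2 P -> strongly_measurable D (duhamel z P c).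
Proof.
move=> PL; have PL' := locL2_cexp ('i%C * z) PL.
apply: (@smeas_eq _ _ _ (fun x => cexp (- ('i%C * z) * x%:C) *:
   (c + oint (fun t => - 'i%C *: (cexp ('i%C * z * t%:C) *: P t)) x))).
  move=> x _; rewrite ointZ; first by rewrite /duhamel mulNr scaleNr.
  by move=> p q; exact: locL2_bintegrable.
by apply: smeas_scale; [exact: seq_continuous_cexp|exact: smeas_oint (locL2Z _ PL')].
Qed.

Lemma decays_duhamel_L2 D z P c : decays D z -> L2 setT P -> L2 D (duhamel z P c).
Proof.
move=> dz PL; have mD := half_line_measurable (decays_half_line dz).
have PL' := L2_locL2 PL.
pose h x := cexp (- ('i%C * z * x%:C)) *: c.
pose q x := h x - duhamel z P c x.
have mh := decays_exponential_L2 c dz.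
have qE x : q x = 'i%C *: (cexp (- ('i%C * z * x%:C)) *: oint (fun t => cexp ('i%C * z * t%:C) *: P t) x).
  rewrite /q /h /duhamel; move: (cexp _) (oint _ _) => a b; hmodule.
have qL : L2 D q.
  apply: (@laplace_convolution_L2 _ _ `|complex.Im z| D q (fun t => hnorm (P t))) => //.
  - by rewrite normr_gt0 (decays_Im_neq0 dz).
  - apply: (@smeas_eq _ _ _ (fun x => (-1) *: duhamel z P c x + h x)).
      by move=> x _; rewrite scaleN1r addrC.
    by apply: smeas_lin; [exact: duhamel_measurable|exact: mh.1].
  - exact: measurable_hnormT.
  - by move=> t; exact: hnorm_ge0.
  - exact: PL.2.
  move=> x Dx; rewrite qE hnormZ norm_i mul1r.
  have bI p r := locL2_bintegrable p r (locL2_cexp ('i%C * z) PL').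
  rewrite /oint /oriented_bochner; case: ifPn => x0.
    apply: exponential_convolution_le => // t; rewrite /= in_itv/= => /andP[t0 tx].
    case: dz Dx => -[-> z0]; rewrite /= in_itv/= ?andbT => x0'.
      by have := lt_le_trans x0' x0; rewrite ltxx.
    by rewrite nmulr_rle0// subr_ge0 ltW.
  rewrite scalerN hnormN.
  apply: exponential_convolution_le => // t; rewrite /= in_itv/= => /andP[t0 tx].
  case: dz Dx => -[-> z0]; rewrite /= in_itv/= ?andbT => x0'.
    by rewrite pmulr_rle0// subr_le0 ltW.
  by rewrite (ltW x0') in x0.
apply: (@L2_eq _ (fun x => (-1) *: q x + h x)); last exact: L2_lin.
by move=> x _; rewrite scaleN1r /q opprB subrK.
Qed.

(** Solutions that are integrals of the data over the part of the line beyond [x]. *)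
Lemma tail_L2 D z P v k (T : R -> set R) : half_line D -> complex.Im z != 0 ->
  L2 setT P -> strongly_measurable D v -> cabs k = 1 ->
  (forall x, D x -> [/\ measurable (T x),
     bintegrable (T x) (fun t => cexp ('i%C * z * t%:C) *: P t),
     forall t, T x t -> complex.Im z * (x - t) <= 0 &
     v x = k *: (cexp (- ('i%C * z * x%:C)) *:
             bochner (T x) (fun t => cexp ('i%C * z * t%:C) *: P t))]) ->
  L2 D v.
Proof.
move=> /half_line_measurable mD z0 PL mv k1 vT.
apply: (@laplace_convolution_L2 _ _ `|complex.Im z| D v (fun t => hnorm (P t))) => //.
- by rewrite normr_gt0.
- exact: measurable_hnormT.
- by move=> t; exact: hnorm_ge0.
- exact: PL.2.
move=> x /vT[mT iT zT ->]; rewrite hnormZ -/(cabs k) k1 mul1r.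
exact: exponential_convolution_le.
Qed.

(** On the growing side, choosing the integral of [G] over the whole half-line as
    boundary value cancels the growing exponential and leaves the integral of [G]
    beyond [x]. *)

Section GrowsRight.
Variables (z : R[i]) (P : R -> E).
Hypotheses (z0 : 0 < complex.Im z) (PL : L2 setT P).
Let G t := cexp ('i%C * z * t%:C) *: P t.

Lemma growsR_bintegrable : bintegrable Rpos G.
Proof.
apply: exponential_bintegrable => //; first by rewrite gt_eqF.
by move=> t; rewrite /= in_itv/= andbT sub0r => t0; rewrite pmulr_rle0// oppr_le0 ltW.
Qed.

Lemma growsR_duhamel x : 0 < x -> duhamel z P ('i%C *: bochner Rpos G) x =
  'i%C *: (cexp (- ('i%C * z * x%:C)) *: bochner `]x, +oo[ G).
Proof.
move=> x0; have -> : bochner Rpos G = bochner `]0, x[ G + bochner `]x, +oo[ G.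
  by apply: bochner_itv_cat; rewrite ?bnd_simp//; exact: growsR_bintegrable.
rewrite /duhamel /oint /oriented_bochner (ltW x0).
rewrite -/G; move: (cexp _) (bochner `]0, x[ G) (bochner `]x, +oo[ G) => a b d; hmodule.
Qed.

Lemma growsR_L2 : L2 Rpos (duhamel z P ('i%C *: bochner Rpos G)).
Proof.
apply: (@tail_L2 Rpos z P _ 'i%C (fun x => `]x, +oo[%classic)) => //.
- by right.
- by rewrite gt_eqF.
- by apply: duhamel_measurable; exact: L2_locL2.
- exact: cabs_i.
move=> x; rewrite /= in_itv/= andbT => x0; split.
- exact: measurable_itv.
- apply: bintegrable_subset growsR_bintegrable; [exact: measurable_itv|exact: measurable_itv|].
  by move=> t; rewrite /= !in_itv/= !andbT; exact: lt_trans.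
- by move=> t; rewrite /= in_itv/= andbT => xt; rewrite pmulr_rle0// subr_le0 ltW.
- exact: growsR_duhamel.
Qed.

End GrowsRight.

Section GrowsLeft.
Variables (z : R[i]) (P : R -> E).
Hypotheses (z0 : complex.Im z < 0) (PL : L2 setT P).
Let G t := cexp ('i%C * z * t%:C) *: P t.

Lemma growsL_bintegrable : bintegrable Rneg G.
Proof.
apply: exponential_bintegrable => //; first by rewrite lt_eqF.
by move=> t; rewrite /= in_itv/= sub0r => t0; rewrite nmulr_rle0// oppr_ge0 ltW.
Qed.

Lemma growsL_duhamel x : x < 0 -> duhamel z P (- 'i%C *: bochner Rneg G) x =
  - 'i%C *: (cexp (- ('i%C * z * x%:C)) *: bochner `]-oo, x[ G).
Proof.
move=> x0; have -> : bochner Rneg G = bochner `]-oo, x[ G + bochner `]x, 0[ G.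
  by apply: bochner_itv_cat; rewrite ?bnd_simp//; exact: growsL_bintegrable.
rewrite /duhamel /oint /oriented_bochner leNgt x0 /=.
rewrite -/G; move: (cexp _) (bochner `]x, 0[ G) (bochner `]-oo, x[ G) => a b d; hmodule.
Qed.

Lemma growsL_L2 : L2 Rneg (duhamel z P (- 'i%C *: bochner Rneg G)).
Proof.
apply: (@tail_L2 Rneg z P _ (- 'i%C) (fun x => `]-oo, x[%classic)) => //.
- by left.
- by rewrite lt_eqF.
- by apply: duhamel_measurable; exact: L2_locL2.
- by rewrite cabsN cabs_i.
move=> x; rewrite /= in_itv/= => x0; split.
- exact: measurable_itv.
- apply: bintegrable_subset growsL_bintegrable; [exact: measurable_itv|exact: measurable_itv|].
  by move=> t; rewrite /= !in_itv/= => tx; exact: lt_trans x0.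
- by move=> t; rewrite /= in_itv/= => xt; rewrite nmulr_rle0// subr_ge0 ltW.
- exact: growsL_duhamel.
Qed.

End GrowsLeft.

(** The derivative is read off from the equation [i v' = F + z v]. *)
Lemma H1_data_duhamel D z F v c : half_line D -> L2 D F ->
  L2 D (duhamel z (patch0 D F) c) ->
  (forall x, D x -> v x = duhamel z (patch0 D F) c x) ->
  H1_data D v c (fun t => - 'i%C *: (F t + z *: v t)).
Proof.
move=> hD FL dL vE; have mD := half_line_measurable hD.
have vL : L2 D v by apply: L2_eq dL => x Dx; rewrite vE.
split => //.
  have FL' : L2 D (fun t => - 'i%C *: F t + 0).
    apply: L2_lin => //; split.
      by apply: smeas_continuous => x _ u _; exact: hcvg_cst.
    by under eq_integral do rewrite hnorm0 expr0n; rewrite integral0.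
  have := L2_lin (- 'i%C * z) mD vL FL'.
  by congr L2; apply/funext => t; rewrite addr0; move: (F t) (v t) => a b; hmodule.
apply: aeW => x Dx; rewrite vE// duhamel_solves; last exact: patch0_locL2.
have e : oint (fun t => - 'i%C *: (patch0 D F t + z *: duhamel z (patch0 D F) c t)) x =
    oint (fun t => - 'i%C *: (F t + z *: v t)) x.
  by apply: (eq_oint hD Dx) => t Dt; rewrite patch0E// vE.
by rewrite e.
Qed.

Lemma H1_data_trace D v c v' : half_line D -> H1_data D v c v' ->
  trace0 D v = c /\ ae_eq_on D (weak_deriv D v) v'.
Proof.
move=> hD vD; split.
  apply: xget_unique; first by exists v'.
  by move=> c' [v1 vD1]; exact: (H1_data_uniq hD vD1 vD).1.
have [c' vD'] : [set w | exists c, H1_data D v c w] (weak_deriv D v).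
  by apply: (@xgetPex _ (fun=> 0)); exists v', c.
exact: (H1_data_uniq hD vD' vD).2.
Qed.

Lemma H1_trace_deriv D v : half_line D -> H1 D v ->
  H1_data D v (trace0 D v) (weak_deriv D v).
Proof.
move=> hD [c [v' vD]].
have [c' vD'] : [set w | exists c, H1_data D v c w] (weak_deriv D v).
  by apply: (@xgetPex _ (fun=> 0)); exists v', c.
by rewrite (H1_data_trace hD vD').1.
Qed.

(** Every [H^1] solution is given by Duhamel's formula with its own boundary value. *)
Lemma H1_ode_duhamel D z F v : half_line D -> L2 D F -> H1 D v ->
  ae_eq_on D (fun x => 'i%C *: weak_deriv D v x - z *: v x) F ->
  ae_eq_on D v (duhamel z (patch0 D F) (trace0 D v)).
Proof.
move=> hD FL /(H1_trace_deriv hD)[vL dL vE] ode.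
set c := trace0 D v in vE *; set w := weak_deriv D v in dL vE ode.
have PL := patch0_locL2 hD FL; have kL := patch0_locL2 hD dL.
pose Y x := c + oint (patch0 D w) x.
have vY : ae_eq_on D v Y.
  apply: ae_mono vE => x vx Dx; have e := oint_patch0 w hD Dx.
  by rewrite (vx Dx) /Y -e.
have wE : ae_eq_on D (patch0 D w) (fun t => - 'i%C *: (patch0 D F t + z *: Y t)).
  apply: ae_mono2 vY ode => x vx odex Dx; rewrite !patch0E// -(vx Dx) -(odex Dx).
  by rewrite subrK scalerA mulNr -expr2 sqr_i opprK scale1r.
have GI p q := locL2_bintegrable p q (locL2_cexp ('i%C * z) PL).
have Y0 : Y 0 = c by rewrite /Y oint0 addr0.
have YE x : D x -> Y x = duhamel z (patch0 D F) c x.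
  move=> Dx; rewrite /duhamel.
  have cK : cexp (- ('i%C * z * x%:C)) * cexp ('i%C * z * x%:C) = 1 by exact: cexpNK.
  have c0 : cexp ('i%C * z * (0 : R)%:C) = 1 by rewrite mulr0 cexp0.
  suff <- : cexp ('i%C * z * x%:C) *: Y x = c - 'i%C *: oint (fun t => cexp ('i%C * z * t%:C) *: patch0 D F t) x.
    by rewrite scalerA cK scale1r.
  have itv p q : (forall t, p < t < q -> D t) -> ae_eq_on `]p, q[ (patch0 D w) (fun t => - 'i%C *: (patch0 D F t + z *: Y t)).
    by move=> sub; apply: ae_mono wE => t wt; rewrite /= in_itv/= => /sub; exact: wt.
  have inc p q : p <= q -> (forall t, p < t < q -> D t) ->
      cexp ('i%C * z * q%:C) *: Y q - cexp ('i%C * z * p%:C) *: Y p =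
      - ('i%C *: bochner `]p, q[ (fun t => cexp ('i%C * z * t%:C) *: patch0 D F t)).
    move=> pq sub; rewrite -[RHS]scaleNr -(bochnerZ _ (measurable_itv _) (GI p q)).
    exact: (duhamel_unique pq PL kL (itv p q sub)).
  have pos : 0 <= x -> cexp ('i%C * z * x%:C) *: Y x - c =
      - ('i%C *: bochner `]0, x[ (fun t => cexp ('i%C * z * t%:C) *: patch0 D F t)).
    move=> x0; rewrite -inc//; first by rewrite c0 scale1r Y0.
    move=> t /andP[t0 tx]; case: hD Dx => ->; rewrite /= !in_itv/= ?andbT => h0 //.
    by have := lt_le_trans h0 x0; rewrite ltxx.
  have neg : x < 0 -> c - cexp ('i%C * z * x%:C) *: Y x =
      - ('i%C *: bochner `]x, 0[ (fun t => cexp ('i%C * z * t%:C) *: patch0 D F t)).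
    move=> x0; rewrite -inc ?(ltW x0)//; first by rewrite c0 scale1r Y0.
    move=> t /andP[t0 tx]; case: hD Dx => ->; rewrite /= !in_itv/= ?andbT => h0 //.
    by have := lt_trans h0 x0; rewrite ltxx.
  move: (cexp _ *: Y x) pos neg; rewrite /oint /oriented_bochner; move: (bochner _ _) (bochner _ _).
  move=> b1 b2 y pos neg; case: (leP 0 x) => x0; first by rewrite -(pos x0) addrC subrK.
  by rewrite scalerN -(neg x0) opprB addrC subrK.
by apply: ae_mono vY => x vx Dx; rewrite -(YE x Dx); exact: vx.
Qed.

Lemma half_line_infinite D : half_line D -> leb D = +oo%E.
Proof. by move=> [] ->; rewrite lebesgue_measure_itv/= ?ltNyr ?ltry. Qed.

Lemma L2_ae_eq D f g : measurable D -> strongly_measurable D g -> ae_eq_on D f g ->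
  L2 D f -> L2 D g.
Proof.
move=> mD mg fg [mf fi]; split => //; apply: le_lt_trans fi; rewrite le_eqVlt.
apply/orP; left; apply/eqP; apply: ae_eq_integral => //.
- exact: measurable_hnorm2.
- exact: measurable_hnorm2.
- by apply: ae_mono fg => x fgx Dx; rewrite fgx.
Qed.

(** The difference of the two solutions is [e^(-izx) (c2 - c1)], whose norm is at
    least [|c2 - c1|] on a set of infinite measure. *)
Lemma grows_L2_duhamel_uniq D z P c1 c2 : grows D z -> locL2 P ->
  L2 D (duhamel z P c1) -> L2 D (duhamel z P c2) -> c1 = c2.
Proof.
move=> gz PL L1 L2'; have hD := grows_half_line gz; have mD := half_line_measurable hD.
have [md dfin] := L2_lin (-1) mD L1 L2'.
apply/esym/subr0_eq/hnorm_eq0/eqP; rewrite -sqrf_eq0; apply/negP => /negP n0.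
have : (\int[leb]_(x in D) (cst ((hnorm (c2 - c1)) ^+ 2)%:E x) < +oo)%E.
  apply: le_lt_trans dfin; apply: ge0_le_integral => //.
  - by move=> x _; rewrite lee_fin sqr_ge0.
  - exact: measurable_hnorm2.
  move=> x Dx; rewrite lee_fin.
  have -> : -1 *: duhamel z P c1 x + duhamel z P c2 x = cexp (- ('i%C * z * x%:C)) *: (c2 - c1).
    by rewrite /duhamel; move: (cexp _) (oint _ _) => a b; hmodule.
  rewrite hnormZ -/(cabs _) cabs_cexp_Ni exprMn -[leLHS]mul1r ler_wpM2r ?sqr_ge0//.
  rewrite -expRM_natl -expR0 ler_expR mulr_ge0//.
  by case: gz Dx => -[-> z0]; rewrite /= in_itv/= ?andbT => x0;
    [rewrite nmulr_rge0// ltW|rewrite pmulr_rge0// ltW].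
rewrite integral_cst// (_ : _ D = leb D)// half_line_infinite// gt0_muley ?ltxx//.
by rewrite lte_fin lt_neqAle eq_sym n0 sqr_ge0.
Qed.

End HalfLineEquation.
Section Formulas.
Context (R : realType) (E : hilbertType R).
Implicit Types (f F v P : R -> E) (z k : R[i]) (x y t : R) (c : E) (D T : set R).

(** The next lemmas take [e^(-izx)] out of integrals against [e^(iz(t-x))]; this is
    how the closed formulas are recognised as instances of Duhamel's formula. *)
Lemma bochner_kernel z x T f : measurable T ->
  bintegrable T (fun t => cexp ('i%C * z * t%:C) *: f t) ->
  bochner T (fun t => cexp ('i%C * z * (t - x)%:C) *: f t) =
  cexp (- ('i%C * z * x%:C)) *: bochner T (fun t => cexp ('i%C * z * t%:C) *: f t).
Proof.
move=> mT iT; apply: etrans (bochnerZ (cexp (- ('i%C * z * x%:C))) mT iT).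
apply: eq_bochner => t _.
by rewrite scalerA -cexpD; congr (cexp _ *: _); rewrite rmorphB/=; ring.
Qed.

Lemma bochner_kernel_patch0 D z x T F : T `<=` D -> measurable T ->
  bintegrable T (fun t => cexp ('i%C * z * t%:C) *: patch0 D F t) ->
  bochner T (fun t => cexp ('i%C * z * (t - x)%:C) *: F t) =
  cexp (- ('i%C * z * x%:C)) *:
    bochner T (fun t => cexp ('i%C * z * t%:C) *: patch0 D F t).
Proof.
move=> TD mT iT; apply: etrans (bochner_kernel x mT iT).
by apply: eq_bochner => t Tt; rewrite patch0E//; exact: TD.
Qed.

Lemma duhamel_kernel D z F c x : half_line D -> D x -> L2 D F ->
  cexp (- ('i%C * z * x%:C)) *: c -
    'i%C *: oriented_bochner 0 x (fun t => cexp ('i%C * z * (t - x)%:C) *: F t) =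
  duhamel z (patch0 D F) c x.
Proof.
move=> hD Dx FL; have PL := patch0_locL2 hD FL.
have GI p q := locL2_bintegrable p q (locL2_cexp ('i%C * z) PL).
have -> : oriented_bochner 0 x (fun t => cexp ('i%C * z * (t - x)%:C) *: F t) =
    cexp (- ('i%C * z * x%:C)) *: oint (fun t => cexp ('i%C * z * t%:C) *: patch0 D F t) x.
  rewrite -[LHS]/(oint _ x) (eq_oint hD Dx (g := fun t => cexp ('i%C * z * (t - x)%:C) *: patch0 D F t)).
    by apply: oint_scale => p q; exact: (bochner_kernel x (measurable_itv _) (GI _ _)).
  by move=> t Dt; rewrite patch0E.
rewrite /duhamel; move: (cexp _) (oint _ _) => a b; hmodule.
Qed.

Lemma H1_data_solves D z F v c : half_line D ->
  H1_data D v c (fun t => - 'i%C *: (F t + z *: v t)) ->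
  ae_eq_on D (fun x => 'i%C *: weak_deriv D v x - z *: v x) F.
Proof.
move=> hD /(H1_data_trace hD)[_]; apply: ae_mono => x wx Dx.
rewrite (wx Dx) scalerA mulrN -expr2 sqr_i opprK scale1r; exact: addrK.
Qed.

End Formulas.

(** * The resolvent of the dilation *)

Section Dilation.
Context (R : realType) (H E Es : hilbertType R).
Context (A : operator H) (Gamma : H -> E) (Gammas : H -> Es).
Context (mu la : R[i]).
Local Notation B := (adjoint A).
Local Notation S := (char_fun A Gamma Gammas).

(** Once the boundary data of the outer components are known, membership in [D(L)]
    concerns vectors of [H], [E] and [Es] only. *)
Lemma L_dom_data vm u vp cm cp vm' vp' (U := Triple vm u vp)
    (um := u + Gsres_adj A Gammas (- mu) cm) (up := u + Gres_adj A Gamma (- la) cp) :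
  H1_data Rneg vm cm vm' -> H1_data Rpos vp cp vp' ->
  L_dom A Gamma Gammas mu la U <->
  [/\ op_dom A um, op_dom B up, cp = badjoint (S (- mu)) cm + 'i%C *: Gamma um &
      cm = S (- conjc la) cp - 'i%C *: Gammas up].
Proof.
move=> mD pD; have hm : half_line (Rneg : set R) by left.
have hp : half_line (Rpos : set R) by right.
rewrite /L_dom /= (H1_data_trace hm mD).1 (H1_data_trace hp pD).1.
split=> [[_ Dm Dp eI eII]|[Dm Dp eI eII]]; split => //.
by split; [exists cm, vm'|exists cp, vp'].
Qed.

Lemma L_equation_data (f : R -> Es) (w : H) (g : R -> E) (vm : R -> Es) u
    (vp : R -> E) cm cp z (U := Triple vm u vp)
    (up := u + Gres_adj A Gamma (- la) cp) :
  H1_data Rneg vm cm (fun t => - 'i%C *: (f t + z *: vm t)) ->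
  H1_data Rpos vp cp (fun t => - 'i%C *: (g t + z *: vp t)) ->
  B up + conjc la *: Gres_adj A Gamma (- la) cp = z *: u + w ->
  dilation_eq (triple_subZ (L_fun A Gamma la U) z U) (Triple f w g).
Proof.
move=> mD pD uE; have hm : half_line (Rneg : set R) by left.
have hp : half_line (Rpos : set R) by right.
split.
- exact: (H1_data_solves hm mD).
- by rewrite /= (H1_data_trace hp pD).1 -/up uE addrC addKr.
- exact: (H1_data_solves hp pD).
Qed.

(** The form of any solution of [(L - z) V = (f, w, g)]: the boundary values [cm]
    and [cp] are left to be determined. *)
Lemma L_equation_duhamel f w g z (V : triple H E Es) :
  in_dilation_space (Triple f w g) -> L_dom A Gamma Gammas mu la V ->
  dilation_eq (triple_subZ (L_fun A Gamma la V) z V) (Triple f w g) ->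
  exists cm cp, [/\ L2 Rneg (duhamel z (patch0 Rneg f) cm) /\
                    L2 Rpos (duhamel z (patch0 Rpos g) cp),
    ae_eq_on Rneg (vminus V) (duhamel z (patch0 Rneg f) cm) /\
    ae_eq_on Rpos (vplus V) (duhamel z (patch0 Rpos g) cp),
    op_dom A (vmid V + Gsres_adj A Gammas (- mu) cm) /\
      op_dom B (vmid V + Gres_adj A Gamma (- la) cp),
    cp = badjoint (S (- mu)) cm + 'i%C *: Gamma (vmid V + Gsres_adj A Gammas (- mu) cm) /\
      cm = S (- conjc la) cp - 'i%C *: Gammas (vmid V + Gres_adj A Gamma (- la) cp) &
    B (vmid V + Gres_adj A Gamma (- la) cp) + conjc la *: Gres_adj A Gamma (- la) cp
      = z *: vmid V + w].
Proof.
move=> [fL gL] [[Hm Hp] Dm Dp eI eII] [em eu ep].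
have hm : half_line (Rneg : set R) by left.
have hp : half_line (Rpos : set R) by right.
have am := H1_ode_duhamel hm fL Hm em; have ap := H1_ode_duhamel hp gL Hp ep.
have [Lm _ _] := H1_trace_deriv hm Hm; have [Lp _ _] := H1_trace_deriv hp Hp.
exists (trace0 Rneg (vminus V)), (trace0 Rpos (vplus V)); split => //.
- split.
  + apply: (L2_ae_eq (half_line_measurable hm) _ am Lm).
    by apply: duhamel_measurable; exact: patch0_locL2.
  + apply: (L2_ae_eq (half_line_measurable hp) _ ap Lp).
    by apply: duhamel_measurable; exact: patch0_locL2.
- by move: eu => /= <-; rewrite [RHS]addrC subrK.
Qed.

Hypotheses (hA : maximal_dissipative A)
  (hGamma : boundary_operator 'i%C A Gamma)
  (hGammas : boundary_operator (- 'i%C) (adjoint A) Gammas)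
  (hmu : complex.Im mu < 0) (hla : 0 < complex.Im la).

Let bp := maximal_dissipative_boundary_pair hA hGamma hGammas.

(** The two solutions differ by an element of the domain of [C] in the kernel of
    [C - z]. *)
Lemma shifted_equation_uniq (C : operator H) z k y y' q w : linear_on (op_dom C) C ->
  bijective_at C z -> op_dom C (y + k) -> op_dom C (y' + k) ->
  C (y + k) + q = z *: y + w -> C (y' + k) + q = z *: y' + w -> y = y'.
Proof.
move=> Cl Cz Dy Dy' ey ey'; apply: (addIr k); rewrite -[LHS](resolventK Cl Cz Dy).
rewrite -[RHS](resolventK Cl Cz Dy'); congr resolvent.
have -> : C (y + k) = z *: y + w - q by rewrite -ey addrK.
have -> : C (y' + k) = z *: y' + w - q by rewrite -ey' addrK.
hmodule.
Qed.

(** Only the values of [vm] and [vp] on the half-lines matter, so any functions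
    that agree there with Duhamel's formula may be used. *)
Theorem L_resolvent_upper f w g z (P := patch0 Rpos g)
    (e := 'i%C *: bochner Rpos (fun t => cexp ('i%C * z * t%:C) *: P t))
    (a := resolvent B z w) (cm := - 'i%C *: Gammas a + S z e) vm vp :
  in_dilation_space (Triple f w g) -> 0 < complex.Im z ->
  (forall x, Rneg x -> vm x = duhamel z (patch0 Rneg f) cm x) ->
  (forall x, Rpos x -> vp x = duhamel z P e x) ->
  L_resolvent_at A Gamma Gammas mu la z (Triple f w g)
    (Triple vm (a - badjoint (fun h => Gamma (resolvent A (conjc z) h)) e) vp).
Proof.
move=> fg z0 vmE vpE; have [fL gL] := fg; rewrite /= in fL gL.
have hm : half_line (Rneg : set R) by left.
have hp : half_line (Rpos : set R) by right.
have dm : decays Rneg z by left.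
have gp : grows Rpos z by right.
have mD : H1_data Rneg vm cm (fun t => - 'i%C *: (f t + z *: vm t)).
  by apply: H1_data_duhamel => //; apply: decays_duhamel_L2 => //; exact: patch0_L2.
have eL : L2 Rpos (duhamel z P e) by apply: growsR_L2 => //; exact: patch0_L2.
have pD : H1_data Rpos vp e (fun t => - 'i%C *: (g t + z *: vp t)).
  exact: H1_data_duhamel.
have nla : 0 < complex.Im (- conjc la) by rewrite cImN cImJ opprK.
have nmu : 0 < complex.Im (- mu) by rewrite cImN oppr_gt0.
have [[Dp Bp cmE] [Dm Am eE]] := boundary_solve bp w e z0 nla nmu.
have conj_la : conjc (- conjc la) = - la by rewrite rmorphN/= conjcK.
rewrite !conj_la conjcK scaleNr opprK in Dp Bp cmE Dm Am eE.
set u := a - _; split.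
- by apply/(L_dom_data _ mD pD); split => //; rewrite -scaleNr.
- exact: (L_equation_data mD pD).
move=> V DV eV.
have [cm' [cp' [[_ Lp] [aem aep] [DAm DBp] [eI eII] Be]]] := L_equation_duhamel fg DV eV.
have cpE : cp' = e by exact: (grows_L2_duhamel_uniq gp (patch0_locL2 hp gL)).
rewrite cpE in aep DBp eI eII Be.
have uE : vmid V = u.
  exact: (shifted_equation_uniq (bp_linB bp) (bp_resB bp z0) DBp Dp Be Bp).
have cmE' : cm' = cm by rewrite eII uE; exact: (esym cmE).
split => //.
- by apply: ae_mono aem => x vx Dx; rewrite vx// cmE' /= vmE.
- by apply: ae_mono aep => x vx Dx; rewrite vx// /= vpE.
Qed.

(** Here the boundary value at [0] of [v_-] is the one that is forced; the equation
    for [u] is therefore used in its form with [A], which holds because [V]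
    satisfies the boundary condition for [v_+(0)]. *)
Theorem L_resolvent_lower f w g z (P := patch0 Rneg f)
    (e := - 'i%C *: bochner Rneg (fun t => cexp ('i%C * z * t%:C) *: P t))
    (a := resolvent A z w)
    (cp := 'i%C *: Gamma a + badjoint (S (conjc z)) e) vm vp :
  in_dilation_space (Triple f w g) -> complex.Im z < 0 ->
  (forall x, Rneg x -> vm x = duhamel z P e x) ->
  (forall x, Rpos x -> vp x = duhamel z (patch0 Rpos g) cp x) ->
  L_resolvent_at A Gamma Gammas mu la z (Triple f w g)
    (Triple vm (a - badjoint (fun h => Gammas (resolvent B (conjc z) h)) e) vp).
Proof.
move=> fg z0 vmE vpE; have [fL gL] := fg; rewrite /= in fL gL.
have hm : half_line (Rneg : set R) by left.
have hp : half_line (Rpos : set R) by right.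
have gm : grows Rneg z by left.
have dp : decays Rpos z by right.
have eL : L2 Rneg (duhamel z P e) by apply: growsL_L2 => //; exact: patch0_L2.
have mD : H1_data Rneg vm e (fun t => - 'i%C *: (f t + z *: vm t)).
  exact: H1_data_duhamel.
have pD : H1_data Rpos vp cp (fun t => - 'i%C *: (g t + z *: vp t)).
  by apply: H1_data_duhamel => //; apply: decays_duhamel_L2 => //; exact: patch0_L2.
have nla : 0 < complex.Im (- conjc la) by rewrite cImN cImJ opprK.
have nmu : 0 < complex.Im (- mu) by rewrite cImN oppr_gt0.
have nz : 0 < complex.Im (conjc z) by rewrite cImJ oppr_gt0.
have nmu' : 0 < complex.Im (conjc (- conjc mu)) by rewrite rmorphN/= conjcK.
have nla' : 0 < complex.Im (conjc (- la)) by rewrite rmorphN.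
have [[Dm Am cpE] [Dp Bp eE]] := boundary_solve (boundary_pair_swap bp) w e nz nmu' nla'.
have conj_mu : conjc (- conjc mu) = - mu by rewrite rmorphN/= conjcK.
have conj_la : conjc (- la) = - conjc la by rewrite rmorphN.
rewrite !conj_mu !conj_la ?conjcK ?opprK ?scaleNr ?opprK in Dm Am cpE Dp Bp eE.
set u := a - _; split.
- by apply/(L_dom_data _ mD pD); split.
- exact: (L_equation_data mD pD).
move=> V DV eV.
have [cm' [cp' [[Lm _] [aem aep] [DAm DBp] [eI eII] Be]]] := L_equation_duhamel fg DV eV.
have cmE : cm' = e by exact: (grows_L2_duhamel_uniq gm (patch0_locL2 hm fL)).
rewrite cmE in aem DAm eI eII.
have [[_ dA _] _] := hA.
have act : B (vmid V + Gres_adj A Gamma (- la) cp') + conjc la *: Gres_adj A Gamma (- la) cp' =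
    A (vmid V + Gsres_adj A Gammas (- mu) e) + conjc mu *: Gsres_adj A Gammas (- mu) e.
  have := boundary_actions bp (z := - conjc la) (nu := - mu) (u := vmid V) (e := cp') (f := e) dA nla nmu.
  have conj_la' : conjc (- conjc la) = - la by rewrite rmorphN/= conjcK.
  have conj_mu' : conjc (- mu) = - conjc mu by rewrite rmorphN.
  rewrite /= conj_la' conjcK conj_mu' !scaleNr !opprK; exact.
rewrite act in Be.
have uE : vmid V = u.
  exact: (shifted_equation_uniq (bp_linA bp) (bp_resA bp nz) DAm Dm Be Am).
have cpE' : cp' = cp by rewrite eI uE; exact: (esym cpE).
split => //.
- by apply: ae_mono aem => x vx Dx; rewrite vx// /= vmE.
- by apply: ae_mono aep => x vx Dx; rewrite vx// cpE' /= vpE.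
Qed.
End Dilation.
Theorem lemma7p1 (R : realType) (H E Es : hilbertType R)
    (A : operator H) (Gamma : H -> E) (Gammas : H -> Es)
    (hA : maximal_dissipative A)
    (hGamma : boundary_operator 'i%C A Gamma)
    (hGammas : boundary_operator (- 'i%C) (adjoint A) Gammas)
    (mu la : R[i]) (hmu : complex.Im mu < 0) (hla : 0 < complex.Im la)
    (f : R -> Es) (w : H) (g : R -> E)
    (hF : in_dilation_space (Triple f w g)) :
  (forall la0 : R[i], 0 < complex.Im la0 ->
     L_resolvent_at A Gamma Gammas mu la la0 (Triple f w g)
       (Triple
          (fun x =>
             - 'i%C *: (cexp (- ('i%C * la0 * x%:C))
                        *: Gammas (resolvent (adjoint A) la0 w))
             + 'i%C *: char_fun A Gamma Gammas la0
                       (bochner `]0, +oo[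
                          (fun t => cexp ('i%C * la0 * (t - x)%:C) *: g t))
             - 'i%C *: oriented_bochner 0 x
                       (fun t => cexp ('i%C * la0 * (t - x)%:C) *: f t))
          (resolvent (adjoint A) la0 w
             - 'i%C *: badjoint (fun h => Gamma (resolvent A la0^* h))
                       (bochner `]0, +oo[
                          (fun t => cexp ('i%C * la0 * t%:C) *: g t)))
          (fun x =>
             'i%C *: bochner `]x, +oo[
                     (fun t => cexp ('i%C * la0 * (t - x)%:C) *: g t)))) /\
  (forall la0 : R[i], complex.Im la0 < 0 ->
     L_resolvent_at A Gamma Gammas mu la la0 (Triple f w g)
       (Triple
          (fun x =>
             - 'i%C *: bochner `]-oo, x[
                       (fun t => cexp ('i%C * la0 * (t - x)%:C) *: f t))
          (resolvent A la0 w
             + 'i%C *: badjoint (fun h => Gammas (resolvent (adjoint A) la0^* h))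
                       (bochner `]-oo, 0[
                          (fun t => cexp ('i%C * la0 * t%:C) *: f t)))
          (fun x =>
             'i%C *: (cexp (- ('i%C * la0 * x%:C)) *: Gamma (resolvent A la0 w))
             - 'i%C *: badjoint (char_fun A Gamma Gammas la0^*)
                       (bochner `]-oo, 0[
                          (fun t => cexp ('i%C * la0 * (t - x)%:C) *: f t))
             - 'i%C *: oriented_bochner 0 x
                       (fun t => cexp ('i%C * la0 * (t - x)%:C) *: g t)))).

Proof.
have bp := maximal_dissipative_boundary_pair hA hGamma hGammas.
have [fL gL] := hF; rewrite /= in fL gL.
have hm : half_line (Rneg : set R) by left.
have hp : half_line (Rpos : set R) by right.
split=> la0 h0.
- have up0 : 0 < complex.Im (conjc (conjc la0)) by rewrite conjcK.
  have gI := growsR_bintegrable h0 (patch0_L2 hp gL).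
  set gt := bochner Rpos (fun t => cexp ('i%C * la0 * t%:C) *: patch0 Rpos g t).
  have bS := bp_bndS bp h0.
  have bM := badjoint_bounded (bp_bndG bp up0).
  have -> : bochner `]0, +oo[ (fun t => cexp ('i%C * la0 * t%:C) *: g t) = gt.
    by apply: eq_bochner => t Dt; rewrite patch0E.
  rewrite -(bopZ bM); apply: L_resolvent_upper => // x Dx.
  + rewrite -duhamel_kernel//; congr (_ - _).
    have -> : bochner `]0, +oo[ (fun t => cexp ('i%C * la0 * (t - x)%:C) *: g t) =
        cexp (- ('i%C * la0 * x%:C)) *: gt.
      exact: (bochner_kernel_patch0 x (@subset_refl _ _) (measurable_itv _) gI).
    rewrite !(bopZ bS); move: (cexp _) (Gammas _) (char_fun _ _ _ _ _) => a b d; hmodule.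
  + have x0 : 0 < x by move: Dx; rewrite /= in_itv/= andbT.
    rewrite (growsR_duhamel h0 (patch0_L2 hp gL) x0); congr (_ *: _).
    have xD : `]x, +oo[%classic `<=` (Rpos : set R).
      by move=> t; rewrite /= !in_itv/= !andbT; exact: lt_trans.
    apply: (bochner_kernel_patch0 x xD (measurable_itv _)).
    exact: (bintegrable_subset (measurable_itv _) (measurable_itv _) xD gI).
- have dn0 : 0 < complex.Im (conjc la0) by rewrite cImJ oppr_gt0.
  have fI := growsL_bintegrable h0 (patch0_L2 hm fL).
  set ft := bochner Rneg (fun t => cexp ('i%C * la0 * t%:C) *: patch0 Rneg f t).
  have bT := badjoint_bounded (bp_bndS bp dn0).
  have bM := badjoint_bounded (bp_bndGs bp dn0).
  have -> : bochner `]-oo, 0[ (fun t => cexp ('i%C * la0 * t%:C) *: f t) = ft.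
    by apply: eq_bochner => t Dt; rewrite patch0E.
  rewrite -[X in _ + X]opprK -scaleNr -(bopZ bM); apply: L_resolvent_lower => // x Dx.
  + have x0 : x < 0 by move: Dx; rewrite /= in_itv/=.
    rewrite (growsL_duhamel h0 (patch0_L2 hm fL) x0); congr (_ *: _).
    have xD : `]-oo, x[%classic `<=` (Rneg : set R).
      by move=> t; rewrite /= !in_itv/= => tx; exact: lt_trans x0.
    apply: (bochner_kernel_patch0 x xD (measurable_itv _)).
    exact: (bintegrable_subset (measurable_itv _) (measurable_itv _) xD fI).
  + rewrite -duhamel_kernel//; congr (_ - _).
    have -> : bochner `]-oo, 0[ (fun t => cexp ('i%C * la0 * (t - x)%:C) *: f t) =
        cexp (- ('i%C * la0 * x%:C)) *: ft.
      exact: (bochner_kernel_patch0 x (@subset_refl _ _) (measurable_itv _) fI).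
    rewrite !(bopZ bT); move: (cexp _) (Gamma _) (badjoint _ _) => a b d; hmodule.
Qed.
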